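(* Let $\{X_t\}_{t \ge 0}$ be a stationary reversible Markov process with values in a space $S$, with infinitesimal generator $\mathrm{L}$ and carré du champ operator $\Gamma$. Let $F: S \to \mathbb{R}^d$ be in the domain of $\mathrm{L}$ (with $\Gamma(F,F)$ defined) and satisfy $\mathbb{E} F(X_0) = 0$. Suppose that there exist an invertible deterministic matrix $\Lambda \in M_d(\mathbb{R})$, a positive semidefinite deterministic symmetric matrix $\Sigma \in M_d(\mathbb{R})$, an $X_0$-measurable random vector $E_1 \in \mathbb{R}^d$, and an $X_0$-measurable random matrix $E_2 \in M_d(\mathbb{R})$ such that $$\mathrm{L} F(X_0) = -\Lambda F(X_0) + E_1, \qquad \Gamma(F,F)(X_0) = \Lambda \Sigma + E_2,$$ and such that for each $\rho > 0$, $$\lim_{t \to 0^+} \frac{1}{t}\, \mathbb{E}\left[ |F(X_t) - F(X_0)|^2\, \mathbf{1}_{\{|F(X_t) - F(X_0)| > \rho\}} \right] = 0.$$ Then for each $g \in C^2(\mathbb{R}^d)$, $$\bigl|\mathbb{E} g(F(X_0)) - \mathbb{E} g(Z_\Sigma)\bigr| \le \|\Lambda^{-1}\|_{op} \left[ \bigl\| |\nabla g| \bigr\|_\infty \mathbb{E}|E_1| + \frac{1}{2} \bigl\| \|D^2 g\|_{HS} \bigr\|_\infty \mathbb{E} \|E_2\|_{HS} \right],$$ where $Z_\Sigma \sim N(0, \Sigma)$ and $D^2 g$ denotes the Hessian matrix of $g$. If $\Sigma$ is nonsingular, then moreover $$d_W(F(X_0), Z_\Sigma) \le \|\Lambda^{-1}\|_{op}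 \left[ \mathbb{E}|E_1| + \|\Sigma^{-1/2}\|_{op}\, \mathbb{E}\|E_2\|_{HS} \right].$$
   Context: Let $\{X_t\}_{t \ge 0}$ be a stationary reversible Markov process on a space $S$ with invariant measure $\mu$ (so $X_0 \sim \mu$, and $(X_0,X_t)$ has the same distribution as $(X_t,X_0)$ for every $t$). Its infinitesimal generator is $$\mathrm{L} f(x) = \lim_{t \to 0^+} \frac{\mathbb{E}[f(X_t) \mid X_0 = x] - f(x)}{t},$$ defined for all $f: S \to \mathbb{R}$ for which this limit exists uniformly in $x$ (these $f$ form the domain of $\mathrm{L}$). The carré du champ operator is $$\Gamma(f,g) = \tfrac{1}{2}\bigl[\mathrm{L}(fg) - f\, \mathrm{L} g - g\, \mathrm{L} f\bigr],$$ defined when $f$, $g$ and $fg$ are in the domain of $\mathrm{L}$. For vector-valued $F, G: S \to \mathbb{R}^d$ these are extended by $(\mathrm{L}F)_j = \mathrm{L}(F_j)$ and $\Gamma(F,G)_{jk} = \Gamma(F_j, G_k)$, so $\mathrm{L}F$ is $\mathbb{R}^d$-valued and $\Gamma(F,G)$ is $M_d(\mathbb{R})$-valued; $F$ is in the domain of $\mathrm{L}$ if each component is. $M_d(\mathbb{R})$ is the space of $d \times d$ real matrices. $|\cdot|$ is the Euclidean norm on $\mathbb{R}^d$, $\|\cdot\|_{op}$ the operator norm, $\|\cdot\|_{HS}$ the Hilbert--Schmidt norm, and $\|\cdot\|_\infty$ the supremum norm of a function on $\mathbb{R}^d$. ''$X_0$-measurable'' means measurable with respect to the $\sigma$-algebra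 generated by $X_0$. The $L^1$-Wasserstein distance between random vectors $X,Y \in \mathbb{R}^d$ is $d_W(X,Y) = \sup_f |\mathbb{E} f(X) - \mathbb{E} f(Y)|$, the supremum being over $1$-Lipschitz $f: \mathbb{R}^d \to \mathbb{R}$. *)

(* Defs.v *)
From HB Require Import structures.
From mathcomp Require Import all_boot all_order all_algebra.
From mathcomp Require Import all_classical all_reals all_analysis.
Import Order.TTheory GRing.Theory Num.Theory.
Import numFieldNormedType.Exports.

Set Implicit Arguments.
Unset Strict Implicit.
Unset Printing Implicit Defensive.

Local Open Scope classical_set_scope.
Local Open Scope ring_scope.

(* R^d is 'cV[R]_d. The norm the library puts on matrices is the max norm; it
   is used below only for the topology and for partial derivatives. *)

(* For n = 1, so for vectors of R^m, this is the Euclidean norm. *)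
Definition hsnorm (R : realType) m n (A : 'M[R]_(m, n)) : R :=
  Num.sqrt (\sum_i \sum_j A i j ^+ 2).

Notation enorm := (@hsnorm _ _ 1) (only parsing).

Definition opnorm (R : realType) d (A : 'M[R]_d) : R :=
  sup [set enorm (A *m v) | v in [set v : 'cV[R]_d | enorm v <= 1]].

Definition psdmx (R : realType) d (A : 'M[R]_d) : Prop :=
  A^T = A /\ forall v : 'cV[R]_d, 0 <= (v^T *m A *m v) 0 0.

(* The sigma-algebra generated by the open sets; as a type it is 'M[R]_(m, n). *)
Definition borelM (R : realType) m n :=
  g_sigma_algebraType (@open 'M[R]_(m, n)).

Notation borelV R d := (borelM R d 1).

Section calculus.
Variables (R : realType) (d : nat).
Implicit Types (g : 'cV[R]_d -> R) (x : 'cV[R]_d).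

Definition partial (j : 'I_d) g x : R := 'D_(delta_mx j 0) g x.

Definition class_C2 g : Prop :=
  [/\ continuous g,
      forall (i : 'I_d) x, derivable g x (delta_mx i 0),
      forall i, continuous (partial i g),
      forall (i j : 'I_d) x, derivable (partial i g) x (delta_mx j 0) &
      forall i j, continuous (partial j (partial i g))].

Definition gradient g x : 'cV[R]_d := \col_j partial j g x.

Definition hessian g x : 'M[R]_d := \matrix_(i, j) partial j (partial i g) x.

Definition supnorm g : \bar R := ereal_sup [set `|g x|%:E | x in setT].

Definition lipschitz1 g : Prop := forall x y, `|g x - g y| <= enorm (x - y).

End calculus.

Section random_vectors.
Variable R : realType.

(* Measurability of E with respect to the sigma-algebra generated by Y. *)
Definition measurable_wrt dT dS dE (T : measurableType dT)
    (S : measurableType dS) (E : measurableType dE) (Y : T -> S) (f : T -> E) :=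
  forall B : set E, measurable B -> g_sigma_algebra_preimage Y (f @^-1` B).

(* The law on R^d of d independent N(0, 1) coordinates. *)
Definition std_normal d (gamma : probability (borelV R d) R) : Prop :=
  forall B : 'I_d -> set R, (forall i, measurable (B i)) ->
    gamma [set v : 'cV[R]_d | forall i, B i (v i 0)] =
    (\prod_(i < d) normal_prob 0 1 (B i))%E.

(* Z ~ N(0, Sigma): Z has the law of A G, with G standard normal and
   A A^T = Sigma. This covers singular Sigma. *)
Definition normal_vector dT (T : measurableType dT) (P : probability T R) d
    (Sigma : 'M[R]_d) (Z : T -> 'cV[R]_d) : Prop :=
  measurable_fun setT (Z : T -> borelV R d) /\
  exists (gamma : probability (borelV R d) R) (A : 'M[R]_d),
    [/\ std_normal gamma, A *m A^T = Sigma &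
        forall C : set (borelV R d), measurable C ->
          P (Z @^-1` C) = gamma [set v : 'cV[R]_d | C (A *m v)]].

Definition wasserstein dT (T : measurableType dT) (P : probability T R)
    dT' (T' : measurableType dT') (P' : probability T' R) d
    (X : T -> 'cV[R]_d) (Y : T' -> 'cV[R]_d) : \bar R :=
  ereal_sup [set `|'E_P[f \o X] - 'E_P'[f \o Y]|%E | f in @lipschitz1 R d].

End random_vectors.

Section markov.
Variables (R : realType) (dS : measure_display) (S : measurableType dS).

(* In what follows p t is the transition kernel over a time t, so that
   E[f(X_t) | X_0 = x] is the integral of f under p t x, for every x. Time is
   indexed by R, but only the values at t >= 0 matter. *)
Implicit Types (p : R -> R.-pker S ~> S) (f g : S -> R).

Definition transition_semigroup p : Prop :=
  (forall x (A : set S), measurable A -> p 0 x A = \d_x A) /\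
  (forall (s t : R) x (A : set S), 0 <= s -> 0 <= t -> measurable A ->
    p (s + t) x A = (\int[p s x]_y p t y A)%E).

Definition past dT (T : measurableType dT) (X : R -> T -> S) (s : R) :
    set (set T) :=
  <<s \bigcup_(u in `[0, s]) g_sigma_algebra_preimage (X u) >>.

Record stationary_reversible_markov dT (T : measurableType dT)
    (P : probability T R) (mu : probability S R) p (X : R -> T -> S) : Prop := {
  markov_measurable : forall t : R, 0 <= t -> measurable_fun setT (X t) ;
  markov_semigroup : transition_semigroup p ;
  markov_property : forall (s t : R) (B : set T) (A : set S), 0 <= s -> 0 <= t ->
    past X s B -> measurable A ->
    P (B `&` X (s + t) @^-1` A) = (\int[P]_(w in B) p t (X s w) A)%E ;
  markov_stationary : forall (t : R) (A : set S), 0 <= t -> measurable A ->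
    P (X t @^-1` A) = mu A ;
  markov_reversible : forall (t : R) (C : set (S * S)), 0 <= t -> measurable C ->
    P [set w | C (X 0 w, X t w)] = P [set w | C (X t w, X 0 w)] }.

Definition cond_exp p (t : R) f (x : S) : R := \int[p t x]_y f y.

Definition difference_quotient p f (t : R) (x : S) : R :=
  (cond_exp p t f x - f x) / t.

(* Outside generator_domain this has an arbitrary value. *)
Definition generator p f (x : S) : R :=
  lim (difference_quotient p f t x @[t --> 0^'+]).

Definition generator_domain p f : Prop :=
  [/\ measurable_fun setT f,
      \forall t \near 0^'+, forall x, (p t x).-integrable setT (EFin \o f) &
      {uniform, difference_quotient p f @ 0^'+ --> generator p f}].

Definition carre_du_champ p f g (x : S) : R :=
  2^-1 * (generator p (f \* g) x - f x * generator p g x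
          - g x * generator p f x).

Definition carre_du_champ_domain p f g : Prop :=
  [/\ generator_domain p f, generator_domain p g &
      generator_domain p (f \* g)].

Section vector_valued.
Variable d : nat.
Implicit Types F G : S -> 'cV[R]_d.

Definition component F (j : 'I_d) : S -> R := fun x => F x j 0.

Definition generatorV p F (x : S) : 'cV[R]_d :=
  \col_j generator p (component F j) x.

Definition generatorV_domain p F : Prop :=
  forall j, generator_domain p (component F j).

Definition carre_du_champV p F G (x : S) : 'M[R]_d :=
  \matrix_(j, k) carre_du_champ p (component F j) (component G k) x.

Definition carre_du_champV_domain p F G : Prop :=
  forall j k, carre_du_champ_domain p (component F j) (component G k).

End vector_valued.

End markov.

(* Main.v *)
(* Write W = F(X_0), let v be a standard Gaussian vector independent of W, and
   let A A^T = Sigma. Rotate W into A v along Y_t = cos t W + sin t A v. In the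
   derivative of E g(Y_t), Gaussian integration by parts turns the A v term into
   sin t cos t E tr(Sigma D^2 g(Y_t)). The other term contains
   W = Lambda^-1 (E_1 - LF(X_0)), and reversibility gives the integration by parts
     E[phi(W) LF_j(X_0)] = - sum_k E[d_k phi(W) Gamma(F_k, F_j)(X_0)],
   whose Lambda Sigma part cancels the Gaussian term. So only E_1 and E_2 remain,
   and integrating over 0 <= t <= pi/2 gives the first bound. For a Lipschitz test
   function a further Gaussian integration by parts removes D^2 g at the price of
   Sigma^(-1/2), and a mollification makes the test function C^2.

   The reversible integration by parts comes from
     2 E[phi(W_0) (W_t - W_0)_j] = - E[(phi(W_t) - phi(W_0)) (W_t - W_0)_j],
   expanded to first order in W_t - W_0 and divided by t; the hypothesis on large
   jumps controls the remainder.

   If sup |grad g| is infinite, the first bound says something only when E_1 = 0;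
   then W is square integrable and linear growth of grad g is enough. If
   sup |D^2 g| is infinite, it says something only when E_2 = 0, and the bound for
   Lipschitz functions applies. If both are infinite, W and Z have the same law. *)

From HB Require Import structures.
Require Import Defs.
From mathcomp Require Import all_boot all_order all_algebra.
From mathcomp Require Import all_classical all_reals all_analysis.
From mathcomp Require Import measurable_realfun ring lra.
Import Order.TTheory GRing.Theory Num.Theory.
Import numFieldNormedType.Exports.

Set Implicit Arguments.
Unset Strict Implicit.
Unset Printing Implicit Defensive.

Local Open Scope classical_set_scope.
Local Open Scope ring_scope.

(** * Euclidean and operator norms *)

(** The rotation, unlike a linear interpolation, keeps the law fixed when W is already N(0, Sigma),
    so its velocity sees only the defects E_1 and E_2; and it uses Sigma only through A A^T, so no
    inverse enters the first bound. The constants are integrals over [0, pi/2]: sin gives 1 for E_1,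
    sin cos gives 1/2 for E_2, and cos gives 1 once an integration by parts has consumed the factor
    sin.

    Integrability is the obstacle that shapes the rest. W is only integrable, LF(X_0) is not known
    to be, and the norms and means of the conclusion may be infinite, with 0 * oo = 0. The
    increments W_t - W_0 are nevertheless square integrable for small t, as soon as Gamma(F_k,
    F_k)(X_0) is integrable for each k. Growth conditions on g carry a factor c1 that makes the
    moment conditions void when the gradient is bounded. When E_1 = 0, square integrability of W is
    itself deduced from the reversible integration by parts, applied to a truncation.

    Gradients of test functions need not be uniformly continuous, so the first-order expansion is
    split according to their local oscillation at W_0. *)

Section linear_algebra.
Variable R : realType.

(** Lagrange's identity: the sum over i, j of (a_i b_j - a_j b_i)^2 equals 2 (A B - C^2), so C^2 <=
    A B. *)
Lemma cauchy_schwarz_sum (I : finType) (a b : I -> R) :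
  `|\sum_i a i * b i| <=
  Num.sqrt (\sum_i a i ^+ 2) * Num.sqrt (\sum_i b i ^+ 2).
Proof.
set A := \sum_i a i ^+ 2; set B := \sum_i b i ^+ 2; set C := \sum_i _.
have A0 : 0 <= A by apply: sumr_ge0 => i _; exact: sqr_ge0.
have B0 : 0 <= B by apply: sumr_ge0 => i _; exact: sqr_ge0.
have key : C ^+ 2 <= A * B.
  have h : 0 <= \sum_i \sum_j (a i * b j - a j * b i) ^+ 2.
    by do 2 apply: sumr_ge0 => ? _; exact: sqr_ge0.
  have E : \sum_i \sum_j (a i * b j - a j * b i) ^+ 2
           = A * B + A * B - (C ^+ 2 + C ^+ 2).
    under eq_bigr => i _.
      under eq_bigr => j _.
        rewrite (_ : _ ^+ 2 = a i ^+ 2 * b j ^+ 2 + b i ^+ 2 * a j ^+ 2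
           - (a i * b i * (a j * b j) + a i * b i * (a j * b j))); last by ring.
        over.
      rewrite big_split /= sumrN !big_split /= -!mulr_sumr -/A -/B -/C.
      over.
    by rewrite big_split /= sumrN !big_split /= -!mulr_suml -/A -/B -/C; ring.
  by move: h; rewrite E; lra.
by rewrite -sqrtrM// -sqrtr_sqr ler_wsqrtr.
Qed.

Lemma hsnorm_ge0 m n (A : 'M[R]_(m, n)) : 0 <= hsnorm A.
Proof. exact: sqrtr_ge0. Qed.

Lemma sqr_hsnorm m n (A : 'M[R]_(m, n)) :
  hsnorm A ^+ 2 = \sum_i \sum_j A i j ^+ 2.
Proof.
by rewrite sqr_sqrtr//; do 2 apply: sumr_ge0 => ? _; exact: sqr_ge0.
Qed.

Lemma sqr_enorm d (v : 'cV[R]_d) : enorm v ^+ 2 = \sum_i v i 0 ^+ 2.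
Proof. by rewrite sqr_hsnorm; apply: eq_bigr => i _; rewrite big_ord1. Qed.

Lemma hsnorm_pair m n (A : 'M[R]_(m, n)) :
  hsnorm A = Num.sqrt (\sum_(p : 'I_m * 'I_n) A p.1 p.2 ^+ 2).
Proof. by rewrite /hsnorm pair_bigA. Qed.

Lemma enormE d (v : 'cV[R]_d) : enorm v = Num.sqrt (\sum_i v i 0 ^+ 2).
Proof. by rewrite -sqr_enorm sqrtr_sqr ger0_norm ?hsnorm_ge0. Qed.

Lemma hsnorm_dot m n (A B : 'M[R]_(m, n)) :
  `|\sum_i \sum_j A i j * B i j| <= hsnorm A * hsnorm B.
Proof.
by rewrite pair_bigA !hsnorm_pair; exact: cauchy_schwarz_sum.
Qed.

Lemma enorm_dot d (u v : 'cV[R]_d) :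
  `|\sum_i u i 0 * v i 0| <= enorm u * enorm v.
Proof. by rewrite !enormE; exact: cauchy_schwarz_sum. Qed.

Lemma ler_entry_hsnorm m n (A : 'M[R]_(m, n)) i j : `|A i j| <= hsnorm A.
Proof.
rewrite hsnorm_pair -sqrtr_sqr ler_wsqrtr// (bigD1 (i, j))//= lerDl.
by apply: sumr_ge0 => ? _; exact: sqr_ge0.
Qed.

Lemma hsnormN m n (A : 'M[R]_(m, n)) : hsnorm (- A) = hsnorm A.
Proof.
rewrite !hsnorm_pair; congr Num.sqrt.
by apply: eq_bigr => ? _; rewrite mxE sqrrN.
Qed.

Lemma hsnormZ m n (c : R) (A : 'M[R]_(m, n)) : hsnorm (c *: A) = `|c| * hsnorm A.
Proof.
rewrite !hsnorm_pair -[`|c|]sqrtr_sqr -sqrtrM ?sqr_ge0//; congr Num.sqrt.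
by rewrite mulr_sumr; apply: eq_bigr => ? _; rewrite mxE exprMn.
Qed.

Lemma hsnorm0 m n : hsnorm (0 : 'M[R]_(m, n)) = 0.
Proof. by rewrite -(scale0r 0) hsnormZ normr0 mul0r. Qed.

Lemma hsnorm_eq0 m n (A : 'M[R]_(m, n)) : hsnorm A = 0 -> A = 0.
Proof.
move=> A0; apply/matrixP => i j; rewrite mxE; apply/eqP.
by rewrite -normr_le0 -A0 ler_entry_hsnorm.
Qed.

(** The square of |A + B| is the inner product of A + B with A plus that with B; Cauchy-Schwarz
    bounds each, and one factor |A + B| cancels. *)
Lemma hsnormD m n (A B : 'M[R]_(m, n)) : hsnorm (A + B) <= hsnorm A + hsnorm B.
Proof.
have [AB0|AB0] := eqVneq (hsnorm (A + B)) 0.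
  by rewrite AB0 addr_ge0 ?hsnorm_ge0.
have ABp : 0 < hsnorm (A + B) by rewrite lt_neqAle eq_sym AB0 hsnorm_ge0.
rewrite -(ler_pM2l ABp) -expr2 sqr_hsnorm mulrDr.
under eq_bigr => i _.
  under eq_bigr => j _ do rewrite expr2 {2}[(A + B) i j]mxE mulrDr.
  rewrite big_split /=; over.
rewrite big_split /=.
by apply: lerD; apply: le_trans (ler_norm _) _; exact: hsnorm_dot.
Qed.

Lemma hsnorm_le_sum m n (A : 'M[R]_(m, n)) :
  hsnorm A <= \sum_i \sum_j `|A i j|.
Proof.
rewrite pair_bigA/= -[leRHS]ger0_norm; last first.
  by apply: sumr_ge0 => ? _; exact: normr_ge0.
rewrite -sqrtr_sqr hsnorm_pair ler_wsqrtr// [leRHS]expr2 mulr_suml.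
apply: ler_sum => p _; rewrite -real_normK ?num_real// expr2 ler_wpM2l//.
by rewrite (bigD1 p)//= lerDl; apply: sumr_ge0 => ? _; exact: normr_ge0.
Qed.

Lemma hsnorm_tr m n (A : 'M[R]_(m, n)) : hsnorm A^T = hsnorm A.
Proof.
rewrite /hsnorm exchange_big; congr Num.sqrt.
by apply: eq_bigr => i _; apply: eq_bigr => j _; rewrite mxE.
Qed.

Lemma enorm_mulmx_le m n (A : 'M[R]_(m, n)) (v : 'cV[R]_n) :
  enorm (A *m v) <= hsnorm A * enorm v.
Proof.
rewrite enormE /hsnorm -sqrtrM; last first.
  by do 2 apply: sumr_ge0 => ? _; exact: sqr_ge0.
apply: ler_wsqrtr; rewrite mulr_suml; apply: ler_sum => i _.
rewrite mxE -real_normK ?num_real//.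
apply: (@le_trans _ _ ((Num.sqrt (\sum_j A i j ^+ 2) * enorm v) ^+ 2)).
  rewrite lerXn2r ?nnegrE ?mulr_ge0 ?sqrtr_ge0// enormE.
  exact: cauchy_schwarz_sum.
rewrite exprMn sqr_sqrtr ?sqr_hsnorm//.
by apply: sumr_ge0 => ? _; exact: sqr_ge0.
Qed.

Let opset d (A : 'M[R]_d) :=
  [set enorm (A *m v) | v in [set v : 'cV[R]_d | enorm v <= 1]].

(** [sup] takes a default value on sets without a supremum; here the Hilbert-Schmidt norm is an
    upper bound. *)
Let opset_has_sup d (A : 'M[R]_d) : has_sup (opset A).
Proof.
split; first by exists (enorm (A *m 0)); exists 0 => //=; rewrite hsnorm0.
exists (hsnorm A) => _ [v /= v1 <-]; apply: le_trans (enorm_mulmx_le _ _) _.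
by rewrite ler_piMr ?hsnorm_ge0.
Qed.

Lemma opnorm_ge0 d (A : 'M[R]_d) : 0 <= opnorm A.
Proof.
apply: (@le_trans _ _ (enorm (A *m 0))); first exact: hsnorm_ge0.
apply: sup_upper_bound; first exact: opset_has_sup.
by exists 0 => //=; rewrite hsnorm0.
Qed.

Lemma enorm_opnorm d (A : 'M[R]_d) (v : 'cV[R]_d) :
  enorm (A *m v) <= opnorm A * enorm v.
Proof.
have [v0|v0] := eqVneq (enorm v) 0.
  by rewrite (hsnorm_eq0 v0) mulmx0 hsnorm0 mulr0.
have vp : 0 < enorm v by rewrite lt_neqAle eq_sym v0 hsnorm_ge0.
rewrite -ler_pdivrMr//.
have -> : enorm (A *m v) / enorm v = enorm (A *m ((enorm v)^-1 *: v)).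
  by rewrite -scalemxAr hsnormZ normfV ger0_norm ?hsnorm_ge0// mulrC.
apply: sup_upper_bound; first exact: opset_has_sup.
exists ((enorm v)^-1 *: v) => //=.
by rewrite hsnormZ normfV ger0_norm ?hsnorm_ge0// mulVf.
Qed.

Lemma opnorm_eq0 d (A : 'M[R]_d) : opnorm A = 0 -> A = 0.
Proof.
move=> A0; apply/matrixP => i j.
have := enorm_opnorm A (delta_mx j 0); rewrite A0 mul0r => h.
have /hsnorm_eq0/matrixP/(_ i 0) : enorm (A *m delta_mx j 0) = 0.
  by apply/eqP; rewrite eq_le h hsnorm_ge0.
by rewrite -colE !mxE.
Qed.

(** The dimension is a successor because the empty matrix is invertible and has norm 0. *)
Lemma opnorm_unitmx_gt0 d (A : 'M[R]_d.+1) : A \in unitmx -> 0 < opnorm A.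
Proof.
move=> uA; rewrite lt_neqAle opnorm_ge0 andbT eq_sym.
apply: contraTneq uA => /opnorm_eq0 ->.
by rewrite unitmxE det0 unitr0.
Qed.

(** The squared Hilbert-Schmidt norm is the sum of the squared Euclidean norms of the columns, and
    [A] acts on each column separately. *)
Lemma hsnorm_mulmx_le d n (A : 'M[R]_d) (B : 'M[R]_(d, n)) :
  hsnorm (A *m B) <= opnorm A * hsnorm B.
Proof.
rewrite -[opnorm A]ger0_norm ?opnorm_ge0// -[`|opnorm A|]sqrtr_sqr.
rewrite /hsnorm -sqrtrM ?sqr_ge0//; apply: ler_wsqrtr.
rewrite exchange_big [in leRHS]exchange_big mulr_sumr; apply: ler_sum => j _.
have -> : \sum_i (A *m B) i j ^+ 2 = enorm (A *m col j B) ^+ 2.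
  by rewrite sqr_enorm; apply: eq_bigr => i _; rewrite colE mulmxA -colE [col _ _ _ _]mxE.
have -> : \sum_i B i j ^+ 2 = enorm (col j B) ^+ 2.
  by rewrite sqr_enorm; apply: eq_bigr => i _; rewrite mxE.
rewrite -exprMn lerXn2r ?nnegrE ?mulr_ge0 ?hsnorm_ge0 ?opnorm_ge0//.
exact: enorm_opnorm.
Qed.

End linear_algebra.

(** * Differentiable and Lipschitz functions on R^d *)

Section partial_derivatives.
Variable R : realType.

Lemma cvg_is_derive (V W : normedModType R) (f : V -> W) x v df :
  h^-1 *: (f (h *: v + x) - f x) @[h --> 0^'] --> df -> is_derive x v f df.
Proof.
move=> h; apply: DeriveDef; last exact: cvg_lim h.
by apply/cvg_ex; exists df.
Qed.

Lemma is_derive_cvg_quotient (V W : normedModType R) (f : V -> W) x v df :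
  is_derive x v f df -> h^-1 *: (f (h *: v + x) - f x) @[h --> 0^'] --> df.
Proof. by move=> [fx <-]; apply: cvgP fx. Qed.

(** One form for increments of either sign; of the intermediate point only |t| <= |h| is
    retained. *)
Lemma mvt0 (f df : R -> R) h : (forall t : R, is_derive t (1 : R) f (df t)) ->
  exists2 t, `|t| <= `|h| & f h - f 0 = df t * h.
Proof.
move=> fdf.
have cf : continuous f.
  by move=> t; apply/differentiable_continuous/derivable1_diffP; case: (fdf t).
have [h0|h0] := leP 0 h.
  have [|t] := @MVT_segment _ f df 0 h h0 (fun t _ => fdf t).
    exact: continuous_subspaceT cf.
  rewrite in_itv/= => /andP[t0 th] E; exists t; last by rewrite E subr0.
  by rewrite !ger0_norm.
have [|t] := @MVT_segment _ f df h 0 (ltW h0) (fun t _ => fdf t).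
  exact: continuous_subspaceT cf.
rewrite in_itv/= => /andP[th t0] E; exists t.
  by rewrite (ler0_norm t0) (ler0_norm (ltW h0)) lerN2.
by apply: oppr_inj; rewrite opprB E sub0r mulrN.
Qed.

Section dim.
Variable d : nat.
Implicit Types (g : 'cV[R]_d -> R) (x y : 'cV[R]_d).

Definition class_C1 g : Prop :=
  (forall i x, derivable g x (delta_mx i 0)) /\
  (forall i, continuous (partial i g)).

(** No sign is imposed on [a], whence the absolute values [|a|] in the bounds below. *)
Definition euclid_lipschitz (a : R) g : Prop :=
  forall x y, `|g x - g y| <= a * enorm (x - y).

Lemma is_derive_line g x v : (forall t, derivable g (x + t *: v) v) ->
  forall t, is_derive t (1 : R) (fun t => g (x + t *: v)) ('D_v g (x + t *: v)).
Proof.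
move=> dg t; apply: cvg_is_derive.
have := is_derive_cvg_quotient (derivableP (dg t)).
rewrite [X in X @ _ --> _ -> _](_ : _ =
  (fun h => h^-1 *: (g (x + (h *: 1 + t) *: v) - g (x + t *: v))))//.
apply/funext => h; congr (_ *: (g _ - _)).
by rewrite [h *: 1]mulr1 scalerDl addrCA.
Qed.

Let mix x y (k : nat) : 'cV[R]_d := \col_i (if (i < k)%N then y i 0 else x i 0).

(** An axis-parallel path from [x] to [y], with corners [mix], changes one coordinate at a time. The
    one-variable mean value theorem on each edge gives [xi k], and the increments telescope. Only
    derivatives along the axes occur, so total differentiability is never invoked. *)
Lemma mean_value_partial g x y :
    (forall i x, derivable g x (delta_mx i 0)) ->
  exists xi : 'I_d -> 'cV[R]_d,
    (forall k i, `|xi k i 0 - x i 0| <= `|y i 0 - x i 0|) /\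
    g y - g x = \sum_k partial k g (xi k) * (y k 0 - x k 0).
Proof.
move=> dg.
have mixS (k : 'I_d) : mix x y k.+1 = mix x y k + (y k 0 - x k 0) *: delta_mx k 0.
  apply/matrixP => i j; rewrite !mxE !ord1 eqxx andbT.
  have [->|ik] := eqVneq i k; first by rewrite ltnS leqnn ltnn mulr1 addrC subrK.
  rewrite mulr0 addr0 ltnS leq_eqVlt.
  by rewrite (negbTE (_ : nat_of_ord i != k))//.
have step (k : 'I_d) : exists xi : 'cV[R]_d,
    (forall i, `|xi i 0 - x i 0| <= `|y i 0 - x i 0|) /\
    g (mix x y k.+1) - g (mix x y k) = partial k g xi * (y k 0 - x k 0).
  have [t th E] := mvt0 (y k 0 - x k 0)
    (is_derive_line (fun t => dg k (mix x y k + t *: delta_mx k 0))).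
  exists (mix x y k + t *: delta_mx k 0); split; last first.
    by rewrite mixS -E scale0r addr0.
  move=> i; rewrite !mxE !eqxx andbT.
  have [->|ik] := eqVneq i k; first by rewrite ltnn mulr1 addrAC subrr add0r.
  by rewrite mulr0 addr0; case: ifP => // _; rewrite subrr normr0.
have [xi xiP] := choice step.
exists xi; split; first by move=> k; have [] := xiP k.
rewrite -(eq_bigr _ (fun k _ => (xiP k).2)).
rewrite -(big_mkord xpredT (fun k => g (mix x y k.+1) - g (mix x y k))).
rewrite telescope_sumr//; congr (g _ - g _); apply/matrixP => i j.
  by rewrite mxE ltn_ord ord1.
by rewrite mxE ltn0 ord1.
Qed.

Lemma nbhs_coord x (A : set 'cV[R]_d) : nbhs x A ->
  exists2 e : R, 0 < e &
    forall y, (forall i, `|y i 0 - x i 0| < e) -> A y.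
Proof.
move=> /nbhs_ballP[e /= e0 eA]; exists e => // y h; apply: eA.
split => // i j; rewrite ord1 /ball/= distrC; exact: h.
Qed.

(** The chain rule. The mean value formula writes the difference quotient as a sum of partial
    derivatives at points squeezed towards [y t], times the difference quotients of the coordinates;
    continuity of the partial derivatives gives the limit. *)
Lemma is_derive_path g (y : R -> 'cV[R]_d) (t : R) (dy : 'I_d -> R) :
    class_C1 g -> (forall k, is_derive t (1 : R) (fun s => y s k 0) (dy k)) ->
  is_derive t (1 : R) (g \o y) (\sum_k partial k g (y t) * dy k).
Proof.
move=> [dg cg] hy; apply: cvg_is_derive.
have [xi xiP] := choice (fun h : R => mean_value_partial (y t) (y (h *: 1 + t)) dg).
rewrite [X in X @ _ --> _](_ : _ = fun h => \sum_k (partial k g (xi h k) *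
   (h^-1 *: (y (h *: 1 + t) k 0 - y t k 0)))); last first.
  apply/funext => h; rewrite /= (xiP h).2 scaler_sumr.
  by apply: eq_bigr => k _; rewrite scalerAr.
have hsum : forall (r : seq 'I_d),
  \sum_(k <- r) (partial k g (xi h k) *
   (h^-1 *: (y (h *: 1 + t) k 0 - y t k 0))) @[h --> 0^'] -->
  \sum_(k <- r) partial k g (y t) * dy k.
  elim=> [|k r ih]; first by under eq_fun do rewrite big_nil; rewrite big_nil; exact: cvg_cst.
  under eq_fun do rewrite big_cons; rewrite big_cons.
  apply: cvgD ih; apply: cvgM; last exact: is_derive_cvg_quotient.
  apply/cvgrPdist_lt => e e0.
  have /cvgrPdist_lt/(_ _ e0)/nbhs_coord[r' r'0 hr'] := cg k (y t).
  have : \forall h \near 0^', forall i, `|y (h *: 1 + t) i 0 - y t i 0| < r'.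
    apply: filter_forall => i.
    have ci : {for t, continuous (fun s => y s i 0)}.
      by apply/differentiable_continuous/derivable1_diffP; case: (hy i).
    move/cvgrPdist_lt : ci => /(_ _ r'0)/nbhs_ballP[u /= u0 hu].
    near=> h; rewrite distrC; apply: hu; rewrite /ball/= opprD addrC subrK.
    by rewrite normrN [h *: 1]mulr1; near: h; exact: dnbhs0_lt.
  apply: filterS => h hi; apply: hr' => i; apply: le_lt_trans (hi i).
  by have [] := xiP h.
exact: hsum.
Unshelve. all: by end_near. Qed.

End dim.
End partial_derivatives.

Section lipschitz_C1.
Variables (R : realType) (d : nat).
Implicit Types (g : 'cV[R]_d -> R) (x y v : 'cV[R]_d) (a e : R).

Lemma is_derive_segment g x v (t : R) : class_C1 g ->
  is_derive t (1 : R) (fun s => g (x + s *: v))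
    (\sum_k partial k g (x + t *: v) * v k 0).
Proof.
move=> C1g; apply: (@is_derive_path _ _ g (fun s => x + s *: v)) => // k.
rewrite (_ : (fun s => _) = cst (x k 0) + v k 0 *: (@id R)); last first.
  by apply/funext => s; rewrite !mxE mulrC.
have := is_deriveD (is_derive_cst (x k 0) t (1:R)) (is_deriveZ (v k 0) (is_derive_id t (1:R))).
by rewrite add0r [_ *: _]mulr1.
Qed.

(** The first-order remainder is measured by the oscillation of the gradient on a box about [x]
    reaching to [y], since the intermediate points lie in that box. *)
Lemma C1_remainder g x y e : (forall i (z : 'cV[R]_d), derivable g z (delta_mx i 0)) ->
    (forall k (z : 'cV[R]_d), (forall i, `|z i 0 - x i 0| <= `|y i 0 - x i 0|) ->
      `|partial k g z - partial k g x| <= e) ->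
  `|g y - g x - \sum_k partial k g x * (y k 0 - x k 0)| <=
  e * \sum_k `|y k 0 - x k 0|.
Proof.
move=> dg he; have [xi [xiP ->]] := mean_value_partial x y dg.
rewrite -sumrB mulr_sumr; apply: le_trans (ler_norm_sum _ _ _) _.
apply: ler_sum => k _; rewrite -mulrBl normrM ler_wpM2r//.
exact/he/xiP.
Qed.

(** The mean value theorem on the segment, rather than on the axis-parallel path, yields the
    constant [a] without a factor depending on the dimension. *)
Lemma gradient_euclid_lipschitz g a : class_C1 g ->
  (forall x, enorm (gradient g x) <= a) -> euclid_lipschitz a g.
Proof.
move=> C1g ga x y.
have [t _] := mvt0 1 (fun t => is_derive_segment y (x - y) t C1g).
rewrite scale1r scale0r addr0 [y + _]addrC subrK mulr1 => ->.
rewrite (eq_bigr (fun k => gradient g (y + t *: (x - y)) k 0 * (x - y) k 0)).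
  by apply: le_trans (enorm_dot _ _) _; rewrite ler_wpM2r// hsnorm_ge0.
by move=> k _; rewrite [gradient _ _ _ _]mxE.
Qed.

Lemma lipschitz_derive_le g a x v (D : R) : euclid_lipschitz a g ->
  h^-1 *: (g (h *: v + x) - g x) @[h --> 0^'] --> D -> `|D| <= a * enorm v.
Proof.
move=> ga gD.
have h1 : `|h^-1 *: (g (h *: v + x) - g x)| @[h --> 0^'] --> `|D|.
  exact: cvg_norm gD.
apply: (@cvgr_to_le _ _ _ _ _ _ _ h1); near=> h.
have h0 : h != 0 by near: h; exact: nbhs_dnbhs_neq.
rewrite normrZ normfV mulrC ler_pdivrMr ?normr_gt0//.
apply: le_trans (ga _ _) _.
by rewrite addrK hsnormZ mulrCA mulrC.
Unshelve. all: by end_near. Qed.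

Lemma lipschitz_partial_le g a k x : euclid_lipschitz a g ->
  derivable g x (delta_mx k 0) -> `|partial k g x| <= a.
Proof.
move=> ga /derivableP/is_derive_cvg_quotient h.
apply: le_trans (lipschitz_derive_le ga h) _.
rewrite enormE (bigD1 k)//= big1 ?addr0; last first.
  by move=> i ik; rewrite mxE (negbTE ik) expr0n.
by rewrite mxE !eqxx expr1n sqrtr1 mulr1.
Qed.

(** The derivative in the direction of the gradient is |grad g|^2, and it is at most a |grad g|. *)
Lemma lipschitz_gradient_le g a x : 0 <= a -> class_C1 g ->
  euclid_lipschitz a g -> enorm (gradient g x) <= a.
Proof.
move=> a0 C1g ga.
have : h^-1 *: (g (h *: gradient g x + x) - g x) @[h --> 0^'] -->
    \sum_k partial k g x * gradient g x k 0.
  have := is_derive_cvg_quotient (is_derive_segment x (gradient g x) 0 C1g).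
  rewrite scale0r addr0 [X in X @ _ --> _ -> _](_ : _ = (fun h : R =>
    h^-1 *: (g (h *: gradient g x + x) - g x)))//; apply/funext => h.
  by rewrite ?addr0 [h *: 1]mulr1 (addrC x).
move=> /(lipschitz_derive_le ga).
rewrite (_ : \sum_k _ = enorm (gradient g x) ^+ 2); last first.
  by rewrite sqr_enorm; apply: eq_bigr => k _; rewrite !mxE expr2.
rewrite ger0_norm ?sqr_ge0// expr2.
have [->//|g0] := eqVneq (enorm (gradient g x)) 0.
by rewrite ler_pM2r// lt_neqAle eq_sym g0 hsnorm_ge0.
Qed.

Lemma enorm_le_sum v : enorm v <= \sum_i `|v i 0|.
Proof.
by apply: le_trans (hsnorm_le_sum _) _; apply: ler_sum => i _; rewrite big_ord1.
Qed.

Lemma enorm_near x e : 0 < e -> \forall y \near x, enorm (x - y) < e.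
Proof.
move=> e0.
(* Neighbourhoods are those of the max norm. Dividing by d + 1 rather than d keeps the final
   inequality strict and covers d = 0. *)
have e1 : 0 < e / (d.+1)%:R by rewrite divr_gt0// ltr0n.
near=> y; apply: le_lt_trans (enorm_le_sum _) _.
apply: (@le_lt_trans _ _ (\sum_(i < d) (e / (d.+1)%:R))).
  apply: ler_sum => i _; rewrite !mxE ltW//; move: i.
  near: y; apply/nbhs_ballP; exists (e / (d.+1)%:R) => //= y [_ h] i.
  exact: h.
rewrite sumr_const card_ord -[X in X < _]mulr_natr -mulrA gtr_pMr//.
by rewrite mulrC ltr_pdivrMr ?ltr0n// mul1r ltr_nat.
Unshelve. all: by end_near. Qed.

Lemma euclid_lipschitz_continuous g a : euclid_lipschitz a g -> continuous g.
Proof.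
move=> ga x; apply/(@cvgrPdist_lt _ _ _ (nbhs x) (nbhs_filter x)) => e e0.
have a1 : 0 < `|a| + 1 by rewrite ltr_wpDl.
near=> y; have : enorm (x - y) < e / (`|a| + 1).
  by near: y; apply: enorm_near; exact: divr_gt0.
rewrite ltr_pdivlMr// => h; apply: le_lt_trans (ga x y) (le_lt_trans _ h).
by rewrite mulrC ler_wpM2l ?hsnorm_ge0// (le_trans (ler_norm a))// lerDl.
Unshelve. all: by end_near. Qed.

Lemma enorm_lipschitz : euclid_lipschitz 1 (fun x : 'cV[R]_d => enorm x).
Proof.
have h x y : enorm x - enorm y <= enorm (x - y).
  by rewrite lerBlDr -{1}(subrK y x); exact: hsnormD.
move=> x y; rewrite mul1r ler_norml h andbT lerNl opprB.
by rewrite -(hsnormN (x - y)) opprB h.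
Qed.

Lemma enorm_continuous : continuous (fun x : 'cV[R]_d => enorm x).
Proof. exact: (euclid_lipschitz_continuous enorm_lipschitz). Qed.

Lemma class_C2_C1 g : class_C2 g -> class_C1 g /\ forall i, class_C1 (partial i g).
Proof.
by case=> _ dg cg dpg cpg; exact: (conj (conj dg cg)
  (fun i => conj (dpg i) (cpg i))).
Qed.

End lipschitz_C1.

(** * Mollification of Lipschitz functions *)

Section steklov_average.
Variable R : realType.
Notation leb := (@lebesgue_measure R).

Lemma itv01_measure : leb `[0%R, 1%R] = 1%E.
Proof. by rewrite lebesgue_measure_itv/= lte01 oppr0 adde0. Qed.

Lemma continuous_itv_integrable (f : R -> R) (a b : R) : continuous f ->
  leb.-integrable `[a, b] (EFin \o f).
Proof.
move=> cf; apply: continuous_compact_integrable; first exact: segment_compact.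
exact: continuous_subspaceT.
Qed.

Lemma is_derive_affine_comp (F : R -> R) (a b s D : R) :
  is_derive (a + b * s) (1 : R) F D ->
  is_derive s (1 : R) (fun s => F (a + b * s)) (D * b).
Proof.
move=> FD; have h : is_derive s (1 : R) (fun s => a + b * s) b.
  have := is_deriveD (is_derive_cst a s (1:R))
    (is_deriveZ b (is_derive_id s (1:R))).
  by rewrite add0r [_ *: _]mulr1.
exact: (@is_derive1_comp _ F (fun s => a + b * s) _ _ _ FD h).
Qed.

(** With H a primitive of G, the average is (H(t + e) - H(t)) / e near t = 0. *)
Lemma is_derive_average (G : R -> R) e : continuous G -> 0 < e -> e <= 1 ->
  is_derive (0 : R) (1 : R)
    (fun t => \int[leb]_(s in `[0%R, 1%R]) G (t + e * s)) (e^-1 * (G e - G 0)).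
Proof.
move=> cG e0 e1.
(* The base point -3 leaves room: for |t| < 1, -1 < s < 2 and 0 < e <= 1 the point t + e s stays in
   ]-3, 3[, where H is differentiable. *)
pose H (u : R) : R := \int[leb]_(t in `[- 3%:R, u]) G t.
have dH (u : R) : -3 < u -> u < 3 -> is_derive u (1 : R) H (G u).
  move=> u1 u2.
  have [|dH DH] := continuous_FTC1_closed u2 _ u1 (cG u).
    exact: continuous_itv_integrable.
  by apply: DeriveDef; [exact: dH|rewrite -derive1E; exact: DH].
have dHe (t s : R) : -1 < t -> t < 1 -> -1 < s -> s < 2 ->
    is_derive s (1 : R) (fun s => e^-1 * H (t + e * s)) (G (t + e * s)).
  move=> t1 t2 s1 s2.
  have es1 : - 1 <= e * s by nra.
  have es2 : e * s <= 2 by nra.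
  have /is_derive_affine_comp h : is_derive (t + e * s) (1 : R) H (G (t + e * s)).
    by apply: dH; lra.
  have := is_deriveZ e^-1 h.
  by rewrite [_ *: _]mulrCA mulVf ?mulr1// gt_eqF.
have cHe (t s : R) : -1 < t -> t < 1 -> -1 < s -> s < 2 ->
    {for s, continuous (fun s => e^-1 * H (t + e * s))}.
  move=> t1 t2 s1 s2; apply/differentiable_continuous/derivable1_diffP.
  by case: (dHe _ _ t1 t2 s1 s2).
have E (t : R) : -1 < t -> t < 1 -> e^-1 * (H (t + e * 1) - H (t + e * 0)) =
    \int[leb]_(s in `[0%R, 1%R]) G (t + e * s).
  move=> t1 t2; rewrite /Rintegral.
  rewrite (@continuous_FTC2 _ (fun s => G (t + e * s)) (fun s => e^-1 * H (t + e * s)))//=.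
  - by rewrite mulrBr.
  - apply: continuous_subspaceT => s; apply: continuous_comp; last exact: cG.
    by apply: cvgD; [exact: cvg_cst|apply: cvgM => //; exact: cvg_cst].
  - split => [s||].
    + by rewrite in_itv/= => /andP[s0 s1]; case: (dHe t s _ _ _ _) => //; lra.
    + by apply: cvg_at_right_filter; apply: cHe => //; lra.
    + by apply: cvg_at_left_filter; apply: cHe => //; lra.
  - move=> s; rewrite in_itv/= => /andP[s0 s1]; rewrite derive1E.
    by case: (dHe t s _ _ _ _) => //; lra.
refine (@near_eq_is_derive R R R (fun t : R => e^-1 * (H (e + 1 * t) - H (0 + 1 * t))) _ _ _ _ _ _).
  near=> t; rewrite -E; last 2 first.
  - by near: t; apply: lt_nbhsr; rewrite ltrN10.
  - by near: t; exact: lt_nbhsl.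
  by rewrite mulr1 mulr0 mul1r addr0 add0r (addrC t e).
have h1 := is_derive_affine_comp (a := e) (b := 1) (s := 0) (F := H) (D := G e).
have h2 := is_derive_affine_comp (a := 0) (b := 1) (s := 0) (F := H) (D := G 0).
have := is_deriveZ e^-1 (is_deriveB (h1 _) (h2 _)).
rewrite !mulr1 mulr0 !addr0 => h; apply: h; apply: dH; lra.
Unshelve. all: by end_near. Qed.

End steklov_average.

Section mollification.
Variables (R : realType) (d : nat).
Notation leb := (@lebesgue_measure R).
Implicit Types (g : 'cV[R]_d -> R) (x y : 'cV[R]_d) (a b e : R) (i j k : 'I_d).

Notation dir k := (delta_mx k 0 : 'cV[R]_d).

Lemma is_derive_line0 g x v (D : R) :
  is_derive (0 : R) (1 : R) (fun t => g (x + t *: v)) D -> is_derive x v g D.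
Proof.
move=> /is_derive_cvg_quotient h; apply: cvg_is_derive.
move: h; rewrite [X in X @ _ --> _ -> _](_ : _ =
  (fun h => h^-1 *: (g (h *: v + x) - g x)))//.
apply/funext => h; congr (_ *: (g _ - g _)); last by rewrite scale0r addr0.
by rewrite addr0 [h *: 1]mulr1 addrC.
Qed.

Lemma euclid_lipschitz_line a g x v : euclid_lipschitz a g ->
  continuous (fun s : R => g (x + s *: v)).
Proof.
move=> ga s; apply: (@continuous_comp _ _ _ (fun s : R => x + s *: v) g).
  by apply: cvgD; [exact: cvg_cst|apply: cvgZr_tmp].
exact: euclid_lipschitz_continuous ga _.
Qed.

Lemma enorm_delta k : enorm (dir k) = 1.
Proof.
rewrite enormE (bigD1 k)//= big1 ?addr0; last first.
  by move=> i ik; rewrite mxE (negbTE ik) expr0n.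
by rewrite mxE !eqxx expr1n sqrtr1.
Qed.

(** Convolution with the uniform law on a segment of length [e] in direction [k]. Averaging in one
    coordinate at a time requires only integrals over [0, 1]. *)
Definition steklov e k g x : R :=
  \int[leb]_(s in `[0%R, 1%R]) g (x + (e * s) *: dir k).

Lemma steklov_integrable a e k g x : euclid_lipschitz a g ->
  leb.-integrable `[0%R, 1%R] (EFin \o (fun s => g (x + (e * s) *: dir k))).
Proof.
move=> ga; apply: continuous_itv_integrable => s.
have := @euclid_lipschitz_line a g x (e *: dir k) ga s.
by under eq_fun do rewrite scalerA mulrC.
Qed.

Let le_steklov a (f : R -> R) : leb.-integrable `[0%R, 1%R] (EFin \o f) ->
  (forall s, 0 <= s -> s <= 1 -> `|f s| <= a) ->
  `|\int[leb]_(s in `[0%R, 1%R]) f s| <= a.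
Proof.
move=> fi fa; apply: le_trans (le_normr_Rintegral _ fi) _ => //.
rewrite -[leRHS]mulr1 -[X in _ * X]/(fine 1%:E) -itv01_measure.
rewrite -Rintegral_cst//; apply: le_Rintegral => //.
- exact: integrable_norm fi.
- by apply: continuous_itv_integrable; exact: cst_continuous.
by move=> s; rewrite /= in_itv/= => /andP[s0 s1]; exact: fa.
Qed.

Lemma steklov_lipschitz a e k g : euclid_lipschitz a g ->
  euclid_lipschitz a (steklov e k g).
Proof.
move=> ga x y; have ix := steklov_integrable e k x ga.
have iy := steklov_integrable e k y ga.
rewrite /steklov -RintegralB//; apply: le_steklov.
  exact: integrableB ix iy.
move=> s _ _; apply: le_trans (ga _ _) _.
by rewrite opprD addrACA subrr addr0.
Qed.

Lemma steklov_approx a e k g x : euclid_lipschitz a g -> 0 <= e ->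
  `|steklov e k g x - g x| <= `|a| * e.
Proof.
move=> ga e0; have ix := steklov_integrable e k x ga.
have E : g x = \int[leb]_(s in `[0%R, 1%R]) (cst (g x) s).
  by rewrite Rintegral_cst//= itv01_measure mulr1.
have ic : leb.-integrable `[0%R, 1%R] (EFin \o cst (g x)).
  by apply: continuous_itv_integrable; exact: cst_continuous.
rewrite E /steklov -RintegralB//; apply: le_steklov.
  exact: integrableB ix ic.
move=> s s0 s1; apply: le_trans (ga _ _) _.
rewrite addrAC subrr add0r hsnormZ enorm_delta mulr1 ger0_norm ?mulr_ge0//.
apply: (@le_trans _ _ (`|a| * (e * s))).
  by rewrite ler_wpM2r ?ler_norm// mulr_ge0.
by rewrite ler_wpM2l// ler_piMr.
Qed.

(** In the direction of averaging the derivative is a difference quotient of [g]: it exists, and is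
    again Lipschitz, for a [g] that is merely Lipschitz. *)
Lemma is_derive_steklov_same a e k g x : euclid_lipschitz a g ->
  0 < e -> e <= 1 ->
  is_derive x (dir k) (steklov e k g) (e^-1 * (g (x + e *: dir k) - g x)).
Proof.
move=> ga e0 e1; apply: is_derive_line0.
have := is_derive_average (@euclid_lipschitz_line a g x (dir k) ga) e0 e1.
rewrite scale0r addr0.
rewrite (_ : (fun t => _) = (fun t => steklov e k g (x + t *: dir k)))//.
apply/funext => t; apply: eq_Rintegral => s _.
by rewrite scalerDl addrA.
Qed.

(** In a direction where [g] already has a derivative, averaging commutes with it; the Lipschitz
    constant dominates when differentiating under the integral. *)
Lemma is_derive_steklov a b e k j g x : euclid_lipschitz a g ->
  (forall x, derivable g x (dir j)) -> euclid_lipschitz b (partial j g) ->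
  is_derive x (dir j) (steklov e k g) (steklov e k (partial j g) x).
Proof.
move=> ga dg gb; apply: is_derive_line0; apply: cvg_is_derive.
pose f (t : R) s := g (x + t *: dir j + (e * s) *: dir k).
have df t s : is_derive t (1 : R) (f ^~ s)
    (partial j g (x + t *: dir j + (e * s) *: dir k)).
  have := is_derive_line (g := g) (x := x + (e * s) *: dir k) (v := dir j)
    (fun t => dg _) t.
  rewrite addrAC (_ : (fun t => _) = f ^~ s)//.
  by apply/funext => u; rewrite /f addrAC.
have D1 t s : partial1of2 f t s = partial j g (x + t *: dir j + (e * s) *: dir k).
  by rewrite partial1of2E; case: (df t s).
have I0 : `]-1, 1[%classic (0 : R) by rewrite /= in_itv/= ltrN10 ltr01.
have intf t : `]-1, 1[%classic t -> leb.-integrable `[0%R, 1%R] (EFin \o f t).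
  by move=> _; exact: steklov_integrable ga.
have derf t s : `]-1, 1[%classic t -> `[0%R, 1%R]%classic s -> derivable (f ^~ s) t 1.
  by move=> _ _; case: (df t s).
have G0 : forall s : R, 0 <= cst `|a| s by move=> s /=.
have intG : leb.-integrable `[0%R, 1%R] (EFin \o cst `|a|).
  by apply: continuous_itv_integrable; exact: cst_continuous.
have Gub t s : `]-1, 1[%classic t -> `[0%R, 1%R]%classic s ->
    `|partial1of2 f t s| <= cst `|a| s.
  move=> _ _; rewrite D1; apply: le_trans (ler_norm a).
  exact: lipschitz_partial_le.
have h := @cvg_differentiation_under_integral R _ _ leb f `[0%R, 1%R]
  (measurable_itv _) 0 (- 1) 1 I0 intf derf (cst `|a|) G0 intG Gub.
have E : \int[leb]_(s in `[0%R, 1%R]) partial1of2 f 0 s =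
    steklov e k (partial j g) x.
  by apply: eq_Rintegral => s _; rewrite D1 scale0r addr0.
have FE : (fun h : R => h^-1 *: (steklov e k g (x + (h *: 1 + 0) *: dir j) -
      steklov e k g (x + 0 *: dir j))) =
    (fun h : R => h^-1 *: (\int[leb]_(s in `[0%R, 1%R]) f (h + 0) s -
      \int[leb]_(s in `[0%R, 1%R]) f 0 s)).
  by apply/funext => t; rewrite [t *: 1]mulr1.
by rewrite -E FE; exact: h.
Qed.

(** [J] records the directions already treated; averaging in direction k adds k to it. *)
Definition lipschitz_partials (J : pred 'I_d) g : Prop :=
  forall j, J j -> (forall x, derivable g x (dir j)) /\
    exists b, euclid_lipschitz b (partial j g).

Lemma steklov_partials a e k J g : euclid_lipschitz a g -> 0 < e -> e <= 1 ->
  lipschitz_partials J g ->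
  lipschitz_partials [pred j | (j == k) || J j] (steklov e k g).
Proof.
move=> ga e0 e1 gJ j /=; have [->|jk /=] := eqVneq j k.
  move=> _; split => [x|]; first by case: (is_derive_steklov_same k x ga e0 e1).
  exists (e^-1 * (a + a)) => x y.
  have D z : partial k (steklov e k g) z = e^-1 * (g (z + e *: dir k) - g z).
    by case: (is_derive_steklov_same k z ga e0 e1).
  rewrite !D -mulrBr normrM ger0_norm ?invr_ge0 ?(ltW e0)// -mulrA.
  rewrite ler_wpM2l ?invr_ge0 ?(ltW e0)// opprD opprK addrACA mulrDl.
  apply: le_trans (ler_normD _ _) _; rewrite lerD//; last first.
    by rewrite -normrN opprD opprK; exact: ga.
  by apply: le_trans (ga _ _) _; rewrite opprD addrACA subrr addr0.
move=> /gJ[dg [b gb]]; split => [x|].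
  by case: (is_derive_steklov e k x ga dg gb).
exists b; rewrite (_ : partial j _ = steklov e k (partial j g)).
  exact: steklov_lipschitz.
by apply/funext => x; case: (is_derive_steklov e k x ga dg gb).
Qed.

Definition mollify e (s : seq 'I_d) g := foldr (steklov e) g s.

Lemma mollify_lipschitz a e s g : euclid_lipschitz a g ->
  euclid_lipschitz a (mollify e s g).
Proof. by move=> ga; elim: s => //= k s; exact: steklov_lipschitz. Qed.

Lemma mollify_approx a e s g x : euclid_lipschitz a g -> 0 <= e ->
  `|mollify e s g x - g x| <= `|a| * e * (size s)%:R.
Proof.
move=> ga e0; elim: s => [|k s ih] /=.
  by rewrite subrr normr0 mulr0.
rewrite -(subrK (mollify e s g x) (steklov _ _ _ _)) -addrA.
apply: le_trans (ler_normD _ _) _; rewrite -natr1 mulrDr mulr1 [leRHS]addrC lerD//.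
by apply: steklov_approx => //; exact: mollify_lipschitz.
Qed.

Lemma mollify_partials a e s J g : euclid_lipschitz a g -> 0 < e -> e <= 1 ->
  lipschitz_partials J g ->
  lipschitz_partials [pred j | (j \in s) || J j] (mollify e s g).
Proof.
move=> ga e0 e1 gJ; elim: s => //= k s ih.
have := @steklov_partials a e k _ _ (mollify_lipschitz e s ga) e0 e1 ih.
by move=> h j; rewrite /= inE -orbA; exact: h.
Qed.

Lemma partial_mollify a b e s j g : euclid_lipschitz a g ->
    (forall x, derivable g x (dir j)) -> euclid_lipschitz b (partial j g) ->
  (forall x, derivable (mollify e s g) x (dir j)) /\
  partial j (mollify e s g) = mollify e s (partial j g).
Proof.
move=> ga dg gb; elim: s => //= k s [ih1 ih2].
have h x := @is_derive_steklov a b e k j (mollify e s g) x.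
split => [x|]; last (apply/funext => x; rewrite -ih2).
  case: (h x) => //; first exact: mollify_lipschitz.
  by rewrite ih2; exact: mollify_lipschitz.
case: (h x) => //; first exact: mollify_lipschitz.
by rewrite ih2; exact: mollify_lipschitz.
Qed.

(* One round of averages makes the partial derivatives exist and be Lipschitz;
   a second round, which commutes with them, does the same at order two. *)
Lemma euclid_lipschitz_C2_approx a g e : euclid_lipschitz a g -> 0 < e ->
  exists h, [/\ class_C2 h, euclid_lipschitz a h,
    forall x, `|h x - g x| <= e &
    exists b, forall i j x, `|partial j (partial i h) x| <= b].
Proof.
(* Each of the 2 d averages with step [u] moves the function by at most |a| u; [u] is chosen so that
   the total is at most [e]. The added 1 keeps [C] positive. *)
move=> ga e0; pose C := `|a| * (d%:R + d%:R) + 1.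
have C0 : 0 < C by rewrite ltr_wpDl// mulr_ge0// addr_ge0.
pose u := Num.min 1 (e / C).
have u0 : 0 < u by rewrite lt_min ltr01 divr_gt0.
have u1 : u <= 1 by rewrite ge_min lexx.
have uC : u * C <= e by rewrite -ler_pdivlMr// ge_min lexx orbT.
pose s := enum 'I_d.
pose g1 := mollify u s g; pose g2 := mollify u s g1.
have g1a : euclid_lipschitz a g1 by exact: mollify_lipschitz.
have P1 : lipschitz_partials xpredT g1.
  have h0 : lipschitz_partials xpred0 g by [].
  have h := @mollify_partials _ u s _ _ ga u0 u1 h0.
  by move=> j _; apply: h; rewrite /= mem_enum.
have P2 i : lipschitz_partials xpredT (partial i g2).
  have [dg [b gb]] := P1 i isT.
  have [_ ->] := partial_mollify u s g1a dg gb.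
  have h0 : lipschitz_partials xpred0 (partial i g1) by [].
  have h := @mollify_partials _ u s _ _ gb u0 u1 h0.
  by move=> j _; apply: h; rewrite /= mem_enum.
have dg2 i : (forall x, derivable g2 x (dir i)) /\
    exists b, euclid_lipschitz b (partial i g2).
  have [dg [b gb]] := P1 i isT.
  have [h1 h2] := partial_mollify u s g1a dg gb; split => //.
  by exists b; rewrite h2; exact: mollify_lipschitz.
have g2a : euclid_lipschitz a g2 by exact: mollify_lipschitz.
exists g2; split => //.
- split.
  + exact: euclid_lipschitz_continuous g2a.
  + by move=> i; have [] := dg2 i.
  + by move=> i; have [_ [b hb]] := dg2 i; exact: euclid_lipschitz_continuous hb.
  + by move=> i j; have [] := P2 i j isT.
  + move=> i j; have [_ [b hb]] := P2 i j isT.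
    exact: euclid_lipschitz_continuous hb.
- move=> x; rewrite -(subrK (g1 x) (g2 x)) -addrA; apply: le_trans (ler_normD _ _) _.
  apply: le_trans (lerD (mollify_approx _ _ g1a (ltW u0)) (mollify_approx _ _ ga (ltW u0))) _.
  rewrite size_enum_ord -mulrDr; apply: le_trans uC.
  by rewrite /C [leRHS]mulrDr mulr1 [X in _ <= X + _]mulrCA mulrA lerDl ltW.
- have bd i : exists b, euclid_lipschitz b (partial i g2).
    by have [_] := dg2 i.
  have [b hb] := choice bd.
  exists (\sum_i `|b i|) => i j x.
  apply: (@le_trans _ _ (b i)).
    by apply: lipschitz_partial_le => //; have [] := P2 i j isT.
  by rewrite (bigD1 i)//= (le_trans (ler_norm _))// lerDl sumr_ge0.
Qed.

End mollification.

(** * Laws and integrability *)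

Section law.
Context (R : realType) d1 d2 d3 (T1 : measurableType d1) (T2 : measurableType d2)
  (Y : measurableType d3).
Variables (m1 : {measure set T1 -> \bar R}) (m2 : {measure set T2 -> \bar R}).
Variables (X1 : T1 -> Y) (X2 : T2 -> Y).
Hypotheses (mX1 : measurable_fun setT X1) (mX2 : measurable_fun setT X2).
Hypothesis X12 : forall A, measurable A -> m1 (X1 @^-1` A) = m2 (X2 @^-1` A).

(** Every comparison of laws below goes through this change of variables: (X_0, X_t) with its kernel
    description, (X_0, X_t) with (X_t, X_0), a Gaussian vector with its resampled version, [Z] with
    A v. *)
Lemma law_ge0_integral (f : Y -> \bar R) : measurable_fun setT f ->
  (forall y, 0 <= f y)%E ->
  (\int[m1]_x f (X1 x) = \int[m2]_x f (X2 x))%E.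
Proof.
move=> mf f0.
have := ge0_integral_pushforward mX1 m1 measurableT mf (fun y _ => f0 y).
have := ge0_integral_pushforward mX2 m2 measurableT mf (fun y _ => f0 y).
rewrite !preimage_setT => <- <-.
by apply: eq_measure_integral => A mA _; exact: X12.
Qed.

Lemma law_integral (f : Y -> \bar R) : measurable_fun setT f ->
  (\int[m1]_x f (X1 x) = \int[m2]_x f (X2 x))%E.
Proof.
move=> mf; rewrite [LHS]integralE [RHS]integralE; congr (_ - _)%E.
  transitivity (\int[m1]_x (f^\+ (X1 x)))%E.
    by apply: eq_integral => x _; rewrite !funeposE.
  rewrite law_ge0_integral//; last exact: measurable_funepos.
  by apply: eq_integral => x _; rewrite !funeposE.
transitivity (\int[m1]_x (f^\- (X1 x)))%E.
  by apply: eq_integral => x _; rewrite !funenegE.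
rewrite law_ge0_integral//; last exact: measurable_funeneg.
by apply: eq_integral => x _; rewrite !funenegE.
Qed.

Lemma law_integrable (f : Y -> \bar R) : measurable_fun setT f ->
  m1.-integrable setT (fun x => f (X1 x)) ->
  m2.-integrable setT (fun x => f (X2 x)).
Proof.
move=> mf /integrableP[_ fi]; apply/integrableP; split.
  by apply: measurableT_comp.
rewrite -(@law_ge0_integral (abse \o f))//; last by move=> y; exact: abse_ge0.
exact: measurableT_comp.
Qed.

End law.

Section borel.
Variable R : realType.

Lemma continuous_measurable_borelM m n (g : 'M[R]_(m, n) -> R) : continuous g ->
  measurable_fun setT (g : borelM R m n -> R).
Proof.
move=> /continuousP cg; apply: (measurability _ (RGenOpens.measurableE R)).
move=> _ [_ [a [b ->] <-]]; rewrite setTI; apply: sub_sigma_algebra.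
exact/cg/interval_open.
Qed.

Lemma measurable_continuous_comp dX (X : measurableType dX) m n
    (g : 'M[R]_(m, n) -> R) (f : X -> borelM R m n) : continuous g ->
  measurable_fun setT f -> measurable_fun setT (fun x => g (f x)).
Proof.
move=> cg mf; apply: (@measurableT_comp _ _ _ _ _ _ (g : borelM R m n -> R)) mf.
exact: continuous_measurable_borelM.
Qed.

Lemma measurable_entry m n i j :
  measurable_fun setT (fun M : borelM R m n => M i j : R).
Proof. by apply: continuous_measurable_borelM; exact: coord_continuous. Qed.

Section dim.
Variable d : nat.

Let box (q : 'cV[rat]_d * nat) : set 'cV[R]_d :=
  [set v | forall i, `|v i 0 - ratr (q.1 i 0)| < q.2.+1%:R^-1].

(** An open set is the union of the rational boxes that it contains. The union is countable, so
    measurability of a vector-valued map reduces to that of its coordinates. *)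
Let open_box (U : set 'cV[R]_d) : open U ->
  U = \bigcup_q (if `[< box q `<=` U >] then box q else set0).
Proof.
move=> oU; apply/seteqP; split=> [x Ux|x [q _]]; last first.
  by case: ifPn => // /asboolP; exact.
have /nbhs_coord[e e0 he] : nbhs x U by exact: open_nbhs_nbhs.
have [n n0] : exists n, n.+1%:R^-1 < e / 2.
  exists (Num.truncn (e / 2)^-1).
  rewrite invf_plt ?posrE ?divr_gt0// ?ltr0n//.
  exact: truncnS_gt.
have n1 : 0 < (n.+1%:R^-1 : R) by rewrite invr_gt0 ltr0n.
have hq (i : 'I_d) : exists q : rat, `|x i 0 - ratr q| < n.+1%:R^-1.
  have [|q] := @rat_in_itvoo R (x i 0 - n.+1%:R^-1) (x i 0 + n.+1%:R^-1).
    by rewrite ltrD2l (lt_trans _ n1)// oppr_lt0.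
  rewrite in_itv/= => /andP[q1 q2]; exists q.
  by rewrite ltr_distlC q1 q2.
have [q hq'] := choice hq.
exists (\col_i q i, n) => //.
case: ifPn => [_|/asboolPn []]; first by move=> i; rewrite mxE; exact: hq'.
move=> y hy; apply: he => i.
have := hy i; have := hq' i; rewrite mxE /= => h1 h2.
rewrite (_ : y i 0 - x i 0 = (y i 0 - ratr (q i)) - (x i 0 - ratr (q i))); last by ring.
apply: le_lt_trans (ler_normB _ _) _; rewrite (splitr e).
by apply: ltrD; exact: lt_trans n0.
Qed.

Definition rectangles : set (set 'cV[R]_d) :=
  [set A | exists2 B : 'I_d -> set R, forall i, measurable (B i) &
    A = [set v : 'cV[R]_d | forall i, B i (v i 0)]].

Let measurable_all dT (T : measurableType dT) (P : 'I_d -> set T) :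
  (forall i, measurable (P i)) -> measurable [set w | forall i, P i w].
Proof.
move=> mP; rewrite (_ : [set w | _] = \bigcap_i P i).
  by apply: fin_bigcap_measurable => // i _; exact: mP.
by apply/seteqP; split=> [w h i _|w h i]; exact: h.
Qed.

Lemma measurable_fun_borelV dT (T : measurableType dT) (f : T -> borelV R d) :
  (forall i, measurable_fun setT (fun w => f w i 0 : R)) -> measurable_fun setT f.
Proof.
move=> mf; apply: (@measurability _ _ T (borelV R d) _ f (@open 'cV[R]_d)) => //.
move=> _ [U oU <-]; rewrite setTI (open_box oU) preimage_bigcup.
apply: countable_bigcupT_measurable => // q; case: ifP => _; last first.
  by rewrite preimage_set0; exact: measurable0.
apply: (@measurable_all _ T (fun i w => `|f w i 0 - ratr (q.1 i 0)| < q.2.+1%:R^-1)) => i.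
have mg : measurable_fun setT (fun w => `|f w i 0 - ratr (q.1 i 0)|).
  by apply: measurableT_comp => //; exact: measurable_funB.
have := mg measurableT _ (measurable_itv `]-oo, (q.2.+1%:R^-1 : R)[).
by rewrite setTI; congr measurable.
Qed.

(** One inclusion says that the identity, with the sigma-algebra of rectangles on its source, is
    Borel measurable, which is checked on coordinates. *)
Lemma borelV_rectangles : @measurable _ (borelV R d) = <<s rectangles >>.
Proof.
apply/seteqP; split.
  pose I : g_sigma_algebraType rectangles -> borelV R d := id.
  have mI : measurable_fun setT I.
    apply: measurable_fun_borelV => i _ B mB; rewrite setTI.
    apply: sub_sigma_algebra.
    exists (fun j => if j == i then B else setT).
      by move=> j; case: ifP => _ //; exact: measurableT.
    apply/seteqP; split=> [v Bv j|v /(_ i)]; last by rewrite eqxx.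
    by case: eqP => // ->.
  by move=> A mA; have := mI measurableT A mA; rewrite setTI.
apply: smallest_sub; first exact: sigma_algebra_measurable.
move=> _ [B mB ->]; apply: measurable_all => i.
have := @measurable_entry d 1 i 0 measurableT _ (mB i).
by rewrite setTI.
Qed.

Lemma rectangles_setI : setI_closed rectangles.
Proof.
move=> _ _ [A mA ->] [B mB ->]; exists (fun i => A i `&` B i).
  by move=> i; exact: measurableI.
by apply/seteqP; split=> [v [h1 h2] i|v h]; split; [|..] => // i; have [] := h i.
Qed.

(** Rectangles form a generating pi-system, and they are the sets on which [std_normal] prescribes
    the law. *)
Lemma rectangles_unique (m1 m2 : {measure set (borelV R d) -> \bar R}) :
  (m1 setT < +oo)%E -> (forall A, rectangles A -> m1 A = m2 A) ->
  forall A, measurable A -> m1 A = m2 A.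
Proof.
move=> m1T h A mA; refine (@measure_unique _ R (borelV R d) rectangles
  (fun=> setT) _ _ _ _ m1 m2 h _ A mA).
- exact: borelV_rectangles.
- exact: rectangles_setI.
- move=> _; exists (fun=> setT); first by move=> i; exact: measurableT.
  by apply/seteqP; split.
- by apply/seteqP; split=> // x _; exists 0%N.
- by move=> _.
Qed.

End dim.
End borel.

Notation L1 mu f := (mu.-integrable setT (EFin \o f)).

Section real_integrable.
Context d (T : measurableType d) (R : realType).
Variable mu : {measure set T -> \bar R}.
Implicit Types f g h : T -> R.

Lemma L1_measurable f : L1 mu f -> measurable_fun setT f.
Proof. by move=> /integrableP[/measurable_EFinP]. Qed.

Lemma L1_le f g : measurable_fun setT f -> L1 mu g ->
  (forall x, `|f x| <= g x) -> L1 mu f.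
Proof.
move=> mf gi fg; apply: (le_integrable _ _ _ gi) => //.
  exact/measurable_EFinP.
by move=> x _ /=; rewrite lee_fin (le_trans (fg x))// ler_norm.
Qed.

Lemma L1_ext f g : f =1 g -> L1 mu f -> L1 mu g.
Proof. by move=> fg; rewrite (_ : g = f)//; apply/funext => x; rewrite fg. Qed.

Lemma L1D f g : L1 mu f -> L1 mu g -> L1 mu (fun x => f x + g x).
Proof. by move=> fi gi; have := integrableD measurableT fi gi. Qed.

Lemma L1N f : L1 mu f -> L1 mu (fun x => - f x).
Proof. by move=> fi; have := integrableN fi. Qed.

Lemma L1B f g : L1 mu f -> L1 mu g -> L1 mu (fun x => f x - g x).
Proof. by move=> fi gi; have := integrableB measurableT fi gi. Qed.

Lemma L1Zl c f : L1 mu f -> L1 mu (fun x => c * f x).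
Proof. by move=> fi; have := integrableZl measurableT c fi. Qed.

Lemma L1Zr c f : L1 mu f -> L1 mu (fun x => f x * c).
Proof. by move=> /(L1Zl c); apply: L1_ext => x; rewrite mulrC. Qed.

Lemma L1_norm f : L1 mu f -> L1 mu (fun x => `|f x|).
Proof. by move=> fi; have := integrable_abse fi. Qed.

Lemma L1_sum (I : Type) (s : seq I) (F : I -> T -> R) :
  (forall i, L1 mu (F i)) -> L1 mu (fun x => \sum_(i <- s) F i x).
Proof.
move=> iF; elim: s => [|i s ih].
  apply: (@L1_ext (cst 0)); last exact: integrable0.
  by move=> x; rewrite big_nil.
apply: (@L1_ext (fun x => F i x + \sum_(j <- s) F j x)); last exact: L1D.
by move=> x; rewrite big_cons.
Qed.

Lemma Rintegral_sum (I : Type) (s : seq I) (F : I -> T -> R) :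
  (forall i, L1 mu (F i)) ->
  \int[mu]_x (\sum_(i <- s) F i x) = \sum_(i <- s) \int[mu]_x F i x.
Proof.
move=> iF; elim: s => [|i s ih].
  rewrite big_nil; under eq_Rintegral do rewrite big_nil.
  by rewrite Rintegral_cst// mul0r.
rewrite big_cons -ih -RintegralD//; last exact: L1_sum.
by apply: eq_Rintegral => x _; rewrite big_cons.
Qed.

Lemma L1_mul_bounded f h C : L1 mu f -> measurable_fun setT h ->
  (forall x, `|h x| <= C) -> L1 mu (fun x => h x * f x).
Proof.
move=> fi mh hC; apply: (@L1_le _ (fun x => C * `|f x|)).
- by apply: measurable_funM => //; exact: L1_measurable.
- exact/L1Zl/L1_norm.
- by move=> x; rewrite normrM ler_wpM2r.
Qed.

Lemma le_Rintegral_norm f g : L1 mu f -> L1 mu g -> (forall x, `|f x| <= g x) ->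
  `|\int[mu]_x f x| <= \int[mu]_x g x.
Proof.
move=> fi gi fg; apply: le_trans (le_normr_Rintegral _ fi) _ => //.
by apply: le_Rintegral => //; exact: L1_norm.
Qed.

(** The relation between Gamma(F, F) and E_2 holds only almost surely; integrability has to pass
    across it. *)
Lemma ae_eq_L1 f g : {ae mu, forall x, f x = g x} -> measurable_fun setT g ->
  L1 mu f -> L1 mu g.
Proof.
move=> fg mg fi.
have mf := L1_measurable fi.
apply/integrableP; split; first exact/measurable_EFinP.
have /integrableP[_] := fi.
rewrite (ae_eq_integral (abse \o (EFin \o g)))//; last first.
- by apply: filterS fg => x fx _ /=; rewrite fx.
- by apply/measurableT_comp => //; exact/measurable_EFinP.
- by apply/measurableT_comp => //; exact/measurable_EFinP.
Qed.

Lemma ae_eq_Rintegral f g : {ae mu, forall x, f x = g x} ->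
  measurable_fun setT f -> measurable_fun setT g ->
  \int[mu]_x f x = \int[mu]_x g x.
Proof.
move=> fg mf mg; congr fine; apply: ae_eq_integral => //.
- exact/measurable_EFinP.
- exact/measurable_EFinP.
- by apply: filterS fg => x fx _ /=; rewrite fx.
Qed.

Lemma L1_ge0_lty f : measurable_fun setT f -> (forall x, 0 <= f x) ->
  (\int[mu]_x (f x)%:E < +oo)%E -> L1 mu f.
Proof.
move=> mf f0 fi; apply/integrableP; split; first exact/measurable_EFinP.
by under eq_integral do rewrite /= ger0_norm//.
Qed.

Lemma L1_EFin_Rintegral f : L1 mu f ->
  (\int[mu]_x (f x)%:E)%E = (\int[mu]_x f x)%:E.
Proof. by move=> fi; rewrite fineK//; exact: integrable_fin_num. Qed.

Lemma L1_integral_lty f : L1 mu f -> (\int[mu]_x (f x)%:E < +oo)%E.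
Proof. by move=> fi; rewrite L1_EFin_Rintegral// ltry. Qed.

End real_integrable.

Section real_integrable_law.
Context (R : realType) d1 d2 d3 (T1 : measurableType d1) (T2 : measurableType d2)
  (Y : measurableType d3).
Variables (m1 : {measure set T1 -> \bar R}) (m2 : {measure set T2 -> \bar R}).
Variables (X1 : T1 -> Y) (X2 : T2 -> Y).
Hypotheses (mX1 : measurable_fun setT X1) (mX2 : measurable_fun setT X2).
Hypothesis X12 : forall A, measurable A -> m1 (X1 @^-1` A) = m2 (X2 @^-1` A).

Lemma law_L1 (f : Y -> R) : measurable_fun setT f ->
  L1 m1 (fun x => f (X1 x)) -> L1 m2 (fun x => f (X2 x)).
Proof.
move=> mf; apply: (law_integrable mX1 mX2 X12 (f := EFin \o f)).
exact/measurable_EFinP.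
Qed.

Lemma law_Rintegral (f : Y -> R) : measurable_fun setT f ->
  \int[m1]_x f (X1 x) = \int[m2]_x f (X2 x).
Proof.
move=> mf; congr fine; apply: (law_integral mX1 mX2 X12 (f := EFin \o f)).
exact/measurable_EFinP.
Qed.

End real_integrable_law.

Section probability_L1.
Context d (T : measurableType d) (R : realType) (P : probability T R).

Lemma L1_cst (c : R) : L1 P (cst c).
Proof. exact: finite_measure_integrable_cst. Qed.

Lemma L1_bounded (f : T -> R) C : measurable_fun setT f ->
  (forall x, `|f x| <= C) -> L1 P f.
Proof. by move=> mf fC; apply: (@L1_le _ _ _ P f (cst C)) => //; exact: L1_cst. Qed.

Lemma Rintegral_prob_cst (c : R) : \int[P]_x c = c.
Proof.
rewrite Rintegral_cst// -[RHS]mulr1; congr (_ * _).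
by rewrite -[RHS]/(fine 1%E); congr fine; exact: probability_setT.
Qed.

Lemma expectation_integral (f : T -> R) : ('E_P[f] = \int[P]_x (f x)%:E)%E.
Proof. by rewrite unlock. Qed.

Lemma expectation_Rintegral (f : T -> R) : L1 P f -> 'E_P[f]%E = (\int[P]_x f x)%:E.
Proof. by move=> fi; rewrite expectation_integral L1_EFin_Rintegral. Qed.

End probability_L1.

(** * Gaussian integration by parts *)

Section gaussian.
Variable R : realType.
Notation leb := (@lebesgue_measure R).
Notation N01 := (normal_prob (0 : R) 1).
Notation phi := (normal_pdf (0 : R) 1).

(** The normal law is dominated by Lebesgue measure, and its Radon-Nikodym derivative agrees almost
    everywhere with the explicit density because both have the same integral over every measurable
    set. *)
Lemma ge0_integral_normal (f : R -> \bar R) : (forall x, 0 <= f x)%E ->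
  measurable_fun setT f ->
  (\int[N01]_x f x = \int[leb]_x (f x * (phi x)%:E))%E.
Proof.
move=> f0 mf; have dom := normal_prob_dominates (0 : R) 1.
rewrite -(Radon_Nikodym_SigmaFinite.change_of_variables dom f0 measurableT mf).
have mRN := Radon_Nikodym_SigmaFinite.f_integrable dom.
apply: ae_eq_integral => //.
- by apply: emeasurable_funM => //; exact: measurable_int mRN.
- by apply: emeasurable_funM => //; apply/measurable_EFinP; exact: measurable_normal_pdf.
apply: ae_eqe_mul2l; apply: integral_ae_eq => //.
- by apply/measurable_EFinP; exact: measurable_normal_pdf.
- by move=> E _ mE; rewrite -Radon_Nikodym_SigmaFinite.f_integral.
Qed.

Lemma L1_normalP (f : R -> R) : measurable_fun setT f ->
  L1 N01 f <-> L1 leb (fun x => f x * phi x).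
Proof.
move=> mf.
have E : (\int[N01]_x `|(f x)%:E| = \int[leb]_x `|(f x * phi x)%:E|)%E.
  rewrite ge0_integral_normal//; last first.
    by apply: measurableT_comp => //; exact/measurable_EFinP.
  apply: eq_integral => x _.
  by rewrite EFinM abseM [X in (_ = _ * X)%E]gee0_abs// lee_fin normal_pdf_ge0.
split=> /integrableP[_ h]; apply/integrableP; split.
- by apply/measurable_EFinP/measurable_funM => //; exact: measurable_normal_pdf.
- by rewrite -E.
- exact/measurable_EFinP.
- by rewrite E.
Qed.

Lemma Rintegral_normal (f : R -> R) : measurable_fun setT f ->
  \int[N01]_x f x = \int[leb]_x (f x * phi x).
Proof.
move=> mf; congr fine; rewrite [LHS]integralE [RHS]integralE; congr (_ - _)%E.
  rewrite ge0_integral_normal//; last first.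
    by apply: measurable_funepos; exact/measurable_EFinP.
  apply: eq_integral => x _; rewrite !funeposE EFinM.
  by rewrite maxe_pMl ?mul0e// lee_fin normal_pdf_ge0.
rewrite ge0_integral_normal//; last first.
  by apply: measurable_funeneg; exact/measurable_EFinP.
apply: eq_integral => x _; rewrite !funenegE EFinM -mulNe.
by rewrite maxe_pMl ?mul0e// lee_fin normal_pdf_ge0.
Qed.

Lemma normal_pdf01E x : phi x = normal_peak 1 * expR (- (x ^+ 2 / 2)).
Proof.
by rewrite normal_pdfE ?oner_neq0// /normal_fun subr0 expr1n mulNr.
Qed.

Lemma is_derive_normal_pdf (x : R) : is_derive x (1 : R) phi (- x * phi x).
Proof.
rewrite (_ : phi = fun x => normal_peak 1 * expR (- (x ^+ 2 / 2))); last first.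
  by apply/funext => y; exact: normal_pdf01E.
have h : is_derive x (1 : R) (fun x : R => - (x ^+ 2 / 2)) (- x).
  rewrite (_ : (fun x => _) = (- 2^-1) *: ((@id R) ^+ 2)); last first.
    by apply/funext => y /=; rewrite mulrC -mulNr.
  have := is_deriveZ (- 2^-1) (is_deriveX 2 (is_derive_id x (1 : R))).
  rewrite expr1 [_ *: 1]mulr1 [_ *: _]mulNr [2^-1 * _](_ : _ = x)//.
  by rewrite -mulr_natl; field.
have /(is_deriveZ (normal_peak 1)) := is_derive1_comp (is_derive_expR _) h.
by rewrite [_ *: _]mulrA mulrC.
Qed.

(** The comparison density has standard deviation 2, hence decays like exp(-x^2/8). One writes
    exp(-x^2/2) = exp(-x^2/8) exp(-3x^2/8) and uses x^2 <= 8 exp(3x^2/8). Both the second moment and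
    the decay at infinity follow from this comparison. *)
Lemma sqr_normal_pdf_le : exists2 K, 0 <= K &
  forall x : R, x ^+ 2 * phi x <= K * normal_pdf 0 2 x.
Proof.
have p0 : 0 < normal_peak 2 :> R by apply: normal_peak_gt0.
exists (normal_peak 1 * 8 / normal_peak 2).
  by rewrite !mulr_ge0// ?normal_peak_ge0// invr_ge0 normal_peak_ge0.
move=> x; rewrite normal_pdf01E normal_pdfE ?pnatr_eq0//.
rewrite /normal_fun subr0.
rewrite [leRHS](_ : _ = normal_peak 1 *
    (8 * expR (- x ^+ 2 / (2 ^+ 2 *+ 2)))); last by field; rewrite gt_eqF.
rewrite mulrCA ler_wpM2l ?normal_peak_ge0//.
set a := - (_ / 2); set b := - _ / _.
have -> : a = b + - (x ^+ 2 * (3 / 8)) by rewrite /a /b; field.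
rewrite expRD mulrCA mulrC ler_wpM2r ?expR_ge0//.
rewrite expRN ler_pdivrMr ?expR_gt0//.
have := expR_ge1Dx (x ^+ 2 * (3 / 8)); have := sqr_ge0 x; lra.
Qed.

Lemma L1_normal_sqr : L1 N01 (fun x => x ^+ 2).
Proof.
apply/L1_normalP; first exact: measurable_funX.
have [K K0 h] := sqr_normal_pdf_le.
apply: (@L1_le _ _ _ leb _ (fun x => K * normal_pdf 0 2 x)).
- by apply: measurable_funM; [exact: measurable_funX|exact: measurable_normal_pdf].
- by apply: L1Zl; exact: integrable_normal_pdf.
- by move=> x; rewrite ger0_norm ?h// mulr_ge0 ?sqr_ge0 ?normal_pdf_ge0.
Qed.

(** The factor |x| stands for the linear growth of the test function in the boundary terms of the
    integration by parts. *)
Lemma normal_pdf_vanish : exists2 K, 0 <= K &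
  forall x : R, 1 <= `|x| -> `|x| * phi x <= K / `|x|.
Proof.
have [K K0 h] := sqr_normal_pdf_le; exists (K * normal_peak 2).
  by rewrite mulr_ge0 ?normal_peak_ge0.
move=> x x1; have x0 : 0 < `|x| by exact: lt_le_trans x1.
rewrite ler_pdivlMr// mulrAC -expr2 real_normK ?num_real//.
apply: le_trans (h x) _; rewrite ler_wpM2l//; apply: normal_pdf_ub.
by rewrite pnatr_eq0.
Qed.

Variables (f df : R -> R) (C : R).
Hypotheses (fdf : forall x : R, is_derive x (1 : R) f (df x))
  (cdf : continuous df) (dfC : forall x, `|df x| <= C).

Let cf : continuous f.
Proof.
by move=> x; apply/differentiable_continuous/derivable1_diffP; case: (fdf x).
Qed.

Let mf : measurable_fun setT f. Proof. exact: continuous_measurable_fun. Qed.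
Let mdf : measurable_fun setT df. Proof. exact: continuous_measurable_fun. Qed.

Let f_growth x : `|f x| <= `|f 0| + C * `|x|.
Proof.
have [t _ E] := mvt0 x fdf.
rewrite -(subrK (f 0) (f x)) E addrC (le_trans (ler_normD _ _))// lerD2l normrM.
by rewrite ler_wpM2r.
Qed.

Let C0 : 0 <= C. Proof. exact: le_trans (normr_ge0 _) (dfC 0). Qed.

Lemma L1_normal_deriv : L1 N01 df.
Proof. exact: (@L1_bounded _ _ _ (normal_prob 0 1) _ C). Qed.

Lemma L1_normal_id_mul : L1 N01 (fun x => x * f x).
Proof.
apply: (@L1_le _ _ _ N01 _ (fun x => `|f 0| + (`|f 0| + C) * x ^+ 2)).
- exact: measurable_funM.
- apply: L1D; first exact: (@L1_cst _ _ _ (normal_prob 0 1)).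
  by apply: L1Zl; exact: L1_normal_sqr.
move=> x; rewrite normrM; have := f_growth x; have := normr_ge0 x.
rewrite -[x ^+ 2]real_normK ?num_real//.
move: (normr_ge0 (f 0)) C0; move: `|x| `|f x| `|f 0| => y z w w0 c0 y0 h.
apply: (@le_trans _ _ (y * (w + C * y))); first by rewrite ler_wpM2l.
have : y <= 1 + y ^+ 2 by have := sqr_ge0 (y - 1); nra.
by nra.
Qed.

(** (x f - f') phi is the derivative of - f phi. Over [-(n+1), n+1] its integral is a boundary term,
    of order 1/n because f grows at most linearly, and dominated convergence gives the whole
    line. *)
Lemma gaussian_ibp1 : \int[N01]_x (x * f x) = \int[N01]_x df x.
Proof.
apply/eqP; rewrite -subr_eq0 -RintegralB//; last 2 first.
- exact: L1_normal_id_mul.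
- exact: L1_normal_deriv.
pose h x := (x * f x - df x).
have mh : measurable_fun setT h.
  by apply: measurable_funB => //; exact: measurable_funM.
have hi : L1 leb (fun x => h x * phi x).
  apply/L1_normalP => //.
  by apply: L1B; [exact: L1_normal_id_mul|exact: L1_normal_deriv].
rewrite Rintegral_normal//.
pose I n := \int[leb]_(x in `[- n.+1%:R, n.+1%:R]) (h x * phi x).
have I1 : I n @[n --> \oo] --> \int[leb]_x (h x * phi x).
  apply: fine_cvg; rewrite -(L1_EFin_Rintegral hi).
  under eq_fun do rewrite integral_mkcond.
  apply: (@dominated_cvg _ _ _ leb _ _ _ _ (fun x => `|h x * phi x|%:E)) => //.
  - move=> n; apply/(measurable_restrictT _ _).1 => //.
    by apply: measurable_funTS; apply/measurable_EFinP; exact: L1_measurable hi.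
  - move=> x _; apply: cvg_near_cst; near=> n.
    rewrite patchE mem_set//= in_itv/= -ler_norml.
    apply: ltW; apply: lt_le_trans (truncnS_gt _) _; rewrite ler_nat ltnS.
    by near: n; exact: nbhs_infty_ge.
  - exact: L1_norm hi.
  - by move=> n x _; rewrite patchE; case: ifPn => _; rewrite /= ?normr0// lee_fin.
have I2 : I n @[n --> \oo] --> (0 : R).
  have [K K0 hK] := normal_pdf_vanish.
  have fphi x : 1 <= `|x| -> `|f x * phi x| <= (`|f 0| + C) * K / `|x|.
    move=> x1; rewrite normrM [X in _ * X]ger0_norm ?normal_pdf_ge0//.
    apply: (@le_trans _ _ ((`|f 0| + C) * (`|x| * phi x))).
      rewrite mulrA ler_wpM2r ?normal_pdf_ge0//.
      apply: le_trans (f_growth x) _; rewrite mulrDl lerD2r ler_peMr//.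
    by rewrite -mulrA ler_wpM2l ?addr_ge0// hK.
  have dF (x : R) : is_derive x (1 : R) (fun x => - (f x * phi x)) (h x * phi x).
    have := is_deriveN (is_deriveM (fdf x) (is_derive_normal_pdf x)).
    rewrite [X in is_derive _ _ _ X -> _](_ : _ = h x * phi x)//.
    by rewrite /h /GRing.scale/=; ring.
  have cF : continuous (fun x => - (f x * phi x)).
    by move=> x; apply/differentiable_continuous/derivable1_diffP; case: (dF x).
  have IE n : I n = f (- n.+1%:R) * phi (- n.+1%:R) - f n.+1%:R * phi n.+1%:R.
    rewrite /I /Rintegral (@continuous_FTC2 _ _ (fun x => - (f x * phi x))).
    - by rewrite /= opprK addrC.
    - by rewrite -subr_gt0 opprK -natrD ltr0n.
    - apply: continuous_subspaceT => x; apply: cvgM; last first.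
        by apply: continuous_normal_pdf; rewrite oner_neq0.
      by apply: cvgB; [apply: cvgM; [exact: cvg_id|exact: cf]|exact: cdf].
    - split => [x _||]; first by case: (dF x).
        by apply: cvg_at_right_filter; exact: cF.
      by apply: cvg_at_left_filter; exact: cF.
    - by move=> x _; rewrite derive1E; case: (dF x).
  apply/norm_cvg0P.
  apply: (@squeeze_cvgr _ _ _ _ (cst 0) (fun n => 2 * ((`|f 0| + C) * K) * harmonic n)).
  - near=> n; rewrite normr_ge0/= IE; apply: le_trans (ler_normB _ _) _.
    have n1 : 1 <= `|n.+1%:R| :> R by rewrite ger0_norm// ler1n.
    have n1' : 1 <= `|- n.+1%:R| :> R by rewrite normrN.
    have e : `|n.+1%:R| = n.+1%:R :> R by rewrite ger0_norm.
    have := fphi _ n1; have := fphi _ n1'; rewrite normrN e /harmonic/=.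
    move=> h1 h2; apply: le_trans (lerD h1 h2) _.
    by rewrite -mulr2n -[X in X <= _]mulr_natl -[leRHS]mulrA.
  - exact: cvg_cst.
  - rewrite -[X in _ --> X](mulr0 (2 * ((`|f 0| + C) * K))).
    by apply: cvgM; [exact: cvg_cst|exact: cvg_harmonic].
by apply/eqP; exact: cvg_unique I1 I2.
Unshelve. all: by end_near. Qed.

End gaussian.

Section real_continuous.
Variables (R : realType) (V : topologicalType).
Implicit Types f g : V -> R.

Lemma continuous_addR f g : continuous f -> continuous g ->
  continuous (fun x => f x + g x).
Proof. by move=> cf cg x; apply: cvgD; [exact: cf|exact: cg]. Qed.

Lemma continuous_mulR f g : continuous f -> continuous g ->
  continuous (fun x => f x * g x).
Proof. by move=> cf cg x; apply: cvgM; [exact: cf|exact: cg]. Qed.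

Lemma continuous_distR f g : continuous f -> continuous g ->
  continuous (fun x => `|f x - g x|).
Proof.
by move=> cf cg x; apply: cvg_norm; apply: cvgB; [exact: cf|exact: cg].
Qed.

Lemma continuous_sum (I : Type) (r : seq I) (F : I -> V -> R) :
  (forall i, continuous (F i)) -> continuous (fun x => \sum_(i <- r) F i x).
Proof.
move=> cF; elim: r => [|i r ih].
  by under eq_fun do rewrite big_nil; exact: cst_continuous.
under eq_fun do rewrite big_cons.
exact: continuous_addR.
Qed.

End real_continuous.

(** * Affine changes of variable in R^d *)

Section affine_maps.
Variables (R : realType) (m d : nat).
Implicit Types (f : 'cV[R]_m -> R) (x : 'cV[R]_m) (B : 'M[R]_(m, d)).

Lemma affine_continuous x B : continuous (fun v : 'cV[R]_d => x + B *m v).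
Proof.
move=> v A /nbhs_coord[e e0 he].
have cc i : continuous (fun v : 'cV[R]_d => (x + B *m v) i 0).
  under eq_fun do rewrite mxE [X in _ + X]mxE.
  apply: continuous_addR; first exact: cst_continuous.
  apply: continuous_sum => j; apply: continuous_mulR; first exact: cst_continuous.
  exact: coord_continuous.
have : \forall u \near v, forall i, `|(x + B *m u) i 0 - (x + B *m v) i 0| < e.
  apply: (@filter_forall _ _ _ _ (nbhs_filter v)) => i.
  have /(@cvgrPdist_lt _ _ _ (nbhs v) (nbhs_filter v))/(_ _ e0) := cc i v.
  by apply: filterS => u; rewrite distrC.
by apply: filterS => u; exact: he.
Qed.

Lemma is_derive_affine f x B v i : class_C1 f ->
  is_derive v (delta_mx i 0) (fun v => f (x + B *m v))
    (\sum_l partial l f (x + B *m v) * B l i).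
Proof.
move=> C1f; apply: is_derive_line0.
have := @is_derive_segment _ _ f (x + B *m v) (B *m delta_mx i 0) 0 C1f.
rewrite scale0r addr0 -colE.
under eq_bigr do rewrite mxE.
rewrite (_ : (fun s : R => f _) =
  (fun t : R => f (x + B *m (v + t *: delta_mx i 0))))//.
by apply/funext => t; rewrite mulmxDr addrA -scalemxAr -colE.
Qed.

Lemma partial_affine f x B i : class_C1 f ->
  partial i (fun v => f (x + B *m v)) =
  (fun v => \sum_l partial l f (x + B *m v) * B l i).
Proof. by move=> C1f; apply/funext => v; case: (is_derive_affine x B v i C1f). Qed.

Lemma class_C1_affine f x B : class_C1 f -> class_C1 (fun v => f (x + B *m v)).
Proof.
move=> C1f; split => [i v|i]; first by case: (is_derive_affine x B v i C1f).
rewrite partial_affine//; apply: continuous_sum => l; apply: continuous_mulR.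
  move=> v; apply: (@continuous_comp _ _ _ (fun v => x + B *m v) (partial l f)).
    exact: affine_continuous.
  exact: C1f.2.
exact: cst_continuous.
Qed.

Lemma bounded_partials_growth f C x y : (forall i x, derivable f x (delta_mx i 0)) ->
  (forall i x, `|partial i f x| <= C) ->
  `|f y - f x| <= C * \sum_i `|y i 0 - x i 0|.
Proof.
move=> df fC; have [xi [_ ->]] := mean_value_partial x y df.
apply: le_trans (ler_norm_sum _ _ _) _; rewrite mulr_sumr.
by apply: ler_sum => i _; rewrite normrM ler_wpM2r.
Qed.

End affine_maps.

(** * Integration by parts for a standard Gaussian vector *)

Section gaussian_vector.
Variables (R : realType) (d : nat) (gamma : probability (borelV R d) R).
Hypothesis gammaN : std_normal gamma.
Notation N01 := (normal_prob (0 : R) 1).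

Let mcoord i : measurable_fun setT (fun v : borelV R d => v i 0 : R).
Proof. exact: measurable_entry. Qed.

Definition resample (i : 'I_d) (p : R * borelV R d) : borelV R d :=
  p.2 + (p.1 - p.2 i 0) *: delta_mx i 0.

Let resampleE i p j : resample i p j 0 = if j == i then p.1 else p.2 j 0.
Proof.
rewrite !mxE eqxx andbT; case: eqP => [->|_]; last by rewrite mulr0 addr0.
by rewrite mulr1 addrC subrK.
Qed.

Let measurable_resample i : measurable_fun setT (resample i).
Proof.
apply: measurable_fun_borelV => j.
under eq_fun do rewrite resampleE.
case: eqP => _; first exact: measurable_fst.
exact: measurableT_comp (mcoord j) measurable_snd.
Qed.

(* Replacing one coordinate by an independent N(0, 1) does not change the law;
   this is how the coordinates are separated without building gamma as a product. *)
Lemma resample_law i A : measurable A ->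
  (normal_prob 0 1 \x gamma)%E (resample i @^-1` A) = gamma A.
Proof.
move=> mA.
move: A mA; apply: (@rectangles_unique _ _
  (pushforward (normal_prob 0 1 \x gamma)%E (resample i)) gamma).
- exact: measurable_resample.
- move=> mr; apply: le_lt_trans (ltry 1).
  apply: (probability_le1 (normal_prob 0 1 \x gamma)%E).
  by rewrite preimage_setT.
- move=> mr _ [B mB ->].
  pose B' j := if j == i then setT else B j.
  have mB' j : measurable (B' j) by rewrite /B'; case: eqP.
  transitivity ((normal_prob 0 1 \x gamma)%E
    (B i `*` [set v : 'cV[R]_d | forall j, B' j (v j 0)])); last first.
    rewrite product_measure1E; [|exact: mB|]; last first.
      by rewrite borelV_rectangles; apply: sub_sigma_algebra; exists B'.
    transitivity (normal_prob 0 1 (B i) * \prod_(j < d) normal_prob 0 1 (B' j))%E.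
      by congr (_ * _)%E; exact: gammaN.
    transitivity (\prod_(j < d) normal_prob 0 1 (B j))%E; last exact/esym/gammaN.
    rewrite (bigD1 i)//= (bigD1 i (F := fun j => normal_prob 0 1 (B j)))//=.
    congr (_ * _)%E; rewrite {1}/B' eqxx probability_setT mul1e.
    by apply: eq_bigr => j /negbTE ji; rewrite /B' ji.
  congr ((_ \x _)%E _); apply/seteqP; split=> [p /= hp|p /= [pi hp] j]; last first.
    rewrite resampleE; have := hp j; rewrite /B'.
    by case: eqP => // ->.
  split; first by have := hp i; rewrite resampleE eqxx.
  move=> j; rewrite /B'; case: eqP => // /eqP/negbTE ji.
  by have := hp j; rewrite resampleE ji.
Qed.

Lemma coordinate_law i (B : set R) : measurable B ->
  gamma ((fun v : 'cV[R]_d => v i 0) @^-1` B) = normal_prob 0 1 B.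
Proof.
move=> mB; pose B' j := if j == i then B else setT.
have mB' j : measurable (B' j) by rewrite /B'; case: eqP.
have := gammaN mB'; rewrite (bigD1 i)//= big1 => [|j /negbTE ji]; last first.
  by rewrite /B' ji probability_setT.
rewrite /B' eqxx mule1 => <-; congr (gamma _).
apply/seteqP; split=> [v /= vB j|v /(_ i)/=]; last by rewrite eqxx.
by case: eqP => // ->.
Qed.

Lemma L1_gaussian_sqr i : L1 gamma (fun v : borelV R d => v i 0 ^+ 2).
Proof.
apply: (@law_L1 R _ _ _ _ _ _ (normal_prob 0 1) gamma id (fun v : borelV R d => v i 0)
  _ (mcoord i) _ (fun x => x ^+ 2)).
- exact: measurable_id.
- by move=> B mB; exact/esym/coordinate_law.
- exact: measurable_funX.
- exact: L1_normal_sqr.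
Qed.

Lemma L1_gaussian_le (h : borelV R d -> R) c : measurable_fun setT h ->
  (forall v, `|h v| <= c * (1 + \sum_i v i 0 ^+ 2)) -> L1 gamma h.
Proof.
move=> mh hc; apply: L1_le hc => //.
apply: L1Zl; apply: L1D; first exact: L1_cst.
by apply: L1_sum => i; exact: L1_gaussian_sqr.
Qed.

Section ibp.
Variables (h : 'cV[R]_d -> R) (C : R).
Hypotheses (C1h : class_C1 h) (ch : continuous h)
  (hC : forall i x, `|partial i h x| <= C).

Lemma L1_gaussian_partial i : L1 gamma (partial i h).
Proof.
apply: L1_bounded => //; apply: continuous_measurable_borelM.
exact: C1h.2.
Qed.

(** Bounded partial derivatives give linear growth of [h], so the product grows at most
    quadratically and second moments control it. *)
Lemma L1_gaussian_coord_mul i : L1 gamma (fun v : borelV R d => v i 0 * h v).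
Proof.
have mh : measurable_fun setT (h : borelV R d -> R).
  exact: continuous_measurable_borelM.
apply: (@L1_gaussian_le _ (`|h 0| + `|C| * (d%:R + 1))).
  by apply: measurable_funM => //; exact: mcoord.
move=> v; have := bounded_partials_growth 0 v C1h.1 hC.
set s := \sum_j `|_| => hs; set q := \sum_j _ ^+ 2.
have q0 : 0 <= q by apply: sumr_ge0 => j _; exact: sqr_ge0.
have s0 : 0 <= s by exact: sumr_ge0.
have vq j : v j 0 ^+ 2 <= q.
  by rewrite /q (bigD1 j)//= lerDl; apply: sumr_ge0 => k _; exact: sqr_ge0.
have vi1 : `|v i 0| <= 1 + q.
  have := vq i; rewrite -real_normK ?num_real//.
  have := sqr_ge0 (`|v i 0| - 1); nra.
have vis : `|v i 0| * s <= d%:R * (1 + q) + q.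
  rewrite mulr_sumr; apply: (@le_trans _ _ (\sum_(j < d) (q + q) / 2)).
    apply: ler_sum => j _; rewrite mxE subr0.
    have h1 := vq i; have h2 := vq j.
    rewrite -[_ ^+ 2]real_normK ?num_real// in h1.
    rewrite -[_ ^+ 2]real_normK ?num_real// in h2.
    have := sqr_ge0 (`|v i 0| - `|v j 0|); nra.
  rewrite sumr_const card_ord -mulr_natl.
  have : 0 <= d%:R :> R by []. 
  nra.
rewrite normrM; apply: (@le_trans _ _ (`|v i 0| * (`|h 0| + `|C| * s))).
  rewrite ler_wpM2l// -{1}(subrK (h 0) (h v)) addrC (le_trans (ler_normD _ _))// lerD2l.
  by apply: le_trans hs _; rewrite ler_wpM2r// ler_norm.
have := normr_ge0 (h 0); have := normr_ge0 C.
move: vi1 vis; move: `|v i 0| `|h 0| `|C| => a e c h1 h2 c0 e0.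
rewrite mulrDr mulrDl lerD//; first by rewrite mulrC ler_wpM2l.
by rewrite mulrCA -mulrA ler_wpM2l// (le_trans h2)// mulrDl mul1r lerD2l lerDr.
Qed.

Let resample_integral (f : borelV R d -> R) : measurable_fun setT f ->
  L1 gamma f -> forall i,
  (\int[gamma]_v (f v)%:E =
   \int[gamma]_v \int[N01]_r (f (resample i (r, v)))%:E)%E.
Proof.
move=> mf fi i; have mr := @measurable_resample i.
have A12 A : measurable A ->
    gamma (id @^-1` A) = (normal_prob 0 1 \x gamma)%E (resample i @^-1` A).
  by move=> mA; apply/esym/resample_law.
have mid : measurable_fun setT (id : borelV R d -> borelV R d) by exact: measurable_id.
have fi' : L1 (normal_prob 0 1 \x gamma)%E (fun p => f (resample i p)).
  exact: (@law_L1 R _ _ _ _ _ _ gamma (normal_prob 0 1 \x gamma)%E id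
    (resample i) mid mr A12 f mf fi).
rewrite -[RHS]/(\int[gamma]_v fubini_G (normal_prob 0 1)
   (EFin \o (fun p => f (resample i p))) v)%E.
rewrite integral21_prod_meas1//.
apply: (@law_integral R _ _ _ _ _ _ gamma (normal_prob 0 1 \x gamma)%E id
    (resample i) mid mr A12 (EFin \o f)).
exact/measurable_EFinP.
Qed.

(** After resampling, Fubini lets coordinate [i] be integrated against N(0, 1) with the others
    fixed, where the one-dimensional identity applies. *)
Lemma gaussian_ibp i :
  \int[gamma]_v (v i 0 * h v) = \int[gamma]_v partial i h v.
Proof.
have mh : measurable_fun setT (h : borelV R d -> R).
  exact: continuous_measurable_borelM.
have mp : measurable_fun setT (partial i h : borelV R d -> R).
  by apply: continuous_measurable_borelM; exact: C1h.2.
have mvh : measurable_fun setT (fun v : borelV R d => v i 0 * h v).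
  by apply: measurable_funM => //; exact: mcoord.
congr fine; rewrite (resample_integral mvh (L1_gaussian_coord_mul i) i).
rewrite (resample_integral mp (L1_gaussian_partial i) i).
apply: eq_integral => v _.
pose x : 'cV[R]_d := v - v i 0 *: delta_mx i 0.
have E r : resample i (r, v) = x + r *: delta_mx i 0.
  by rewrite /resample/= /x scalerBl addrA addrAC.
have dh (r : R) : is_derive r (1 : R) (fun r => h (resample i (r, v)))
    (partial i h (resample i (r, v))).
  under eq_fun do rewrite E; rewrite E.
  by apply: is_derive_line => t; exact: C1h.1.
have ci : continuous (fun r => partial i h (resample i (r, v))).
  under eq_fun do rewrite E.
  move=> r; apply: (@continuous_comp _ _ _ (fun r : R => x + r *: delta_mx i 0) (partial i h)).
    by apply: cvgD; [exact: cvg_cst|exact: cvgZr_tmp].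
  exact: C1h.2.
have bi r : `|partial i h (resample i (r, v))| <= C by [].
under eq_integral => r _ do rewrite resampleE eqxx.
rewrite (L1_EFin_Rintegral (L1_normal_id_mul dh bi)).
by rewrite (gaussian_ibp1 dh ci bi) -L1_EFin_Rintegral//; exact: L1_normal_deriv ci bi.
Qed.

End ibp.

End gaussian_vector.

Section gaussian_moments.
Variables (R : realType) (d : nat).

Lemma is_derive_coord (i j : 'I_d) (x : 'cV[R]_d) :
  is_derive x (delta_mx i 0) (fun v : 'cV[R]_d => v j 0) ((j == i)%:R).
Proof.
apply: cvg_is_derive; apply: cvg_near_cst; near=> h.
rewrite !mxE eqxx andbT addrK scalerA mulVf ?scale1r//.
by near: h; exact: nbhs_dnbhs_neq.
Unshelve. all: by end_near. Qed.

Lemma partial_coord (i j : 'I_d) :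
  partial i (fun v : 'cV[R]_d => v j 0) = cst (j == i)%:R.
Proof. by apply/funext => x; case: (is_derive_coord i j x). Qed.

Lemma class_C1_coord (j : 'I_d) : class_C1 (fun v : 'cV[R]_d => v j 0).
Proof.
split => [i x|i]; first by case: (is_derive_coord i j x).
by rewrite partial_coord; exact: cst_continuous.
Qed.

Variable gamma : probability (borelV R d) R.
Hypothesis gammaN : std_normal gamma.

Let coord_le1 (j i : 'I_d) (x : 'cV[R]_d) :
  `|partial i (fun v : 'cV[R]_d => v j 0) x| <= 1.
Proof. by rewrite partial_coord /= ger0_norm ?lern1 ?leq_b1. Qed.

Let ccoord (j : 'I_d) : continuous (fun v : 'cV[R]_d => v j 0).
Proof. exact: coord_continuous. Qed.

Lemma L1_gaussian_coordM i j : L1 gamma (fun v : borelV R d => v i 0 * v j 0).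
Proof.
exact: (L1_gaussian_coord_mul gammaN (class_C1_coord j) (@ccoord j) (@coord_le1 j) i).
Qed.

(** Integration by parts with a coordinate as test function; the constant 1 gives the mean in the
    same way below. *)
Lemma gaussian_cov i j :
  \int[gamma]_v (v i 0 * v j 0) = (j == i)%:R.
Proof.
rewrite (gaussian_ibp gammaN (class_C1_coord j) (@ccoord j) (@coord_le1 j) i).
by rewrite partial_coord Rintegral_prob_cst.
Qed.

Lemma L1_gaussian_coord i : L1 gamma (fun v : borelV R d => v i 0).
Proof.
apply: (@L1_gaussian_le _ _ _ gammaN _ 1); first exact: measurable_entry.
move=> v; rewrite mul1r (bigD1 i)//=.
set q := \sum_(_ | _) _; have q0 : 0 <= q.
  by apply: sumr_ge0 => j _; exact: sqr_ge0.
by rewrite -[_ ^+ 2]real_normK ?num_real//; have := sqr_ge0 (`|v i 0| - 1); nra.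
Qed.

Lemma gaussian_mean i : \int[gamma]_v (v i 0) = 0.
Proof.
have C1c : class_C1 (cst 1 : 'cV[R]_d -> R).
  split=> [k x|k]; first exact: derivable_cst.
  rewrite (_ : partial k (cst 1) = cst 0); first exact: cst_continuous.
  by apply/funext => x; rewrite /partial derive_cst.
have pc k x : `|partial k (cst 1 : 'cV[R]_d -> R) x| <= 0.
  by rewrite /partial derive_cst normr0.
have cc : continuous (cst 1 : 'cV[R]_d -> R) by exact: cst_continuous.
have := gaussian_ibp gammaN C1c cc pc i.
under eq_Rintegral do rewrite mulr1; move=> ->.
under eq_Rintegral do rewrite /partial derive_cst.
by rewrite Rintegral_prob_cst.
Qed.

Variables (m : nat) (B : 'M[R]_(m, d)).

Let sqrE (v : 'cV[R]_d) : enorm (B *m v) ^+ 2 =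
  \sum_k \sum_i \sum_j B k i * B k j * (v i 0 * v j 0).
Proof.
rewrite sqr_enorm; apply: eq_bigr => k _; rewrite mxE expr2 mulr_suml.
apply: eq_bigr => i _; rewrite mulr_sumr; apply: eq_bigr => j _; ring.
Qed.

Lemma L1_gaussian_mulmx_sqr : L1 gamma (fun v : borelV R d => enorm (B *m v) ^+ 2).
Proof.
refine (@L1_ext _ (borelV R d) R gamma _ _ (fun v => esym (sqrE v)) _).
by do 3 apply: L1_sum => ?; apply: L1Zl; exact: L1_gaussian_coordM.
Qed.

Lemma gaussian_mulmx_sqr :
  \int[gamma]_v (enorm (B *m (v : 'cV[R]_d)) ^+ 2) = hsnorm B ^+ 2.
Proof.
under eq_Rintegral do rewrite sqrE.
rewrite Rintegral_sum => [|k]; last first.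
  by do 2 apply: L1_sum => ?; apply: L1Zl; exact: L1_gaussian_coordM.
rewrite sqr_hsnorm; apply: eq_bigr => k _; rewrite Rintegral_sum => [|i]; last first.
  by apply: L1_sum => ?; apply: L1Zl; exact: L1_gaussian_coordM.
apply: eq_bigr => i _; rewrite Rintegral_sum => [|j]; last first.
  by apply: L1Zl; exact: L1_gaussian_coordM.
rewrite (bigD1 i)//= big1 => [|j ji]; rewrite RintegralZl ?gaussian_cov//.
- by rewrite eqxx mulr1 addr0 expr2.
- exact: L1_gaussian_coordM.
- by rewrite (negbTE ji) mulr0.
- exact: L1_gaussian_coordM.
Qed.

Lemma measurable_enorm_mulmx :
  measurable_fun setT (fun v : borelV R d => enorm (B *m v)).
Proof.
apply: continuous_measurable_borelM.
move=> v; apply: (@continuous_comp _ _ _ (fun v : 'cV[R]_d => B *m v)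
  (fun x : 'cV[R]_m => enorm x)).
  have := @affine_continuous _ _ _ 0 B v.
  by under eq_fun do rewrite add0r.
exact: enorm_continuous.
Qed.

Lemma L1_gaussian_mulmx : L1 gamma (fun v : borelV R d => enorm (B *m v)).
Proof.
apply: (@L1_le _ _ _ gamma _ (fun v => 1 + enorm (B *m v) ^+ 2)).
- exact: measurable_enorm_mulmx.
- by apply: L1D; [exact: L1_cst|exact: L1_gaussian_mulmx_sqr].
move=> v; rewrite ger0_norm ?hsnorm_ge0//.
by have := sqr_ge0 (enorm (B *m v) - 1); nra.
Qed.

(** With s the Hilbert-Schmidt norm of [B], 2 s x <= s^2 + x^2, and for x = |B v| the right-hand
    side has mean 2 s^2. This is how a Hilbert-Schmidt norm enters the Wasserstein bound. *)
Lemma gaussian_mulmx_le : \int[gamma]_v enorm (B *m (v : 'cV[R]_d)) <= hsnorm B.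
Proof.
have [B0|B0] := eqVneq (hsnorm B) 0.
  rewrite (@eq_Rintegral _ _ _ gamma setT (cst 0)); last first.
    by move=> v _; rewrite (hsnorm_eq0 B0) mul0mx hsnorm0.
  by rewrite Rintegral_prob_cst hsnorm_ge0.
set s := hsnorm B; have s0 : 0 < s by rewrite lt_neqAle eq_sym B0 hsnorm_ge0.
apply: (@le_trans _ _ (\int[gamma]_v ((2 * s)^-1 *
    (s ^+ 2 + enorm (B *m (v : 'cV[R]_d)) ^+ 2)))).
  apply: le_Rintegral => //; first exact: L1_gaussian_mulmx.
    by apply: L1Zl; apply: L1D; [exact: L1_cst|exact: L1_gaussian_mulmx_sqr].
  move=> v _; rewrite mulrC ler_pdivlMr ?mulr_gt0//.
  by have := sqr_ge0 (enorm (B *m (v : 'cV[R]_d)) - s); nra.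
rewrite RintegralZl//; last first.
  by apply: L1D; [exact: L1_cst|exact: L1_gaussian_mulmx_sqr].
rewrite RintegralD//; [|exact: L1_cst|exact: L1_gaussian_mulmx_sqr].
rewrite (Rintegral_prob_cst gamma (s ^+ 2)) gaussian_mulmx_sqr -/s.
by rewrite le_eqVlt; apply/orP; left; apply/eqP; field; rewrite gt_eqF.
Qed.

End gaussian_moments.

(** * Reversible integration by parts *)

Section kernel_precomposition.
Context d1 d2 d3 (U : measurableType d1) (V : measurableType d2)
  (W : measurableType d3) (R : realType).
Variables (f : U -> V) (mf : measurable_fun setT f) (k : R.-pker V ~> W).

(** Taken with a map that reads off X_0, this turns [p t] into a kernel issuing from the sample
    space. *)
Definition kprecomp (mf : measurable_fun setT f) (u : U) :
  {measure set W -> \bar R} := k (f u).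

Let measurable_kprecomp A : measurable A ->
  measurable_fun setT (kprecomp mf ^~ A).
Proof. by move=> mA; exact: measurableT_comp (measurable_kernel k A mA) mf. Qed.

HB.instance Definition _ := isKernel.Build _ _ U W R (kprecomp mf)
  measurable_kprecomp.

Let kprecomp_prob u : kprecomp mf u setT = 1%E.
Proof. exact: prob_kernel. Qed.

HB.instance Definition _ := Kernel_isProbability.Build _ _ U W R (kprecomp mf)
  kprecomp_prob.

End kernel_precomposition.

Lemma measurable_kernel_integral d1 d2 (U : measurableType d1)
    (V : measurableType d2) (R : realType) (k : R.-pker U ~> V)
    (H : U * V -> \bar R) : (forall z, 0 <= H z)%E ->
  measurable_fun setT H -> measurable_fun setT (fun x => \int[k x]_y H (x, y))%E.
Proof. by move=> H0 mH; exact: (measurable_fun_integral_sfinite_kernel H k). Qed.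

Lemma measurable_kernel_Rintegral d1 d2 (U : measurableType d1)
    (V : measurableType d2) (R : realType) (k : R.-pker U ~> V)
    (H : U * V -> R) : measurable_fun setT H ->
  measurable_fun setT (fun x => \int[k x]_y H (x, y)).
Proof.
move=> mH; apply: measurableT_comp => //=.
have mF : measurable_fun setT (EFin \o H) by exact/measurable_EFinP.
rewrite (_ : (fun x => _) = fun x => (\int[k x]_y (EFin \o H)^\+%E (x, y) -
    \int[k x]_y (EFin \o H)^\-%E (x, y))%E); last first.
  apply/funext => x; rewrite integralE; congr (_ - _)%E; apply: eq_integral => y _.
    by rewrite !funeposE.
  by rewrite !funenegE.
apply: emeasurable_funB; apply: measurable_kernel_integral => //.
  exact: measurable_funepos.
exact: measurable_funeneg.
Qed.

Lemma kernel_L1_cst d1 d2 (U : measurableType d1) (V : measurableType d2)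
  (R : realType) (k : R.-pker U ~> V) x (c : R) : L1 (k x) (cst c).
Proof.
apply/integrableP; split; first exact/measurable_EFinP.
rewrite (_ : (\int[k x]_y _ = `|c|%:E * k x setT)%E); last first.
  by rewrite -integral_cst.
by rewrite prob_kernel mule1 ltry.
Qed.

Lemma kernel_Rintegral_cst d1 d2 (U : measurableType d1) (V : measurableType d2)
  (R : realType) (k : R.-pker U ~> V) x (c : R) : \int[k x]_y c = c.
Proof. by rewrite Rintegral_cst// prob_kernel mulr1. Qed.

(** * The joint law of X_0 and X_t *)

Section markov_joint.
Context (R : realType) (dT : measure_display) (T : measurableType dT)
  (P : probability T R) (dS : measure_display) (S : measurableType dS)
  (mu : probability S R) (p : R -> R.-pker S ~> S) (X : R -> T -> S)
  (hX : stationary_reversible_markov P mu p X).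

Let mX0 : measurable_fun setT (X 0).
Proof. exact: (markov_measurable hX). Qed.

Section fixed_time.
Variables (t : R) (t0 : 0 <= t).

Let mXt : measurable_fun setT (X t).
Proof. exact: (markov_measurable hX). Qed.

(** The joint law is a composition of three kernels: draw w from [P], made a kernel by a one-point
    source; draw y from [p t (X 0 w)]; keep the pair (X_0(w), y). *)
Let l1 : R.-pker unit ~> T := kprobability (measurable_cst (P : pprobability T R)).

Let mX0snd : measurable_fun setT (fun w : unit * T => X 0 w.2).
Proof. exact: measurableT_comp mX0 measurable_snd. Qed.

Let l2 : R.-pker (unit * T)%type ~> S := kprecomp (p t) mX0snd.

Let pairf (w : (unit * T) * S) : S * S := (X 0 w.1.2, w.2).

Let mpairf : measurable_fun setT pairf.
Proof.
apply: measurable_fun_pair; last exact: measurable_snd.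
exact: measurableT_comp mX0snd measurable_fst.
Qed.

Let l3 : R.-pker ((unit * T) * S)%type ~> (S * S)%type := kdirac mpairf.

Let joint : {measure set (S * S) -> \bar R} := (l1 \; (l2 \; l3))%E tt.

Let joint_integral (H : S * S -> \bar R) : (forall z, 0 <= H z)%E ->
  measurable_fun setT H ->
  (\int[joint]_z H z = \int[P]_w \int[p t (X 0 w)]_y H (X 0 w, y))%E.
Proof.
move=> H0 mH.
transitivity (\int[l1 tt]_w \int[(l2 \; l3)%E (tt, w)]_z H z)%E.
  exact: (@integral_kcomp _ _ _ _ _ _ _ l1 (l2 \; l3)%E tt H H0 mH).
apply: eq_integral => w _.
transitivity (\int[l2 (tt, w)]_y \int[l3 ((tt, w), y)]_z H z)%E.
  exact: (@integral_kcomp _ _ _ _ _ _ _ l2 l3 (tt, w) H H0 mH).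
apply: eq_integral => y _.
by rewrite /l3/= /kdirac integral_dirac// diracT mul1e.
Qed.

Let mpair : measurable_fun setT (fun w => (X 0 w, X t w)).
Proof. exact: measurable_fun_pair. Qed.

(** The Markov property at s = 0, applied to the event that X_0 lies in [A], which belongs to the
    past up to time 0. *)
Let markov_rectangle A B : measurable A -> measurable B ->
  P (X 0 @^-1` A `&` X t @^-1` B) = joint (A `*` B).
Proof.
move=> mA mB.
have pastA : past X 0 (X 0 @^-1` A).
  apply: sub_sigma_algebra; exists 0; first by rewrite /= in_itv/= lexx.
  by exists A => //; rewrite setTI.
have := markov_property hX (lexx 0) t0 pastA mB.
rewrite add0r => ->.
have mAX : measurable (X 0 @^-1` A) by rewrite -[_ @^-1` _]setTI; exact: mX0.
have mAB : measurable (A `*` B) by exact: measurableX.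
have mi : measurable_fun setT (fun z => (\1_(A `*` B) z : R)%:E).
  by apply/measurable_EFinP; exact: measurable_indic.
transitivity (\int[joint]_z (\1_(A `*` B) z)%:E)%E; last first.
  exact: etrans (integral_indic joint measurableT mAB) (congr1 joint (setIT _)).
rewrite (joint_integral _ mi); last by move=> z; rewrite lee_fin.
rewrite integral_mkcond; apply: eq_integral => w _; rewrite patchE.
have [wA|wA] := boolP (w \in X 0 @^-1` A).
  transitivity (\int[p t (X 0 w)]_y (\1_B y)%:E)%E.
    by rewrite integral_indic// setIT.
  apply: eq_integral => y _; rewrite !indicE; congr (_%:R%:E); congr nat_of_bool.
  apply/idP/idP; rewrite !inE/= => hB; last by have [] := hB.
  by split => //; move: wA; rewrite inE.
rewrite integral0_eq// => y _; rewrite indicE memNset//= => -[hA _].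
by move/negP : wA; apply; rewrite inE.
Qed.

Lemma markov_law C : measurable C ->
  P ((fun w => (X 0 w, X t w)) @^-1` C) = joint C.
Proof.
move=> mC.
pose m1 : {measure set (S * S) -> \bar R} := pushforward P (fun w => (X 0 w, X t w)).
refine (@measure_unique _ R _ [set A `*` B | A in measurable & B in measurable]
  (fun=> setT) _ _ _ _ (m1 mpair) joint _ _ C mC).
- exact: measurable_prod_measurableType.
- move=> _ _ [A mA [B mB <-]] [A' mA' [B' mB' <-]].
  exists (A `&` A'); first exact: measurableI.
  by exists (B `&` B'); [exact: measurableI|rewrite setXI].
- by move=> _; exists setT => //; exists setT => //; rewrite setXTT.
- by apply/seteqP; split=> // z _; exists 0%N.
- by move=> _ [A mA [B mB <-]]; rewrite -markov_rectangle.
- move=> _; apply: le_lt_trans (ltry 1); apply: (probability_le1 P).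
  by rewrite preimage_setT; exact: measurableT.
Qed.

Lemma markov_ge0_integral (H : S * S -> \bar R) : (forall z, 0 <= H z)%E ->
  measurable_fun setT H ->
  (\int[P]_w H (X 0 w, X t w) = \int[P]_w \int[p t (X 0 w)]_y H (X 0 w, y))%E.
Proof.
move=> H0 mH; rewrite -joint_integral//.
have mid : measurable_fun setT (id : S * S -> S * S) by exact: measurable_id.
exact: (@law_ge0_integral R _ _ _ _ _ _ P joint _ id mpair mid markov_law H mH H0).
Qed.

Lemma markov_L1 (H : S * S -> R) : measurable_fun setT H ->
  (\int[P]_w \int[p t (X 0 w)]_y `|H (X 0 w, y)|%:E < +oo)%E ->
  L1 P (fun w => H (X 0 w, X t w)).
Proof.
move=> mH Hi; apply/integrableP; split.
  by apply/measurable_EFinP; exact: measurableT_comp mH mpair.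
rewrite (markov_ge0_integral (H := fun z => `|H z|%:E))//.
by apply/measurable_EFinP; exact: measurableT_comp.
Qed.

(** Real-valued integrals turn infinite values into 0, so positive and negative parts are
    conditioned separately; integrability under every [p t x] ensures that the inner integral is
    genuine at each point. *)
Lemma markov_Rintegral (H : S * S -> R) : measurable_fun setT H ->
  (forall x, L1 (p t x) (fun y => H (x, y))) ->
  L1 P (fun w => H (X 0 w, X t w)) ->
  L1 P (fun w => \int[p t (X 0 w)]_y H (X 0 w, y)) /\
  \int[P]_w H (X 0 w, X t w) = \int[P]_w \int[p t (X 0 w)]_y H (X 0 w, y).
Proof.
move=> mH Hi HP; pose F := EFin \o H.
have mF : measurable_fun setT F by exact/measurable_EFinP.
have mFp := measurable_funepos mF; have mFn := measurable_funeneg mF.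
pose Gp x := (\int[p t x]_y F^\+ (x, y))%E.
pose Gn x := (\int[p t x]_y F^\- (x, y))%E.
have mGp : measurable_fun setT Gp by exact: measurable_kernel_integral.
have mGn : measurable_fun setT Gn by exact: measurable_kernel_integral.
have Gp0 x : (0 <= Gp x)%E by apply: integral_ge0.
have Gn0 x : (0 <= Gn x)%E by apply: integral_ge0.
have Ep : (\int[P]_w F^\+ (X 0 w, X t w) = \int[P]_w Gp (X 0 w))%E.
  exact: markov_ge0_integral.
have En : (\int[P]_w F^\- (X 0 w, X t w) = \int[P]_w Gn (X 0 w))%E.
  exact: markov_ge0_integral.
have GE x : (\int[p t x]_y (H (x, y))%:E = Gp x - Gn x)%E.
  rewrite integralE; congr (_ - _)%E; apply: eq_integral => y _.
    by rewrite !funeposE.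
  by rewrite !funenegE.
have Gpfin : (\int[P]_w Gp (X 0 w) < +oo)%E.
  have := integrable_pos_fin_num measurableT HP.
  rewrite ge0_fin_numE; last by apply: integral_ge0 => w _; exact: funepos_ge0.
  rewrite -Ep; congr (_ < _)%E; apply: eq_integral => w _.
  by rewrite !funeposE.
have Gnfin : (\int[P]_w Gn (X 0 w) < +oo)%E.
  have := integrable_neg_fin_num measurableT HP.
  rewrite ge0_fin_numE; last by apply: integral_ge0 => w _; exact: funeneg_ge0.
  rewrite -En; congr (_ < _)%E; apply: eq_integral => w _.
  by rewrite !funenegE.
have iGp : P.-integrable setT (Gp \o X 0).
  apply/integrableP; split; first exact: measurableT_comp.
  rewrite (eq_integral (fun w => Gp (X 0 w)))// => w _.
  by rewrite gee0_abs//; exact: Gp0.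
have iGn : P.-integrable setT (Gn \o X 0).
  apply/integrableP; split; first exact: measurableT_comp.
  rewrite (eq_integral (fun w => Gn (X 0 w)))// => w _.
  by rewrite gee0_abs//; exact: Gn0.
have RE x : ((\int[p t x]_y H (x, y))%R%:E = Gp x - Gn x)%E.
  by rewrite -L1_EFin_Rintegral.
split.
  have := integrableB measurableT iGp iGn.
  by apply: eq_integrable => // w _; rewrite /= -RE.
congr fine; transitivity (\int[P]_w (Gp (X 0 w) - Gn (X 0 w)))%E; last first.
  by apply: eq_integral => w _; rewrite RE.
rewrite (integralB measurableT iGp iGn) integralE.
rewrite -Ep -En; congr (_ - _)%E; apply: eq_integral => w _.
  by rewrite !funeposE.
by rewrite !funenegE.
Qed.

Lemma reversible_law C : measurable C ->
  P ((fun w => (X 0 w, X t w)) @^-1` C) = P ((fun w => (X t w, X 0 w)) @^-1` C).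
Proof. by move=> mC; exact: (markov_reversible hX t0 mC). Qed.

End fixed_time.
End markov_joint.

(** * Uniform approximation of the generator *)

Section generator_facts.
Context (R : realType) (dS : measure_display) (S : measurableType dS)
  (p : R -> R.-pker S ~> S).
Implicit Types f g : S -> R.

Lemma generator_domain_near f e : generator_domain p f -> 0 < e ->
  \forall t \near 0^'+, forall x, `|difference_quotient p f t x - generator p f x| <= e.
Proof.
move=> [_ _ uf] e0.
apply: (uf [set h | forall x, `|h x - generator p f x| <= e]).
apply/uniform_nbhs; exists [set xy | ball xy.1 e xy.2]; split.
  exact: (entourage_ball _ (PosNum e0)).
move=> h hh x /=; have := hh x I; rewrite /ball/= distrC; exact: ltW.
Qed.

Lemma generator_domain_L1 f : generator_domain p f ->
  \forall t \near 0^'+, forall x, L1 (p t x) f.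
Proof. by case. Qed.

Lemma measurable_cond_exp t f : measurable_fun setT f ->
  measurable_fun setT (cond_exp p t f).
Proof.
move=> mf; apply: (@measurable_kernel_Rintegral _ _ _ _ _ (p t) (fun z => f z.2)).
exact: measurableT_comp mf measurable_snd.
Qed.

(** Uniform convergence supplies a time for each n at which the difference quotient is within
    1/(n+1) of the generator, which is thus a pointwise limit of a sequence of measurable
    functions. *)
Lemma measurable_generator f : generator_domain p f ->
  measurable_fun setT (generator p f).
Proof.
move=> df; have [mf _ _] := df.
have hn n : exists t : R, forall x,
    `|difference_quotient p f t x - generator p f x| <= n.+1%:R^-1.
  have h0 : 0 < n.+1%:R^-1 :> R by rewrite invr_gt0.
  have [t ht] := @filter_ex _ _ (at_right_proper_filter (0 : R)) _
    (generator_domain_near df h0).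
  by exists t.
have [t ht] := choice hn.
apply: (@measurable_fun_cvg _ _ _ setT (fun n => difference_quotient p f (t n))).
  move=> n; apply: measurable_funM => //; apply: measurable_funB => //.
  exact: measurable_cond_exp.
move=> x _; apply/cvgrPdist_le => e e0.
have /cvgrPdist_le/(_ e e0) := @cvg_harmonic R; apply: filterS => n.
rewrite sub0r normrN ger0_norm ?invr_ge0// => hne.
by rewrite distrC; apply: le_trans hne.
Qed.

Lemma carre_du_champC f g x : carre_du_champ p f g x = carre_du_champ p g f x.
Proof.
have E : f \* g = g \* f by apply/funext => y; rewrite /= mulrC.
by rewrite /carre_du_champ E addrAC.
Qed.

End generator_facts.

(** * Local oscillation of the gradient of a test function *)

Section oscillation.
Variables (R : realType) (d : nat) (phi : 'cV[R]_d -> R).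
Hypothesis C1phi : class_C1 phi.

(** A substitute for uniform continuity of the gradient: every point belongs to this set once [r] is
    small enough, but how small depends on the point. *)
Definition small_oscillation (e r : R) : set 'cV[R]_d :=
  [set v : 'cV[R]_d | forall z : 'cV[R]_d, (forall i, `|z i 0 - v i 0| <= r) ->
     forall k, `|partial k phi z - partial k phi v| <= e].

(** The intersection over all displacements is uncountable, but each condition is closed because the
    gradient is continuous. *)
Lemma measurable_small_oscillation e r :
  measurable (small_oscillation e r : set (borelV R d)).
Proof.
suff : closed (small_oscillation e r).
  move=> cl; rewrite -[X in measurable X]setCK; apply: measurableC.
  by apply: sub_sigma_algebra; exact: closed_openC.
rewrite (_ : small_oscillation e r =
  \bigcap_(hk in [set hk : 'cV[R]_d * 'I_d | forall i, `|hk.1 i 0| <= r])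
    ((fun v : 'cV[R]_d => `|partial hk.2 phi (v + hk.1) - partial hk.2 phi v|) @^-1` [set x | x <= e])).
  apply: closed_bigI => -[h k] _ /=.
  have cs : continuous (fun v : 'cV[R]_d => partial k phi (v + h)).
    move=> v; apply: (@continuous_comp _ _ _ (fun v : 'cV[R]_d => v + h) (partial k phi)).
      have := @affine_continuous R d d h 1%:M v.
      by under eq_fun do rewrite mul1mx addrC.
    exact: C1phi.2.
  have ck : continuous (fun v : 'cV[R]_d => `|partial k phi (v + h) - partial k phi v|).
    exact: continuous_distR cs (C1phi.2 k).
  have /continuous_closedP := ck.
  by apply; exact: closed_le.
apply/seteqP; split=> [v hv [h k] /= hr|v hv z hz k].
  by apply: hv => i; rewrite mxE addrAC subrr add0r.
have := hv (z - v, k); rewrite /= [v + _]addrC subrK; apply => i.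
by rewrite !mxE.
Qed.

Lemma small_oscillation_near (v : 'cV[R]_d) e : 0 < e ->
  exists N, forall n, (N <= n)%N -> small_oscillation e n.+1%:R^-1 v.
Proof.
move=> e0.
have h : \forall z \near v, forall k, `|partial k phi z - partial k phi v| <= e.
  apply: (@filter_forall _ _ _ _ (nbhs_filter v)) => k.
  have /(@cvgrPdist_le _ _ _ (nbhs v) (nbhs_filter v))/(_ _ e0) := C1phi.2 k v.
  by apply: filterS => z; rewrite distrC.
have [r r0 hr] := nbhs_coord h.
exists (Num.truncn r^-1) => n Nn z hz; apply: hr => i.
apply: le_lt_trans (hz i) _; rewrite invf_plt ?posrE// ?ltr0n//.
by apply: lt_le_trans (truncnS_gt _) _; rewrite ler_nat ltnS.
Qed.

End oscillation.

(** * Second-order estimates and the limit t -> 0 *)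

Section reversible_ibp.
Context (R : realType) (dT : measure_display) (T : measurableType dT)
  (P : probability T R) (dS : measure_display) (S : measurableType dS)
  (mu : probability S R) (p : R -> R.-pker S ~> S) (X : R -> T -> S)
  (hX : stationary_reversible_markov P mu p X)
  (d : nat) (F : S -> 'cV[R]_d)
  (hF : generatorV_domain p F) (hFF : carre_du_champV_domain p F F)
  (hint : forall j, L1 P (component F j \o X 0))
  (hlim : forall rho : R, 0 < rho ->
     ((t^-1)%:E * 'E_P[(fun w => enorm (F (X t w) - F (X 0 w)) ^+ 2
                         * (rho < enorm (F (X t w) - F (X 0 w)))%R%:R)%R]
       @[t --> 0^'+] --> 0)%E).

Notation Fc := (component F).
Notation LF j := (generator p (Fc j)).
Notation G k j := (carre_du_champ p (Fc k) (Fc j)).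

Let D t j w := Fc j (X t w) - Fc j (X 0 w).
Let HD k j (z : S * S) := (Fc k z.2 - Fc k z.1) * (Fc j z.2 - Fc j z.1).
Let q t k j x := \int[p t x]_y HD k j (x, y).

Let mFc j : measurable_fun setT (Fc j). Proof. by case: (hF j). Qed.

Let mX t : 0 <= t -> measurable_fun setT (X t).
Proof. exact: (markov_measurable hX). Qed.

Let mX0 : measurable_fun setT (X 0). Proof. exact: mX. Qed.

Let mHD k j : measurable_fun setT (HD k j).
Proof.
by apply: measurable_funM; apply: measurable_funB;
  apply: measurableT_comp => //; exact: mFc.
Qed.

(** All that is asked of the semigroup at a small time: integrability under the kernel and uniform
    accuracy [e] of the difference quotients. The estimates hold at each such [t], and smallness is
    chosen once, at the end. *)
Let good (e t : R) := [/\ 0 < t, forall j x, L1 (p t x) (Fc j),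
  forall k j x, L1 (p t x) (Fc k \* Fc j),
  forall j x, `|difference_quotient p (Fc j) t x - LF j x| <= e &
  forall k j x, `|difference_quotient p (Fc k \* Fc j) t x -
                  generator p (Fc k \* Fc j) x| <= e].

Let good_near e : 0 < e -> \forall t \near 0^'+, good e t.
Proof.
move=> e0.
have h1 : \forall t \near (0 : R)^'+, forall j x, L1 (p t x) (Fc j).
  apply: filter_forall => j; exact: generator_domain_L1 (hF j).
have h2 : \forall t \near (0 : R)^'+, forall k j x, L1 (p t x) (Fc k \* Fc j).
  apply: filter_forall => k; apply: filter_forall => j.
  by apply: generator_domain_L1; case: (hFF k j).
have h3 : \forall t \near (0 : R)^'+, forall j x,
    `|difference_quotient p (Fc j) t x - LF j x| <= e.
  by apply: filter_forall => j; exact: generator_domain_near (hF j) e0.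
have h4 : \forall t \near (0 : R)^'+, forall k j x,
    `|difference_quotient p (Fc k \* Fc j) t x -
                  generator p (Fc k \* Fc j) x| <= e.
  apply: filter_forall => k; apply: filter_forall => j.
  by apply: generator_domain_near e0; case: (hFF k j).
near=> t; split.
- by near: t; exact: nbhs_right_gt.
- by near: t.
- by near: t.
- by near: t.
- by near: t.
Unshelve. all: by end_near. Qed.

Let L1_HD e t k j x : good e t -> L1 (p t x) (fun y => HD k j (x, y)).
Proof.
move=> [t0 h1 h2 _ _].
apply: (@L1_ext _ _ _ _ (fun y => ((Fc k \* Fc j) y - Fc j x * Fc k y) -
    (Fc k x * Fc j y - Fc k x * Fc j x))).
  by move=> y; rewrite /HD/=; ring.
by apply: L1B; apply: L1B; rewrite ?h2//; [exact: L1Zl|exact: L1Zl|exact: kernel_L1_cst].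
Qed.

(** Expanding the product of increments, the conditional second moment is t times the expression of
    2 Gamma with difference quotients in place of the generator. The three uniform errors enter with
    weights 1, |F_k| and |F_j|. *)
Let q_close e t k j x : good e t ->
  `|q t k j x - t * (2 * G k j x)| <= t * (e * (1 + `|Fc k x| + `|Fc j x|)).
Proof.
move=> [t0 h1 h2 h3 h4].
have qE : q t k j x = t * (difference_quotient p (Fc k \* Fc j) t x -
    Fc k x * difference_quotient p (Fc j) t x -
    Fc j x * difference_quotient p (Fc k) t x).
  rewrite /q /HD /difference_quotient /cond_exp /=.
  rewrite (@eq_Rintegral _ _ _ _ _ (fun y => ((Fc k \* Fc j) y - Fc j x * Fc k y) -
    (Fc k x * Fc j y - Fc k x * Fc j x))); last by move=> y _ /=; ring.
  have i1 := h2 k j x.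
  have i2 := L1Zl (Fc j x) (h1 k x).
  have i3 := L1Zl (Fc k x) (h1 j x).
  have i4 := kernel_L1_cst (p t) x (Fc k x * Fc j x).
  rewrite (RintegralB _ (L1B i1 i2) (L1B i3 i4))// (RintegralB _ i1 i2)//.
  rewrite (RintegralB _ i3 i4)//.
  rewrite kernel_Rintegral_cst.
  rewrite (RintegralZl (Fc j x) measurableT (h1 k x)) (RintegralZl (Fc k x) measurableT (h1 j x)).
  by field; rewrite gt_eqF.
rewrite qE /carre_du_champ -mulrBr normrM gtr0_norm// ler_wpM2l ?(ltW t0)//.
have := h4 k j x; have := h3 j x; have := h3 k x.
set A1 := difference_quotient _ (Fc k) _ _; set A2 := difference_quotient _ (Fc j) _ _.
set A3 := difference_quotient _ _ _ _; set B1 := LF k x; set B2 := LF j x.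
set B3 := generator _ _ _ => e1 e2 e3.
rewrite [X in `|X|](_ : _ = (A3 - B3) - (Fc k x * (A2 - B2) + Fc j x * (A1 - B1))); last by field.
apply: le_trans (ler_normB _ _) _; apply: (@le_trans _ _ (e + (`|Fc k x| * e + `|Fc j x| * e))).
  by rewrite lerD//; apply: le_trans (ler_normD _ _) _; rewrite !normrM lerD// ler_wpM2l.
by rewrite le_eqVlt; apply/orP; left; apply/eqP; ring.
Qed.

Hypothesis L1G : forall k j, L1 P (fun w => G k j (X 0 w)).

Let M k j := \int[P]_w (1 + `|Fc k (X 0 w)| + `|Fc j (X 0 w)|).

Let L1M k j : L1 P (fun w => 1 + `|Fc k (X 0 w)| + `|Fc j (X 0 w)|).
Proof.
apply: L1D; last exact: L1_norm (hint j).
by apply: L1D; [exact: L1_cst|exact: L1_norm (hint k)].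
Qed.

Let M_ge0 k j : 0 <= M k j.
Proof. by apply: Rintegral_ge0 => w _; rewrite !addr_ge0. Qed.

(** F(X_0) is only integrable, yet its increments are square integrable: their conditional second
    moment is at most 2 t |Gamma| plus a term linear in |F_k|, and both are integrable. *)
Let L1_D2 e t k : good e t -> L1 P (fun w => D t k w ^+ 2).
Proof.
move=> gt; have [t0 _ _ _ _] := gt.
apply: (markov_L1 hX (ltW t0) (H := fun z => (Fc k z.2 - Fc k z.1) ^+ 2)).
  exact: (mHD k k).
pose b w := 2 * t * `|G k k (X 0 w)| +
  t * e * (1 + `|Fc k (X 0 w)| + `|Fc k (X 0 w)|).
have ib : L1 P b.
  by apply: L1D; apply: L1Zl; [exact: L1_norm (L1G k k)|exact: L1M].
apply: le_lt_trans (L1_integral_lty ib).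
have mH : measurable_fun setT (fun z => `|HD k k z|%:E).
  by apply/measurable_EFinP; exact: measurableT_comp (mHD k k).
apply: ge0_le_integral => //.
- by move=> w _; apply: integral_ge0.
- exact: measurableT_comp (measurable_kernel_integral (p t) _ mH) mX0.
- by apply/measurable_EFinP; exact: L1_measurable ib.
- move=> w _.
  rewrite [leLHS](_ : _ = (q t k k (X 0 w))%:E); last first.
    rewrite /q -L1_EFin_Rintegral; last exact: L1_HD gt.
    by apply: eq_integral => y _; rewrite ger0_norm// sqr_ge0.
  rewrite lee_fin; have := q_close k k (X 0 w) gt.
  rewrite ler_norml => /andP[_]; rewrite lerBlDr => /le_trans; apply.
  rewrite addrC /b mulrA [t * 2]mulrC; apply: lerD; last by rewrite mulrA.
  by rewrite ler_wpM2l ?mulr_ge0 ?(ltW t0)// ler_norm.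
Qed.

Let mD t j : 0 <= t -> measurable_fun setT (D t j).
Proof.
move=> t0; apply: measurable_funB; apply: measurableT_comp => //.
exact: mX.
Qed.

Let L1_DD e t k j : good e t -> L1 P (fun w => D t k w * D t j w).
Proof.
move=> gt; have [t0 _ _ _ _] := gt.
apply: (L1_le _ (L1D (L1_D2 k gt) (L1_D2 j gt))).
  by apply: measurable_funM; apply: mD; exact: ltW.
move=> w; rewrite normrM -[D t k w ^+ 2]real_normK ?num_real//.
rewrite -[D t j w ^+ 2]real_normK ?num_real//.
have := sqr_ge0 (`|D t k w| - `|D t j w|).
have := sqr_ge0 (`|D t k w|); have := sqr_ge0 (`|D t j w|); nra.
Qed.

(** Conditioning on X_0 takes the weight u(X_0) out of the inner integral, so the pointwise estimate
    can be integrated against it. *)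
Let E_uDD e t k j (u : S -> R) C : good e t -> 0 <= e ->
  measurable_fun setT u -> (forall x, `|u x| <= C) ->
  `|\int[P]_w (u (X 0 w) * (D t k w * D t j w)) -
    t * (2 * \int[P]_w (u (X 0 w) * G k j (X 0 w)))| <=
  t * (e * (C * M k j)).
Proof.
move=> gt e0 mu' uC; have [t0 _ _ _ _] := gt.
have mu0 : measurable_fun setT (u \o X 0) by exact: measurableT_comp.
pose H (z : S * S) := u z.1 * HD k j z.
have mH : measurable_fun setT H.
  apply: measurable_funM; last exact: mHD.
  exact: measurableT_comp mu' measurable_fst.
have iH x : L1 (p t x) (fun y => H (x, y)) by exact: (L1Zl (u x) (L1_HD k j x gt)).
have iHP : L1 P (fun w => H (X 0 w, X t w)).
  by apply: (L1_mul_bounded (C := C) (L1_DD k j gt)).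
have [iq E] := markov_Rintegral hX (ltW t0) mH iH iHP.
have qE w : \int[p t (X 0 w)]_y H (X 0 w, y) = u (X 0 w) * q t k j (X 0 w).
  by rewrite /H /= RintegralZl//; exact: L1_HD gt.
have iuG : L1 P (fun w => u (X 0 w) * G k j (X 0 w)).
  by apply: (L1_mul_bounded (C := C) (L1G k j)).
rewrite [X in `|X - _|](_ : _ = \int[P]_w \int[p t (X 0 w)]_y H (X 0 w, y)) //.
have i2 := L1Zl (t * 2) iuG; have i3 := L1Zl (t * (e * C)) (L1M k j).
rewrite [t * (2 * _)]mulrA -(RintegralZl (t * 2) measurableT iuG) -(RintegralB measurableT iq i2).
rewrite [e * _]mulrA [leRHS]mulrA -(RintegralZl _ measurableT (L1M k j)).
apply: (le_Rintegral_norm _ i3); first exact: L1B.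
move=> w; rewrite qE mulrCA -mulrBr normrM.
have C0 : 0 <= C by exact: le_trans (normr_ge0 _) (uC (X 0 w)).
apply: le_trans (ler_wpM2r (normr_ge0 _) (uC _)) _.
rewrite [leRHS](_ : _ = C * (t * (e *
  (1 + `|Fc k (X 0 w)| + `|Fc j (X 0 w)|)))); last by ring.
by rewrite ler_wpM2l// -[t * 2 * _]mulrA; exact: q_close.
Qed.

Lemma measurable_statistic : measurable_fun setT (F : S -> borelV R d).
Proof. by apply: measurable_fun_borelV => i; exact: mFc. Qed.

Section test_function.
Variables (phi : 'cV[R]_d -> R) (C : R).
Hypotheses (C1phi : class_C1 phi) (cphi : continuous phi)
  (phiC : forall k x, `|partial k phi x| <= C)
  (phi2 : L1 P (fun w => phi (F (X 0 w)) ^+ 2)).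

Let mphi : measurable_fun setT (fun x => phi (F x)).
Proof. exact: measurable_continuous_comp cphi measurable_statistic. Qed.

Let mpartial k : measurable_fun setT (fun x => partial k phi (F x)).
Proof. exact: measurable_continuous_comp (C1phi.2 k) measurable_statistic. Qed.

Let L1phi : L1 P (fun w => phi (F (X 0 w))).
Proof.
apply: (L1_le _ (L1D (L1_cst P 1) phi2)).
  exact: measurableT_comp mphi mX0.
move=> w /=; rewrite -[_ ^+ 2]real_normK ?num_real//.
have := sqr_ge0 (`|phi (F (X 0 w))| - 1); nra.
Qed.

Let L1_phiD e t j : good e t -> L1 P (fun w => phi (F (X 0 w)) * D t j w).
Proof.
move=> gt; have [t0 _ _ _ _] := gt.
apply: (L1_le _ (L1D phi2 (L1_D2 j gt))).
  apply: measurable_funM; last exact: mD (ltW t0).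
  exact: measurableT_comp mphi mX0.
move=> w; rewrite normrM -[phi _ ^+ 2]real_normK ?num_real//.
rewrite -[D t j w ^+ 2]real_normK ?num_real//.
have := sqr_ge0 (`|phi (F (X 0 w))| - `|D t j w|).
have := sqr_ge0 (`|phi (F (X 0 w))|); have := sqr_ge0 (`|D t j w|); nra.
Qed.

(** Integrability of phi LF_j is obtained at a fixed time: phi and the increment are square
    integrable, so phi times the difference quotient is integrable, and the quotient differs from
    LF_j by at most e. *)
Let E_phiD e t j : good e t -> 0 <= e ->
  L1 P (fun w => phi (F (X 0 w)) * LF j (X 0 w)) /\
  `|\int[P]_w (phi (F (X 0 w)) * D t j w) -
    t * \int[P]_w (phi (F (X 0 w)) * LF j (X 0 w))| <=
  t * (e * \int[P]_w `|phi (F (X 0 w))|).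
Proof.
move=> gt e0; have [t0 h1 _ h3 _] := gt.
pose H (z : S * S) := phi (F z.1) * (Fc j z.2 - Fc j z.1).
have mH : measurable_fun setT H.
  apply: measurable_funM; first exact: measurableT_comp mphi measurable_fst.
  by apply: measurable_funB; apply: measurableT_comp.
have iB x : L1 (p t x) (fun y => Fc j y - Fc j x).
  by apply: L1B; [exact: h1|exact: kernel_L1_cst].
have iH x : L1 (p t x) (fun y => H (x, y)) by exact: (L1Zl (phi (F x)) (iB x)).
have iHP : L1 P (fun w => H (X 0 w, X t w)) by exact: L1_phiD gt.
have [iq E] := markov_Rintegral hX (ltW t0) mH iH iHP.
pose dq w := difference_quotient p (Fc j) t (X 0 w).
have qE w : \int[p t (X 0 w)]_y H (X 0 w, y) = phi (F (X 0 w)) * (t * dq w).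
  rewrite /H /= (RintegralZl (phi (F (X 0 w))) measurableT (iB (X 0 w))).
  rewrite (RintegralB measurableT (h1 j (X 0 w)) (kernel_L1_cst (p t) _ (Fc j (X 0 w)))).
  rewrite kernel_Rintegral_cst /dq /difference_quotient /cond_exp [t * _]mulrC.
  by rewrite divfK// gt_eqF.
have mdq : measurable_fun setT dq.
  apply: (@measurableT_comp _ _ _ _ _ _ (difference_quotient p (Fc j) t)) mX0.
  apply: measurable_funM => //; apply: measurable_funB => //.
  exact: measurable_cond_exp.
have mLF : measurable_fun setT (fun w => LF j (X 0 w)).
  exact: measurableT_comp (measurable_generator (hF j)) mX0.
have mphi0 : measurable_fun setT (fun w => phi (F (X 0 w))).
  exact: measurableT_comp mphi mX0.
have i1 : L1 P (fun w => phi (F (X 0 w)) * dq w).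
  apply: L1_ext (L1Zl t^-1 iq) => w; rewrite qE mulrCA mulKf// gt_eqF//.
have i2 : L1 P (fun w => phi (F (X 0 w)) * (dq w - LF j (X 0 w))).
  apply: (L1_le _ (L1Zl e (L1_norm L1phi))).
    by apply: measurable_funM => //; exact: measurable_funB.
  by move=> w; rewrite normrM mulrC ler_wpM2r//; exact: h3.
have iL : L1 P (fun w => phi (F (X 0 w)) * LF j (X 0 w)).
  by apply: L1_ext (L1B i1 i2) => w; rewrite -mulrBr subKr.
split => //.
rewrite [X in `|X - _|](_ : _ = \int[P]_w \int[p t (X 0 w)]_y H (X 0 w, y))//.
rewrite -(RintegralZl t measurableT iL) -(RintegralB measurableT iq (L1Zl t iL)).
rewrite mulrA -(RintegralZl (t * e) measurableT (L1_norm L1phi)).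
apply: le_Rintegral_norm.
- exact: (L1B iq (L1Zl t iL)).
- exact: (L1Zl (t * e) (L1_norm L1phi)).
move=> w; rewrite qE mulrCA -mulrBr -mulrBr normrM gtr0_norm// -mulrA ler_wpM2l ?(ltW t0)//.
by rewrite normrM mulrC ler_wpM2r//; exact: h3.
Qed.

(** Exchanging X_0 and X_t reverses the increment, so replacing phi(W_0) by phi(W_t) changes only
    the sign of the mean. *)
Let symmetrize e t j : good e t ->
  L1 P (fun w => (phi (F (X t w)) - phi (F (X 0 w))) * D t j w) /\
  2 * \int[P]_w (phi (F (X 0 w)) * D t j w) =
  - \int[P]_w ((phi (F (X t w)) - phi (F (X 0 w))) * D t j w).
Proof.
move=> gt; have [t0 _ _ _ _] := gt; have i1 := L1_phiD j gt.
pose f (z : S * S) := phi (F z.1) * (Fc j z.2 - Fc j z.1).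
have mf : measurable_fun setT f.
  apply: measurable_funM; first exact: measurableT_comp mphi measurable_fst.
  by apply: measurable_funB; apply: measurableT_comp.
have mXt := mX (ltW t0).
have m1 : measurable_fun setT (fun w => (X 0 w, X t w)) by exact: measurable_fun_pair.
have m2 : measurable_fun setT (fun w => (X t w, X 0 w)) by exact: measurable_fun_pair.
have rev := reversible_law hX (ltW t0).
have i2' : L1 P (fun w => f (X t w, X 0 w)).
  exact: (@law_L1 R _ _ _ _ _ _ P P _ _ m1 m2 rev f mf i1).
have E := @law_Rintegral R _ _ _ _ _ _ P P _ _ m1 m2 rev f mf.
have i2 : L1 P (fun w => phi (F (X t w)) * D t j w).
  by apply: L1_ext (L1N i2') => w; rewrite /f /D /= -mulrN opprB.
have E2 : \int[P]_w (phi (F (X 0 w)) * D t j w) =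
    - \int[P]_w (phi (F (X t w)) * D t j w).
  rewrite -mulN1r -RintegralZl// [LHS]E; apply: eq_Rintegral => w _.
  by rewrite /f /D /= mulN1r -mulrN opprB.
have i3 : L1 P (fun w => (phi (F (X t w)) - phi (F (X 0 w))) * D t j w).
  by apply: L1_ext (L1B i2 i1) => w; rewrite mulrBl.
split => //.
have -> : \int[P]_w ((phi (F (X t w)) - phi (F (X 0 w))) * D t j w) =
    \int[P]_w (phi (F (X t w)) * D t j w) - \int[P]_w (phi (F (X 0 w)) * D t j w).
  by rewrite -(RintegralB measurableT i2 i1); apply: eq_Rintegral => w _; rewrite mulrBl.
by rewrite E2; ring.
Qed.

Let Q t w := \sum_k D t k w ^+ 2.

Let QE t w : enorm (F (X t w) - F (X 0 w)) ^+ 2 = Q t w.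
Proof. by rewrite sqr_enorm; apply: eq_bigr => k _; rewrite !mxE. Qed.

Let Q_ge0 t w : 0 <= Q t w.
Proof. by apply: sumr_ge0 => k _; exact: sqr_ge0. Qed.

Let L1Q e t : good e t -> L1 P (Q t).
Proof. by move=> gt; apply: L1_sum => k; exact: (L1_D2 k gt). Qed.

Let far rho t w : R := (rho < enorm (F (X t w) - F (X 0 w)))%R%:R.

Let mfar rho t : 0 <= t -> measurable_fun setT (far rho t).
Proof.
move=> t0.
have mdF : measurable_fun setT (fun w => F (X t w) - F (X 0 w) : borelV R d).
  apply: measurable_fun_borelV => i; under eq_fun do rewrite !mxE.
  exact: mD.
have men : measurable_fun setT (fun w => enorm (F (X t w) - F (X 0 w))).
  by apply: measurable_continuous_comp mdF; exact: enorm_continuous.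
rewrite (_ : far rho t = fun w => \1_(`]rho, +oo[%classic : set R)
    (enorm (F (X t w) - F (X 0 w)))); last first.
  apply/funext => w; rewrite /far indicE; congr (_%:R); congr nat_of_bool.
  by apply/idP/idP; rewrite inE/= in_itv/= andbT.
exact: measurableT_comp (measurable_indic (measurable_itv `]rho, +oo[)) men.
Qed.

Let L1_Qfar e t rho : good e t -> L1 P (fun w => Q t w * far rho t w).
Proof.
move=> gt; have [t0 _ _ _ _] := gt.
apply: (L1_ext (f := fun w => far rho t w * Q t w)); first by move=> w; rewrite mulrC.
apply: (L1_mul_bounded (C := 1) (L1Q gt)); first exact: mfar (ltW t0).
by move=> w; rewrite /far; case: (_ < _); rewrite ?normr1 ?normr0.
Qed.

Let far_near e rho eta : 0 < e -> 0 < rho -> 0 < eta -> \forall t \near 0^'+,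
  good e t /\ \int[P]_w (Q t w * far rho t w) <= t * eta.
Proof.
move=> e0 rho0 eta0.
have /fine_cvgP[_ /cvgrPdist_le/(_ _ eta0) h] := hlim rho0.
near=> t; have gt : good e t by near: t; exact: good_near.
split => //; have [t0 _ _ _ _] := gt.
have : `|0 - (fine \o (fun t : R => (t^-1)%:E * 'E_P[(fun w =>
   enorm (F (X t w) - F (X 0 w)) ^+ 2 *
   (rho < enorm (F (X t w) - F (X 0 w)))%R%:R)%R])%E) t| <= eta by near: t.
rewrite /= sub0r normrN.
rewrite (_ : (fun w => _) = fun w => Q t w * far rho t w); last first.
  by apply/funext => w; rewrite QE.
rewrite (expectation_Rintegral (L1_Qfar rho gt)) -EFinM/= => /(le_trans (ler_norm _)).
by rewrite mulrC ler_pdivrMr// mulrC.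
Unshelve. all: by end_near. Qed.

Let rough eps r x : R := \1_(~` small_oscillation phi eps r) (F x).

Let mrough eps r : measurable_fun setT (rough eps r).
Proof.
have ms : measurable (~` small_oscillation phi eps r : set (borelV R d)).
  by apply: measurableC; exact: measurable_small_oscillation.
exact: measurableT_comp (measurable_indic ms) measurable_statistic.
Qed.

Let rough01 eps r x : `|rough eps r x| <= 1.
Proof. by rewrite /rough indicE; case: (_ \in _); rewrite ?normr1 ?normr0. Qed.

Let rough_ge0 eps r x : 0 <= rough eps r x. Proof. by rewrite /rough indicE. Qed.

(** By continuity of the gradient each point leaves the rough set as the cube shrinks; dominated
    convergence applies since Gamma(F_k, F_k)(X_0) is integrable. *)
Let rough_small eps eta : 0 < eps -> 0 < eta ->
  exists n, forall k, \int[P]_w (rough eps n.+1%:R^-1 (X 0 w) * `|G k k (X 0 w)|) <= eta.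
Proof.
move=> eps0 eta0.
have h k : \forall n \near \oo,
    \int[P]_w (rough eps n.+1%:R^-1 (X 0 w) * `|G k k (X 0 w)|) <= eta.
  pose f_ n w := (rough eps n.+1%:R^-1 (X 0 w) * `|G k k (X 0 w)|)%:E.
  have iG := L1_norm (L1G k k).
  have mf n : measurable_fun setT (f_ n).
    apply/measurable_EFinP; apply: measurable_funM; last exact: L1_measurable iG.
    exact: measurableT_comp (mrough _ _) mX0.
  have : (\int[P]_w f_ n w @[n --> \oo] --> \int[P]_w (cst 0 w))%E.
    apply: (@dominated_cvg _ _ _ P _ measurableT _ _
        (fun w => `|G k k (X 0 w)|%:E)) => //.
    - move=> w _; apply: cvg_near_cst.
      have [N hN] := small_oscillation_near C1phi (F (X 0 w)) eps0.
      exists N => // n /= Nn; rewrite /f_ /rough indicE memNset ?mul0r//=.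
      by move=> h; apply: h; exact: hN.
    - move=> n w _; rewrite /f_ lee_fin normrM normr_id.
      by rewrite ler_piMl.
  rewrite integral0 => /fine_cvgP[_ /cvgrPdist_le/(_ _ eta0)].
  apply: filterS => n /=; rewrite sub0r normrN; apply: le_trans.
  exact: ler_norm.
have [N _ hN] := filter_forall _ h.
by exists N => k; exact: (hN N (leqnn N) k).
Qed.

Let Rm t w := phi (F (X t w)) - phi (F (X 0 w)) -
  \sum_k partial k phi (F (X 0 w)) * D t k w.

(** With N1 the sum of the |D_k|, the remainder is at most eps N1 when W_0 is a point of small
    oscillation and the jump has size at most r. At a rough point or for a larger jump the bound on
    the partial derivatives gives 2 C N1. The factor d + 1 comes from N1 |D_j| <= (d + 1) Q. *)
Let Rm_le eps r t j w : 0 <= eps ->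
  `|Rm t w * D t j w| <= d.+1%:R * (eps * Q t w +
    2 * C * (rough eps r (X 0 w) * Q t w) + 2 * C * (Q t w * far r t w)).
Proof.
move=> eps0.
have C0 : 0 <= C by exact: le_trans (normr_ge0 _) (phiC j (F (X 0 w))).
have DE k : (F (X t w)) k 0 - (F (X 0 w)) k 0 = D t k w by [].
pose N1 := \sum_k `|D t k w|.
have N1D : N1 * `|D t j w| <= d.+1%:R * Q t w.
  rewrite mulr_suml; apply: (@le_trans _ _ (\sum_k (D t k w ^+ 2 + D t j w ^+ 2))).
    apply: ler_sum => k _; rewrite -[D t k w ^+ 2]real_normK ?num_real//.
    rewrite -[D t j w ^+ 2]real_normK ?num_real//.
    have := sqr_ge0 (`|D t k w| - `|D t j w|).
    have := sqr_ge0 (`|D t k w|); have := sqr_ge0 (`|D t j w|); nra.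
  rewrite big_split/= sumr_const card_ord -[X in _ + X]mulr_natl -nat1r mulrDl mul1r lerD2l.
  rewrite ler_wpM2l// /Q (bigD1 j)//= lerDl; apply: sumr_ge0 => k _; exact: sqr_ge0.
have key e : 0 <= e -> `|Rm t w| <= e * N1 -> `|Rm t w * D t j w| <= d.+1%:R * (e * Q t w).
  move=> e0 h; rewrite normrM; apply: le_trans (ler_wpM2r (normr_ge0 _) h) _.
  by rewrite -mulrA [leRHS]mulrCA ler_wpM2l.
have Qr : 0 <= rough eps r (X 0 w) * Q t w by rewrite mulr_ge0.
have Qf : 0 <= Q t w * far r t w by rewrite mulr_ge0.
have R2C : `|Rm t w| <= 2 * C * N1.
  apply: (C1_remainder C1phi.1) => k z _; apply: le_trans (ler_normB _ _) _.
  by rewrite mulr_natl mulr2n lerD.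
have [osc|osc] := pselect (small_oscillation phi eps r (F (X 0 w))); last first.
  apply: le_trans (key _ _ R2C) _; first by rewrite mulr_ge0.
  rewrite ler_wpM2l// /rough indicE mem_set// mul1r addrAC addrC lerDl.
  by rewrite addr_ge0 ?mulr_ge0.
have [fr|fr] := boolP (r < enorm (F (X t w) - F (X 0 w))).
  apply: le_trans (key _ _ R2C) _; first by rewrite mulr_ge0.
  rewrite ler_wpM2l// /far fr mulr1 addrC lerDl.
  by rewrite addr_ge0 ?mulr_ge0.
apply: (@le_trans _ _ (d.+1%:R * (eps * Q t w))); last first.
  by rewrite ler_wpM2l// -addrA lerDl addr_ge0 ?mulr_ge0.
apply: key => //; apply: (C1_remainder C1phi.1) => k z hz; apply: osc => i.
apply: le_trans (hz i) _; move: fr; rewrite -leNgt; apply: le_trans.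
by have := ler_entry_hsnorm (F (X t w) - F (X 0 w)) i 0; rewrite !mxE.
Qed.

(** Applied with u = 1 and with u the indicator of the rough set. *)
Let E_Q e t (u : S -> R) : good e t -> 0 <= e -> measurable_fun setT u ->
    (forall x, 0 <= u x) -> (forall x, `|u x| <= 1) ->
  \int[P]_w (u (X 0 w) * Q t w) <=
  t * (2 * (\sum_k \int[P]_w (u (X 0 w) * `|G k k (X 0 w)|)) + e * \sum_k M k k).
Proof.
move=> gt e0 mu' u0 u1; have [t0 _ _ _ _] := gt.
have mu0 : measurable_fun setT (fun w => u (X 0 w)) by exact: measurableT_comp.
have iD k : L1 P (fun w => u (X 0 w) * (D t k w * D t k w)).
  by apply: (L1_mul_bounded (C := 1) (L1_DD k k gt)).
have iG k : L1 P (fun w => u (X 0 w) * G k k (X 0 w)).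
  by apply: (L1_mul_bounded (C := 1) (L1G k k)).
have iG' k : L1 P (fun w => u (X 0 w) * `|G k k (X 0 w)|).
  by apply: (L1_mul_bounded (C := 1) (L1_norm (L1G k k))).
rewrite (@eq_Rintegral _ _ _ P setT (fun w =>
  \sum_k (u (X 0 w) * (D t k w * D t k w)))); last first.
  by move=> w _; rewrite -mulr_sumr; congr (_ * _); apply: eq_bigr => k _; rewrite expr2.
rewrite Rintegral_sum// [leRHS]mulrDr mulrA mulrA !mulr_sumr -big_split/=.
apply: ler_sum => k _; have := E_uDD k k gt e0 mu' u1.
rewrite ler_norml mul1r => /andP[_]; rewrite lerBlDr addrC => /le_trans; apply.
rewrite mulrA lerD2l mulrA ler_wpM2l ?mulr_ge0 ?(ltW t0)//.
by apply: le_Rintegral => // w _; rewrite ler_wpM2l// ler_norm.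
Qed.

Let m := \sum_k M k k.

Let m_ge0 : 0 <= m. Proof. by apply: sumr_ge0 => k _; exact: M_ge0. Qed.

Lemma reversible_ibp j :
  L1 P (fun w => phi (F (X 0 w)) * LF j (X 0 w)) /\
  \int[P]_w (phi (F (X 0 w)) * LF j (X 0 w)) =
  - \sum_k \int[P]_w (partial k phi (F (X 0 w)) * G k j (X 0 w)).
Proof.
have [t1 gt1] := @filter_ex _ _ (at_right_proper_filter (0 : R)) _ (good_near ltr01).
have [iL _] := E_phiD j gt1 ler01; split => //.
have C0 : 0 <= C by exact: le_trans (normr_ge0 _) (phiC j 0).
set I := \int[P]_w _; set J := \sum_k _.
pose A := \int[P]_w `|phi (F (X 0 w))|.
have A0 : 0 <= A by exact: Rintegral_ge0.
pose g := \sum_k \int[P]_w `|G k k (X 0 w)|.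
have g0 : 0 <= g by apply: sumr_ge0 => k _; exact: Rintegral_ge0.
pose mj := \sum_k M k j.
have mj0 : 0 <= mj by apply: sumr_ge0 => k _; exact: M_ge0.
(* Neither constant depends on [t] or [eta]. [K1] collects the three parts of the remainder bound,
   for small oscillation, rough points and large jumps; [K] adds the errors of the generator term
   and of the second-order term. *)
pose K1 := 2 * g + m + 2 * C * (2 * d%:R + m) + 2 * C.
pose K := 2 * A + C * mj + d.+1%:R * K1.
suff main eta : 0 < eta -> eta <= 1 -> `|2 * I + 2 * J| <= K * eta.
  have K10 : 0 <= K1 by rewrite !addr_ge0 ?mulr_ge0 ?addr_ge0 ?mulr_ge0.
  have K0 : 0 <= K by rewrite !addr_ge0 ?mulr_ge0.
  apply/eqP; rewrite -addr_eq0 -normr_le0; apply/ler_addgt0Pr => e e0; rewrite add0r.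
  pose eta := Num.min 1 (e / (K + 1)).
  have K10' : 0 < K + 1 by rewrite ltr_wpDl.
  have eta0 : 0 < eta by rewrite lt_min ltr01 divr_gt0.
  have eta1 : eta <= 1 by rewrite ge_min lexx.
  have etaK : K * eta <= e.
    apply: (@le_trans _ _ ((K + 1) * eta)); first by rewrite ler_wpM2r ?(ltW eta0)// lerDl.
    by rewrite mulrC -ler_pdivlMr// ge_min lexx orbT.
  have := le_trans (main _ eta0 eta1) etaK; rewrite -mulrDr normrM ger0_norm//.
  by have := normr_ge0 (I + J); lra.
move=> eta0 eta1.
(* The order matters: the half-width 1/(n+1) is fixed by the rough set, and [t] is then taken small
   for jumps beyond that half-width. *)
have [n hn] := rough_small eta0 eta0.
have n0 : 0 < n.+1%:R^-1 :> R by rewrite invr_gt0.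
have [t [gt ht]] := @filter_ex _ _ (at_right_proper_filter (0 : R)) _
  (far_near eta0 n0 eta0).
have [t0 _ _ _ _] := gt.
have e0 := ltW eta0.
have [_ a1] := E_phiD j gt e0.
have a2 k := E_uDD k j gt e0 (mpartial k) (fun x => phiC k (F x)).
have [iS sym] := symmetrize j gt.
have b1 : \int[P]_w Q t w <= t * (2 * g + eta * m).
  rewrite (@eq_Rintegral _ _ _ P setT (fun w => (cst 1 : S -> R) (X 0 w) * Q t w)); last first.
    by move=> w _ /=; rewrite mul1r.
  rewrite (_ : g = \sum_k \int[P]_w ((cst 1 : S -> R) (X 0 w) * `|G k k (X 0 w)|)); last first.
    by apply: eq_bigr => k _; apply: eq_Rintegral => w _ /=; rewrite mul1r.
  by apply: E_Q gt e0 _ _ _ => //= x; rewrite normr1.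
pose r := n.+1%:R^-1 : R.
have b2 : \int[P]_w (rough eta r (X 0 w) * Q t w) <= t * (2 * (d%:R * eta) + eta * m).
  apply: (le_trans (E_Q gt e0 (mrough eta r) (rough_ge0 eta r) (rough01 eta r))).
  rewrite ler_wpM2l ?(ltW t0)// lerD2r ler_wpM2l//.
  apply: le_trans (ler_sum _ (fun k _ => hn k)) _.
  by rewrite sumr_const card_ord mulr_natl.
have iQ := L1Q gt.
have irQ : L1 P (fun w => rough eta r (X 0 w) * Q t w).
  apply: (L1_mul_bounded (C := 1) iQ); last by move=> w; exact: rough01.
  exact: measurableT_comp (mrough _ _) mX0.
have iQf := L1_Qfar r gt.
have iB k : L1 P (fun w => partial k phi (F (X 0 w)) * (D t k w * D t j w)).
  apply: (L1_mul_bounded (C := C) (L1_DD k j gt)); last by move=> w; exact: phiC.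
  exact: measurableT_comp (mpartial k) mX0.
have iR : L1 P (fun w => Rm t w * D t j w).
  apply: L1_ext (L1B iS (L1_sum (index_enum _) iB)) => w.
  rewrite /Rm [RHS]mulrBl mulr_suml; congr (_ - _); apply: eq_bigr => k _.
  by rewrite mulrA.
have RE : \int[P]_w (Rm t w * D t j w) =
    \int[P]_w ((phi (F (X t w)) - phi (F (X 0 w))) * D t j w) -
    \sum_k \int[P]_w (partial k phi (F (X 0 w)) * (D t k w * D t j w)).
  rewrite -Rintegral_sum// -(RintegralB measurableT iS (L1_sum (index_enum _) iB)).
  apply: eq_Rintegral => w _; rewrite /Rm [LHS]mulrBl mulr_suml; congr (_ - _).
  by apply: eq_bigr => k _; rewrite mulrA.
have b3 : `|\int[P]_w (Rm t w * D t j w)| <= d.+1%:R * (eta * \int[P]_w Q t w +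
    2 * C * \int[P]_w (rough eta r (X 0 w) * Q t w) +
    2 * C * \int[P]_w (Q t w * far r t w)).
  have i1 := L1Zl eta iQ; have i2 := L1Zl (2 * C) irQ; have i3 := L1Zl (2 * C) iQf.
  rewrite -(RintegralZl eta measurableT iQ) -(RintegralZl (2 * C) measurableT irQ).
  rewrite -(RintegralZl (2 * C) measurableT iQf).
  rewrite -(RintegralD measurableT i1 i2) -(RintegralD measurableT (L1D i1 i2) i3).
  rewrite -(RintegralZl d.+1%:R measurableT (L1D (L1D i1 i2) i3)).
  apply: (le_Rintegral_norm iR); first exact: L1Zl (L1D (L1D i1 i2) i3).
  by move=> w; exact: Rm_le.
have b4 : `|\int[P]_w (Rm t w * D t j w)| <= t * (d.+1%:R * K1 * eta).
  apply: le_trans b3 _; rewrite [leRHS](_ : _ = d.+1%:R * (t * K1 * eta)); last by ring.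
  rewrite ler_wpM2l//.
  have h1 : \int[P]_w Q t w <= t * (2 * g + m).
    by apply: le_trans b1 _; rewrite ler_wpM2l ?(ltW t0)// lerD2l ler_piMl.
  have h2 : 2 * C * \int[P]_w (rough eta r (X 0 w) * Q t w) <=
      2 * C * (t * (2 * (d%:R * eta) + eta * m)) by rewrite ler_wpM2l ?mulr_ge0.
  have h3 : 2 * C * \int[P]_w (Q t w * far r t w) <= 2 * C * (t * eta).
    by rewrite ler_wpM2l ?mulr_ge0.
  apply: le_trans (lerD (lerD (ler_wpM2l e0 h1) h2) h3) _.
  by rewrite le_eqVlt; apply/orP; left; apply/eqP; rewrite /K1; ring.
have b5 : `|\sum_k \int[P]_w (partial k phi (F (X 0 w)) * (D t k w * D t j w)) -
    t * (2 * J)| <= t * (eta * (C * mj)).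
  rewrite /J /mj !mulr_sumr -sumrB; apply: le_trans (ler_norm_sum _ _ _) _.
  by apply: ler_sum => k _; exact: a2.
move: a1 sym RE b4 b5; set S1 := \int[P]_w (phi _ * D t j w).
set S2 := \int[P]_w (_ * D t j w); set S3 := \int[P]_w (_ * D t j w).
set S4 := \sum_k _; rewrite -/I -/A => a1 sym RE b4 b5.
rewrite -(ler_pM2l t0).
rewrite -[X in X * `|_|](gtr0_norm t0) -normrM.
(* By reversibility 2 S1 = - S2, and by the expansion S2 = S4 + S3; only the two approximation
   errors and the remainder S3 are left. *)
rewrite (_ : t * _ = - (2 * (S1 - t * I) + (S4 - t * (2 * J)) + S3)); last first.
  by rewrite RE -[S2]opprK -sym; ring.
rewrite normrN; apply: le_trans (ler_normD _ _) _.
apply: le_trans (lerD (ler_normD _ _) b4) _; rewrite normrM ger0_norm//.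
apply: le_trans (lerD (lerD (ler_wpM2l _ a1) b5) (lexx _)) _ => //.
by rewrite le_eqVlt; apply/orP; left; apply/eqP; rewrite /K; ring.
Qed.

End test_function.

End reversible_ibp.

(** * Rotation of the statistic into a Gaussian vector *)

Lemma L1_hsnorm dT (T : measurableType dT) (R : realType)
    (mu : {measure set T -> \bar R}) m n (N : T -> 'M[R]_(m, n)) :
  (forall i j, L1 mu (fun w => N w i j)) -> L1 mu (fun w => hsnorm (N w)).
Proof.
move=> iN; apply: (L1_le (g := fun w => \sum_i \sum_j `|N w i j|)).
- apply: (measurableT_comp (f := @Num.sqrt R)).
    by apply: continuous_measurable_fun; exact: sqrt_continuous.
  apply: measurable_sum => i; apply: measurable_sum => j.
  by apply: measurable_funX; exact: L1_measurable (iN i j).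
- by apply: L1_sum => i; apply: L1_sum => j; exact: L1_norm.
- by move=> w; rewrite ger0_norm ?hsnorm_ge0//; exact: hsnorm_le_sum.
Qed.

(** c1 B |u| <= c1 (B^2 + u^2). The factor [c1] stays inside the integrability hypotheses so that
    they become void for c1 = 0. *)
Lemma L1_growth dT (T : measurableType dT) (R : realType)
    (mu : {measure set T -> \bar R}) (B u h : T -> R) (c0 c1 : R) :
  measurable_fun setT h -> L1 mu u -> L1 mu (fun x => c1 * u x ^+ 2) ->
  L1 mu (fun x => c1 * B x ^+ 2) -> 0 <= c1 ->
  (forall x, `|h x| <= c0 + c1 * B x) -> L1 mu (fun x => h x * u x).
Proof.
move=> mh iu iu2 iB2 c10 hB.
apply: (L1_le _ (L1D (L1Zl c0 (L1_norm iu)) (L1D iB2 iu2))).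
  by apply: measurable_funM => //; exact: L1_measurable iu.
move=> x; rewrite normrM; apply: le_trans (ler_wpM2r (normr_ge0 _) (hB x)) _.
rewrite mulrDl lerD2l -[u x ^+ 2]real_normK ?num_real// -mulrA -mulrDr.
rewrite ler_wpM2l//; have := sqr_ge0 (B x - `|u x|).
by have := sqr_ge0 (B x); have := sqr_ge0 (`|u x|); nra.
Qed.

Section product_probability.
Context (R : realType) d1 d2 (T1 : measurableType d1) (T2 : measurableType d2)
  (P1 : probability T1 R) (P2 : probability T2 R).

Lemma L1_fst f : L1 P1 f -> L1 (P1 \x P2)%E (fun z => f z.1).
Proof.
move=> fi; have mf := L1_measurable fi.
have mf1 : measurable_fun setT (EFin \o (fun z : T1 * T2 => f z.1)).
  by apply/measurable_EFinP; exact: measurableT_comp mf measurable_fst.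
apply/(integrable12ltyP P1 P2 mf1) => /=.
rewrite (_ : (\int[_]_x _ = \int[P1]_x `|f x|%:E)%E).
  exact: L1_integral_lty (L1_norm fi).
apply: eq_integral => x _; rewrite (L1_EFin_Rintegral (L1_cst P2 `|f x|)).
by rewrite (Rintegral_prob_cst P2).
Qed.

Lemma L1_snd f : L1 P2 f -> L1 (P1 \x P2)%E (fun z => f z.2).
Proof.
move=> fi; have mf := L1_measurable fi.
have mf1 : measurable_fun setT (EFin \o (fun z : T1 * T2 => f z.2)).
  by apply/measurable_EFinP; exact: measurableT_comp mf measurable_snd.
apply/(integrable12ltyP P1 P2 mf1) => /=.
rewrite (L1_EFin_Rintegral (L1_norm fi)).
by rewrite (L1_EFin_Rintegral (L1_cst P1 _)) ltry.
Qed.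

Lemma Rintegral_fubini12 f : L1 (P1 \x P2)%E f ->
  (forall x, L1 P2 (fun y => f (x, y))) ->
  \int[(P1 \x P2)%E]_z f z = \int[P1]_x \int[P2]_y f (x, y).
Proof.
move=> fi fx; congr fine; rewrite -(integral12_prod_meas1 fi).
by apply: eq_integral => x _; rewrite -(L1_EFin_Rintegral (fx x)).
Qed.

Lemma Rintegral_fubini21 f : L1 (P1 \x P2)%E f ->
  (forall y, L1 P1 (fun x => f (x, y))) ->
  \int[(P1 \x P2)%E]_z f z = \int[P2]_y \int[P1]_x f (x, y).
Proof.
move=> fi fy; congr fine; rewrite -(integral21_prod_meas1 fi).
by apply: eq_integral => x _; rewrite -(L1_EFin_Rintegral (fy x)).
Qed.

Lemma L1_fubini12 f : L1 (P1 \x P2)%E f ->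
  (forall x, L1 P2 (fun y => f (x, y))) -> L1 P1 (fun x => \int[P2]_y f (x, y)).
Proof.
move=> fi fx; have := integrable_fubini_F fi; apply: eq_integrable => // x _.
exact: L1_EFin_Rintegral (fx x).
Qed.

Lemma Rintegral_fst f : L1 P1 f ->
  \int[(P1 \x P2)%E]_z f z.1 = \int[P1]_x f x.
Proof.
move=> fi; rewrite (Rintegral_fubini12 (L1_fst fi)) => [|x].
  by apply: eq_Rintegral => x _ /=; rewrite (Rintegral_prob_cst P2).
exact: (L1_cst P2 (f x)).
Qed.

Lemma Rintegral_snd f : L1 P2 f ->
  \int[(P1 \x P2)%E]_z f z.2 = \int[P2]_x f x.
Proof.
move=> fi; rewrite (Rintegral_fubini12 (L1_snd fi) (fun=> fi)).
exact: (Rintegral_prob_cst P1 (\int[P2]_x f x)).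
Qed.

End product_probability.

(** The majorant is the derivative of - K1 cos t + K2 sin^2 t / 2 + K3 sin t, which increases by K1
    + K2 / 2 + K3 over [0, pi/2]. Monotonicity of the difference makes it unnecessary to integrate
    [dpsi] in t. *)
Lemma trig_increment_le (R : realType) (psi dpsi : R -> R) (K1 K2 K3 : R) :
  (forall t : R, is_derive t (1 : R) psi (dpsi t)) ->
  (forall t, 0 < t < pi / 2 ->
    dpsi t <= K1 * sin t + K2 * (sin t * cos t) + K3 * cos t) ->
  psi (pi / 2) - psi 0 <= K1 + 2^-1 * K2 + K3.
Proof.
move=> dpsiP le_dpsi.
pose H := (fun t => K1 * - cos t + 2^-1 * K2 * sin t ^+ 2 + K3 * sin t - psi t).
have dH (t : R) : is_derive t (1 : R) H
    (K1 * sin t + K2 * (sin t * cos t) + K3 * cos t - dpsi t).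
  rewrite (_ : H = K1 *: (- @cos R) + (2^-1 * K2) *: (@sin R ^+ 2) + K3 *: @sin R - psi).
    apply: is_derive_eq. rewrite /GRing.scale/= expr1.
    by rewrite /GRing.scale/=; field.
  by apply/funext => s; rewrite /H !fctE.
have p0 : 0 <= pi / 2 :> R by rewrite divr_ge0// pi_ge0.
have dH1 (t : R) : t \in `]0, (pi / 2)[ -> derivable H t 1 by case: (dH t).
have dH2 (t : R) : t \in `]0, (pi / 2)[ -> 0 <= H^`()%classic t.
  rewrite in_itv/= => /le_dpsi h.
  by rewrite derive1E; case: (dH t) => _ ->; rewrite subr_ge0.
have cH : {within `[0, (pi / 2)], continuous H}.
  by apply: derivable_within_continuous => t _; case: (dH t).
have : H 0 <= H (pi / 2).
  apply: (ger0_derive1_le_cc dH1 dH2 cH) => //; rewrite in_itv/= ?lexx//.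
  by rewrite andbT.
rewrite /H cos0 sin0 cos_pihalf sin_pihalf; lra.
Qed.

Lemma trig_distance_le (R : realType) (psi dpsi : R -> R) (K1 K2 K3 : R) :
  (forall t : R, is_derive t (1 : R) psi (dpsi t)) ->
  (forall t, 0 < t < pi / 2 ->
    `|dpsi t| <= K1 * sin t + K2 * (sin t * cos t) + K3 * cos t) ->
  `|psi 0 - psi (pi / 2)| <= K1 + 2^-1 * K2 + K3.
Proof.
move=> dpsiP le_dpsi.
have h1 := @trig_increment_le R psi dpsi K1 K2 K3 dpsiP
  (fun t ht => le_trans (ler_norm _) (le_dpsi t ht)).
have dN (t : R) : is_derive t (1 : R) (- psi) (- dpsi t) by exact: is_deriveN.
have leN t : 0 < t < pi / 2 -> (- dpsi) t <=
    K1 * sin t + K2 * (sin t * cos t) + K3 * cos t.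
  by move=> /le_dpsi; apply: le_trans; rewrite fctE -normrN ler_norm.
have h2 := @trig_increment_le R (- psi) (- dpsi) K1 K2 K3 dN leN.
move: h1 h2; rewrite !fctE => h1 h2; rewrite ler_norml.
by apply/andP; split; lra.
Qed.

Lemma sum_mul_scalar_mx (R : pzRingType) d (f : 'I_d -> R) (c : R) i :
  \sum_l f l * (c%:M : 'M[R]_d) l i = f i * c.
Proof.
rewrite (bigD1 i)//= big1 ?addr0 ?mxE ?eqxx ?mulr1n// => l li.
by rewrite mxE (negbTE li) mulr0.
Qed.

Section interpolation.
Context (R : realType) (dT : measure_display) (T : measurableType dT)
  (P : probability T R) (d : nat) (gamma : probability (borelV R d) R)
  (gammaN : std_normal gamma) (W U : T -> 'cV[R]_d) (N : T -> 'M[R]_d)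
  (Sigma A : 'M[R]_d) (AAT : A *m A^T = Sigma).
Hypotheses (iW : forall k, L1 P (fun w => W w k 0))
  (iU : forall k, L1 P (fun w => U w k 0))
  (iN : forall k i, L1 P (fun w => N w k i)).

(* Up to multiplication by Lambda^-1, the reversible integration by parts. *)
Hypothesis ibp : forall (phi : 'cV[R]_d -> R) C, class_C1 phi -> continuous phi ->
  (forall k x, `|partial k phi x| <= C) -> L1 P (fun w => phi (W w) ^+ 2) ->
  (forall k, L1 P (fun w => phi (W w) * W w k 0)) ->
  (forall k, L1 P (fun w => phi (W w) * U w k 0)) ->
  forall k, \int[P]_w (phi (W w) * W w k 0) = \int[P]_w (phi (W w) * U w k 0) +
    \sum_i \int[P]_w (partial i phi (W w) * (Sigma k i + N w k i)).

(** For c1 = 0 the gradient is bounded and [iW2], [iU2] hold trivially; for c1 > 0 they say that W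
    and U are square integrable. *)
Variables (g : 'cV[R]_d -> R) (b0 c0 c1 : R).
Hypotheses (C2g : class_C2 g) (c00 : 0 <= c0) (c10 : 0 <= c1)
  (g1 : forall k x, `|partial k g x| <= c0 + c1 * \sum_i `|x i 0|)
  (g2 : forall k l x, `|partial l (partial k g) x| <= b0)
  (iW2 : forall k, L1 P (fun w => c1 * W w k 0 ^+ 2))
  (iU2 : forall k, L1 P (fun w => c1 * U w k 0 ^+ 2)).

Let cg : continuous g. Proof. by case: C2g. Qed.
Let C1g : class_C1 g. Proof. exact: (class_C2_C1 C2g).1. Qed.
Let C1dg k : class_C1 (partial k g). Proof. exact: (class_C2_C1 C2g).2. Qed.

Let Q := (P \x gamma)%E.
(** A point of the rotation, with c and s in place of cos t and sin t. Both coefficients are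
    matrices so that the results on affine maps apply in w and in v alike. *)
Let Y (c s : R) (w v : 'cV[R]_d) := c%:M *m w + (s *: A) *m v.
Let N1 (x : 'cV[R]_d) := \sum_i `|x i 0|.
Let B (z : T * borelV R d) := N1 (W z.1) + N1 (A *m (z.2 : 'cV[R]_d)).

Let N1_ge0 x : 0 <= N1 x. Proof. by apply: sumr_ge0. Qed.

Let YE c s w v k : Y c s w v k 0 = c * w k 0 + s * (A *m v) k 0.
Proof. by rewrite mxE mul_scalar_mx -scalemxAl !mxE. Qed.

Let le1M (c x : R) : `|c| <= 1 -> `|c * x| <= `|x|.
Proof. by move=> c1'; rewrite normrM ler_piMl. Qed.

Let N1Y c s w v : `|c| <= 1 -> `|s| <= 1 -> N1 (Y c s w v) <= N1 w + N1 (A *m v).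
Proof.
move=> hc hs; rewrite /N1 -big_split/=; apply: ler_sum => k _.
by rewrite YE; apply: le_trans (ler_normD _ _) _; rewrite lerD// le1M.
Qed.

Let mW k : measurable_fun setT (fun w => W w k 0).
Proof. exact: L1_measurable (iW k). Qed.

Let mcoord k : measurable_fun setT (fun v : borelV R d => v k 0 : R).
Proof. exact: measurable_entry. Qed.

Let mAv k : measurable_fun setT (fun v : borelV R d => (A *m (v : 'cV[R]_d)) k 0 : R).
Proof.
under eq_fun do rewrite mxE; apply: measurable_sum => i.
by apply: measurable_funM => //; exact: mcoord.
Qed.

Let mY c s : measurable_fun setT
  (fun z : T * borelV R d => Y c s (W z.1) z.2 : borelV R d).
Proof.
apply: measurable_fun_borelV => k; under eq_fun do rewrite YE.
apply: measurable_funD; apply: measurable_funM => //.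
  exact: measurableT_comp (mW k) measurable_fst.
exact: (measurableT_comp (mAv k) measurable_snd).
Qed.

Let mYw c s w : measurable_fun setT (fun v : borelV R d => Y c s w v : borelV R d).
Proof.
apply: measurable_fun_borelV => k; under eq_fun do rewrite YE.
by apply: measurable_funD => //; apply: measurable_funM => //; exact: mAv.
Qed.

Let mYv c s v : measurable_fun setT (fun w => Y c s (W w) v : borelV R d).
Proof.
apply: measurable_fun_borelV => k; under eq_fun do rewrite YE.
by apply: measurable_funD => //; apply: measurable_funM => //; exact: mW.
Qed.

(* The random variables that may multiply a function of linear growth c1. *)
Let adm dX (X : measurableType dX) (m : {measure set X -> \bar R}) (u : X -> R) :=
  L1 m u /\ L1 m (fun x => c1 * u x ^+ 2).

Let admD dX (X : measurableType dX) (m : {measure set X -> \bar R}) u u' :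
  adm m u -> adm m u' -> adm m (fun x => u x + u' x).
Proof.
move=> [i1 i2] [j1 j2]; split; first exact: L1D.
apply: (L1_le _ (L1D (L1Zl 2 i2) (L1Zl 2 j2))).
  apply: measurable_funM => //; apply: measurable_funX.
  by apply: measurable_funD; [exact: L1_measurable i1|exact: L1_measurable j1].
move=> x; rewrite normrM ger0_norm// ger0_norm ?sqr_ge0//.
rewrite [leRHS](_ : _ = c1 * (2 * u x ^+ 2 + 2 * u' x ^+ 2)); last by ring.
rewrite ler_wpM2l//.
have := sqr_ge0 (u x - u' x); nra.
Qed.

Let admZ dX (X : measurableType dX) (m : {measure set X -> \bar R}) c u :
  adm m u -> adm m (fun x => c * u x).
Proof.
move=> [i1 i2]; split; first exact: L1Zl.
by apply: L1_ext (L1Zl (c ^+ 2) i2) => x; rewrite exprMn mulrCA.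
Qed.

Let adm_norm dX (X : measurableType dX) (m : {measure set X -> \bar R}) u :
  adm m u -> adm m (fun x => `|u x|).
Proof.
move=> [i1 i2]; split; first exact: L1_norm.
by apply: L1_ext i2 => x; rewrite real_normK ?num_real.
Qed.

Let adm_cst dX (X : measurableType dX) (m : probability X R) (c : R) :
  adm m (fun=> c).
Proof. by split; [exact: (L1_cst m c)|exact: (L1_cst m (c1 * c ^+ 2))]. Qed.

Let adm_sum dX (X : measurableType dX) (m : probability X R) (I : Type)
    (r : seq I) (u : I -> X -> R) :
  (forall i, adm m (u i)) -> adm m (fun x => \sum_(i <- r) u i x).
Proof.
move=> iu; elim: r => [|i r ih].
  by under eq_fun do rewrite big_nil; exact: adm_cst.
by under eq_fun do rewrite big_cons; exact: admD.
Qed.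

Let adm_fst u : adm P u -> adm Q (fun z => u z.1).
Proof.
by move=> [i1 i2]; split; [exact: (L1_fst gamma i1)|exact: (L1_fst gamma i2)].
Qed.

Let adm_snd u : adm gamma u -> adm Q (fun z => u z.2).
Proof. by move=> [i1 i2]; split; [exact: (L1_snd P i1)|exact: (L1_snd P i2)]. Qed.

Let admW k : adm P (fun w => W w k 0). Proof. by split. Qed.
Let admU k : adm P (fun w => U w k 0). Proof. by split. Qed.

Let admv k : adm gamma (fun v : borelV R d => v k 0).
Proof.
by split; [exact: L1_gaussian_coord|apply: L1Zl; exact: L1_gaussian_sqr].
Qed.

Let admAv k : adm gamma (fun v : borelV R d => (A *m (v : 'cV[R]_d)) k 0).
Proof.
by under eq_fun do rewrite mxE; apply: adm_sum => i; apply: admZ; exact: admv.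
Qed.

Let admB : adm Q B.
Proof.
apply: admD.
  by apply: (@adm_fst (fun w => N1 (W w))); apply: adm_sum => i; exact: adm_norm.
apply: (@adm_snd (fun v => N1 (A *m (v : 'cV[R]_d)))).
by apply: adm_sum => i; apply: adm_norm; exact: admAv.
Qed.

Let admBw w : adm gamma (fun v => B (w, v)).
Proof.
apply: admD; first exact: (adm_cst gamma (N1 (W w))).
by apply: adm_sum => i; apply: adm_norm; exact: admAv.
Qed.

Let admBv v : adm P (fun w => B (w, v)).
Proof.
apply: admD; last exact: (adm_cst P (N1 (A *m v))).
by apply: adm_sum => i; exact: adm_norm.
Qed.

Let g1Y c s k z : `|c| <= 1 -> `|s| <= 1 ->
  `|partial k g (Y c s (W z.1) z.2)| <= c0 + c1 * B z.
Proof.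
move=> hc hs; apply: le_trans (g1 _ _) _.
by rewrite lerD2l ler_wpM2l//; exact: N1Y.
Qed.


Let dg c s k (z : T * borelV R d) := partial k g (Y c s (W z.1) z.2).
Let ddg c s k l (z : T * borelV R d) := partial l (partial k g) (Y c s (W z.1) z.2).

Section fixed_angle.
Variables c s : R.
Hypotheses (hc : `|c| <= 1) (hs : `|s| <= 1).

(** The map [z] lets one argument serve the product space and its fibres over a fixed w or a fixed
    v. *)
Let L1_dg_at dX (V : measurableType dX) (m : {measure set V -> \bar R})
    (z : V -> T * borelV R d) k u : adm m (fun x => B (z x)) -> adm m u ->
  measurable_fun setT (fun x => Y c s (W (z x).1) (z x).2 : borelV R d) ->
  L1 m (fun x => dg c s k (z x) * u x).
Proof.
move=> [_ iB] [i1 i2] mz; apply: (L1_growth (B := B \o z) _ i1 i2 iB c10).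
  by apply: measurable_continuous_comp mz; exact: C1g.2.
by move=> x; exact: g1Y.
Qed.

Let L1_dg k u : adm Q u -> L1 Q (fun z => dg c s k z * u z).
Proof. by move=> iu; exact: (L1_dg_at k admB iu (mY c s)). Qed.

Let L1_dgw k w u : adm gamma u -> L1 gamma (fun v => dg c s k (w, v) * u v).
Proof. by move=> iu; exact: (L1_dg_at k (admBw w) iu (mYw c s (W w))). Qed.

Let L1_dgv k v u : adm P u -> L1 P (fun w => dg c s k (w, v) * u w).
Proof. by move=> iu; exact: (L1_dg_at k (admBv v) iu (mYv c s v)). Qed.

Let L1_ddg_at dX (V : measurableType dX) (m : {measure set V -> \bar R})
    (z : V -> T * borelV R d) k l u : L1 m u ->
  measurable_fun setT (fun x => Y c s (W (z x).1) (z x).2 : borelV R d) ->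
  L1 m (fun x => ddg c s k l (z x) * u x).
Proof.
move=> iu mz; apply: (L1_mul_bounded (C := b0) iu); last by move=> x; exact: g2.
by apply: measurable_continuous_comp mz; exact: (C1dg k).2.
Qed.

Let L1_ddg k l u : L1 Q u -> L1 Q (fun z => ddg c s k l z * u z).
Proof. by move=> iu; exact: (L1_ddg_at k l iu (mY c s)). Qed.

Let L1_ddgw k l w u : L1 gamma u -> L1 gamma (fun v => ddg c s k l (w, v) * u v).
Proof. by move=> iu; exact: (L1_ddg_at (z := pair w) k l iu (mYw c s (W w))). Qed.

Let L1_ddgv k l v u : L1 P u -> L1 P (fun w => ddg c s k l (w, v) * u w).
Proof. by move=> iu; exact: (L1_ddg_at (z := pair^~ v) k l iu (mYv c s v)). Qed.

(** Deliberately crude: both integrations by parts ask only for some bound common to all partial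
    derivatives, and the bound does not appear in their conclusions. *)
Let bound_affine k (x : 'cV[R]_d) (M : 'M[R]_d) i y :
  `|partial i (fun v : 'cV[R]_d => partial k g (x + M *m v)) y| <=
    \sum_j \sum_l b0 * `|M l j|.
Proof.
have b00 : 0 <= b0 by exact: le_trans (normr_ge0 _) (g2 k k 0).
rewrite partial_affine// [leRHS](bigD1 i)//= -[leLHS]addr0 lerD//; last first.
  by apply: sumr_ge0 => j _; apply: sumr_ge0 => l _; rewrite mulr_ge0.
apply: le_trans (ler_norm_sum _ _ _) _; apply: ler_sum => l _.
by rewrite normrM ler_wpM2r.
Qed.

Let cdg k : continuous (partial k g). Proof. exact: C1g.2. Qed.

Let continuous_affine k (x : 'cV[R]_d) (M : 'M[R]_d) :
  continuous (fun v : 'cV[R]_d => partial k g (x + M *m v)).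
Proof.
move=> v; apply: (@continuous_comp _ _ _ (fun v => x + M *m v) (partial k g)).
  exact: affine_continuous.
exact: cdg.
Qed.

Let iddg k l (e : R) : L1 Q (fun z => ddg c s k l z * e).
Proof. by apply: L1_ddg; exact: (adm_cst Q e).1. Qed.

Let iddgw k l w (e : R) : L1 gamma (fun v => ddg c s k l (w, v) * e).
Proof. by apply: (L1_ddgw k l w (u := fun=> e)); exact: (L1_cst gamma e). Qed.

Let gaussian_ibp_fiber k i w :
  \int[gamma]_v (dg c s k (w, v) * v i 0) =
  \int[gamma]_v \sum_l (ddg c s k l (w, v) * (s * A l i)).
Proof.
have := gaussian_ibp gammaN (class_C1_affine (c%:M *m W w) (s *: A) (C1dg k))
  (@continuous_affine k _ _) (bound_affine k _ _) i.
rewrite partial_affine// => E.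
transitivity (\int[gamma]_v (v i 0 * partial k g (c%:M *m W w + (s *: A) *m (v : 'cV[R]_d)))).
  by apply: eq_Rintegral => v _; rewrite mulrC.
rewrite E; apply: eq_Rintegral => v _; apply: eq_bigr => l _.
by rewrite /ddg mxE.
Qed.

Let gaussian_ibp_interpolation k i :
  \int[Q]_z (dg c s k z * z.2 i 0) =
  \sum_l \int[Q]_z (ddg c s k l z * (s * A l i)).
Proof.
have i1 := L1_dg k (adm_snd (admv i)).
rewrite (Rintegral_fubini12 i1 (fun w => L1_dgw k w (admv i))).
rewrite -Rintegral_sum// Rintegral_fubini12.
- by apply: eq_Rintegral => w _; exact: gaussian_ibp_fiber.
- exact: L1_sum.
- by move=> w; apply: L1_sum => l; exact: iddgw.
Qed.

(** For fixed v, [ibp] is applied to x |-> d_k g(c x + s A v), whose derivatives bring out the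
    factor c; the result is integrated over v. *)
Let reversible_ibp_interpolation k :
  \int[Q]_z (dg c s k z * W z.1 k 0) = \int[Q]_z (dg c s k z * U z.1 k 0) +
  \sum_i \int[Q]_z (ddg c s k i z * (c * (Sigma k i + N z.1 k i))).
Proof.
have i1 := L1_dg k (adm_fst (admW k)).
have i2 := L1_dg k (adm_fst (admU k)).
have iSN i : L1 P (fun w => c * (Sigma k i + N w k i)).
  by apply: L1Zl; apply: L1D => //; exact: (L1_cst P _).
have i3 i : L1 Q (fun z => ddg c s k i z * (c * (Sigma k i + N z.1 k i))).
  exact: (L1_ddg k i (L1_fst gamma (iSN i))).
have i4 v i := L1_ddgv k i v (iSN i).
have iS := L1_sum (index_enum _) i3.
rewrite -(Rintegral_sum _ i3) -(RintegralD measurableT i2 iS).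
rewrite (Rintegral_fubini21 i1 (fun v => L1_dgv k v (admW k))).
rewrite (Rintegral_fubini21 (L1D i2 iS)); last first.
  by move=> v; apply: L1D (L1_dgv k v (admU k)) _; apply: L1_sum => i; exact: i4.
apply: eq_Rintegral => v _.
pose phi (x : 'cV[R]_d) := partial k g ((s *: A) *m v + c%:M *m x).
have phiY w : phi (W w) = dg c s k (w, v) by rewrite /phi addrC.
have iphi2 : L1 P (fun w => phi (W w) ^+ 2).
  apply: (L1_ext (f := fun w => dg c s k (w, v) * dg c s k (w, v))).
    by move=> w; rewrite phiY expr2.
  have mdg : measurable_fun setT (fun w => dg c s k (w, v)).
    by apply: measurable_continuous_comp (mYv c s v); exact: C1g.2.
  have bdg w : `|dg c s k (w, v)| <= c0 + c1 * B (w, v) by exact: g1Y.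
  have ic := (admD (adm_cst P c0) (admZ c1 (admBv v))).
  apply: L1_dgv; split.
    by apply: (L1_le mdg ic.1).
  apply: (L1_le _ ic.2).
    by apply: measurable_funM => //; exact: measurable_funX.
  move=> w; rewrite normrM ger0_norm// ler_wpM2l// normrX lerXn2r// nnegrE//.
  exact: le_trans (normr_ge0 _) (bdg w).
have iphiW l : L1 P (fun w => phi (W w) * W w l 0).
  by apply: L1_ext (L1_dgv k v (admW l)) => w; rewrite phiY.
have iphiU l : L1 P (fun w => phi (W w) * U w l 0).
  by apply: L1_ext (L1_dgv k v (admU l)) => w; rewrite phiY.
have := ibp (class_C1_affine _ _ (C1dg k)) (@continuous_affine k _ _)
  (bound_affine k _ _) iphi2 iphiW iphiU k.
rewrite -/phi => E.
have E1 : \int[P]_w (phi (W w) * W w k 0) = \int[P]_w (dg c s k (w, v) * W w k 0).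
  by apply: eq_Rintegral => w _; rewrite phiY.
have E2 : \int[P]_w (phi (W w) * U w k 0) = \int[P]_w (dg c s k (w, v) * U w k 0).
  by apply: eq_Rintegral => w _; rewrite phiY.
have E3 i : \int[P]_w (partial i phi (W w) * (Sigma k i + N w k i)) =
    \int[P]_w (ddg c s k i (w, v) * (c * (Sigma k i + N w k i))).
  apply: eq_Rintegral => w _.
  have -> : partial i phi = fun x => \sum_l partial l (partial k g)
      ((s *: A) *m v + c%:M *m x) * c%:M l i by exact: partial_affine.
  by rewrite sum_mul_scalar_mx -mulrA [_ + _ *m W w]addrC.
have E4 : \int[P]_w (\sum_i ddg c s k i (w, v) * (c * (Sigma k i + N w k i))) =
    \sum_i \int[P]_w (ddg c s k i (w, v) * (c * (Sigma k i + N w k i))).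
  by rewrite Rintegral_sum.
have E5 := RintegralD measurableT (L1_dgv k v (admU k)) (L1_sum (index_enum _) (i4 v)).
rewrite -[LHS]E1 E E2; apply/esym/(etrans E5); rewrite E4; congr (_ + _).
by apply: eq_bigr => i _; rewrite E3.
Qed.

Let EU := \sum_k \int[Q]_z (dg c s k z * U z.1 k 0).
Let EN := \sum_k \sum_i \int[Q]_z (ddg c s k i z * N z.1 k i).

Let iddN k i : L1 Q (fun z => ddg c s k i z * N z.1 k i).
Proof. exact: (L1_ddg k i (L1_fst gamma (iN k i))). Qed.

Lemma interpolation_velocity :
  \int[Q]_z (\sum_k dg c s k z *
    (- s * W z.1 k 0 + c * (A *m (z.2 : 'cV[R]_d)) k 0)) =
  - s * EU - s * c * EN.
Proof.
(* [h k l] is the mean of a second derivative of g. The W term and the A v term each produce s c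
   Sigma_kl h k l, with opposite signs. *)
pose h k l := \int[Q]_z (ddg c s k l z * 1).
have hE k l (e : R) : \int[Q]_z (ddg c s k l z * e) = e * h k l.
  rewrite -(RintegralZl e measurableT (iddg k l 1)).
  by apply: eq_Rintegral => z _; rewrite mulr1 mulrC.
have E k : \int[Q]_z (dg c s k z *
    (- s * W z.1 k 0 + c * (A *m (z.2 : 'cV[R]_d)) k 0)) =
  - s * \int[Q]_z (dg c s k z * U z.1 k 0) -
  s * c * \sum_i \int[Q]_z (ddg c s k i z * N z.1 k i).
  have iA := L1_dg k (adm_snd (admAv k)).
  have iWk := L1_dg k (adm_fst (admW k)).
  rewrite (@eq_Rintegral _ _ _ Q setT (fun z => - s * (dg c s k z * W z.1 k 0) +
    c * (dg c s k z * (A *m (z.2 : 'cV[R]_d)) k 0))); last by move=> z _; ring.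
  rewrite (RintegralD measurableT (L1Zl (- s) iWk) (L1Zl c iA)).
  rewrite (RintegralZl (- s) measurableT iWk) (RintegralZl c measurableT iA).
  rewrite reversible_ibp_interpolation mulrDr -addrA; congr (_ + _).
  have iv i := L1_dg k (adm_snd (admv i)).
  have -> : \int[Q]_z (dg c s k z * (A *m (z.2 : 'cV[R]_d)) k 0) =
      \sum_l s * Sigma k l * h k l.
    transitivity (\int[Q]_z (\sum_i A k i * (dg c s k z * z.2 i 0))).
      apply: eq_Rintegral => z _; rewrite mxE mulr_sumr.
      by apply: eq_bigr => i _; rewrite mulrCA.
    rewrite Rintegral_sum; last by move=> i; exact: L1Zl (iv i).
    transitivity (\sum_i \sum_l A k i * (s * A l i * h k l)).
      apply: eq_bigr => i _; rewrite (RintegralZl (A k i) measurableT (iv i)).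
      rewrite gaussian_ibp_interpolation mulr_sumr; apply: eq_bigr => l _.
      by rewrite hE.
    rewrite exchange_big/=; apply: eq_bigr => l _.
    rewrite -AAT mxE mulr_sumr mulr_suml; apply: eq_bigr => i _.
    by rewrite mxE; ring.
  rewrite !mulr_sumr -!sumrN -big_split/=; apply: eq_bigr => i _.
  have -> : \int[Q]_z (ddg c s k i z * (c * (Sigma k i + N z.1 k i))) =
      c * Sigma k i * h k i + c * \int[Q]_z (ddg c s k i z * N z.1 k i).
    rewrite -hE -(RintegralZl c measurableT (iddN k i)).
    rewrite -(RintegralD measurableT (iddg k i _) (L1Zl c (iddN k i))).
    by apply: eq_Rintegral => z _; ring.
  by ring.
rewrite Rintegral_sum; last first.
  move=> k; apply: L1_dg; apply: admD; apply: admZ.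
    exact: adm_fst (admW k).
  exact: adm_snd (admAv k).
rewrite (eq_bigr _ (fun k _ => E k)) big_split/= -mulr_sumr; congr (_ + _).
by rewrite sumrN -mulr_sumr.
Qed.

(** The hypothesis carries the factor |U| so that it also holds when U vanishes and the gradient is
    unbounded. *)
Lemma interpolation_U_le a :
  (forall w x, enorm (gradient g x) * enorm (U w) <= a * enorm (U w)) ->
  `|EU| <= a * \int[P]_w enorm (U w).
Proof.
move=> ha.
have inU : L1 P (fun w => enorm (U w)).
  by apply: L1_hsnorm => i j; rewrite (ord1 j).
have iQU := L1_fst gamma inU.
have idU k := L1_dg k (adm_fst (admU k)).
rewrite /EU -Rintegral_sum// -(Rintegral_fst gamma inU).
rewrite -(RintegralZl a measurableT iQU).
apply: (le_Rintegral_norm _ (L1Zl a iQU)); first exact: L1_sum.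
move=> z; apply: le_trans (ha _ (Y c s (W z.1) z.2)); apply: le_trans (enorm_dot _ _).
by rewrite le_eqVlt; apply/orP; left; apply/eqP; congr `|_|; apply: eq_bigr => k _;
  rewrite mxE.
Qed.

Lemma interpolation_N_le b : (forall x, hsnorm (hessian g x) <= b) ->
  `|EN| <= b * \int[P]_w hsnorm (N w).
Proof.
move=> hb.
have inN : L1 P (fun w => hsnorm (N w)) by exact: L1_hsnorm.
have iQN := L1_fst gamma inN.
rewrite (_ : EN = \int[Q]_z (\sum_k \sum_i ddg c s k i z * N z.1 k i)); last first.
  rewrite Rintegral_sum; last by move=> k; exact: L1_sum.
  by apply: eq_bigr => k _; rewrite Rintegral_sum.
rewrite -(Rintegral_fst gamma inN) -(RintegralZl b measurableT iQN).
apply: (le_Rintegral_norm _ (L1Zl b iQN)).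
  by apply: L1_sum => k; exact: L1_sum.
move=> z; apply: le_trans (ler_wpM2r (hsnorm_ge0 _) (hb (Y c s (W z.1) z.2))).
apply: le_trans (hsnorm_dot _ _); rewrite le_eqVlt; apply/orP; left; apply/eqP.
by congr `|_|; apply: eq_bigr => k _; apply: eq_bigr => i _; rewrite mxE.
Qed.

(* A Gaussian integration by parts moves the second derivative back onto v. *)
Lemma interpolation_N_lipschitz_le a (M : 'M[R]_d) : A *m M = 1%:M ->
  (forall x, enorm (gradient g x) <= a) ->
  `|s * EN| <= a * \int[P]_w hsnorm (N w *m M^T).
Proof.
move=> AM ha.
have iNM i j : L1 P (fun w => (N w *m M^T) i j).
  by under eq_fun do rewrite mxE; apply: L1_sum => l; exact: L1Zr.
have inN : L1 P (fun w => hsnorm (N w *m M^T)) by exact: L1_hsnorm.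
have iddw k l w : L1 gamma (fun v => ddg c s k l (w, v) * N w k l) by exact: iddgw.
have iS : L1 Q (fun z => \sum_k \sum_i ddg c s k i z * N z.1 k i).
  by apply: L1_sum => k; exact: L1_sum.
have iSw w : L1 gamma (fun v => \sum_k \sum_i ddg c s k i (w, v) * N w k i).
  by apply: L1_sum => k; exact: L1_sum.
rewrite (_ : EN = \int[Q]_z (\sum_k \sum_i ddg c s k i z * N z.1 k i)); last first.
  rewrite Rintegral_sum; last by move=> k; exact: L1_sum.
  by apply: eq_bigr => k _; rewrite Rintegral_sum.
have iP := L1_fubini12 iS iSw.
rewrite (Rintegral_fubini12 iS iSw) -(RintegralZl s measurableT iP).
rewrite -(RintegralZl a measurableT inN).
apply: (le_Rintegral_norm (L1Zl s iP) (L1Zl a inN)) => w.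
have a0 : 0 <= a by exact: le_trans (hsnorm_ge0 _) (ha 0).
apply: le_trans (ler_wpM2l a0 (gaussian_mulmx_le gammaN (N w *m M^T))).
have iM := L1_gaussian_mulmx gammaN (N w *m M^T).
have idv k i : L1 gamma (fun v => (N w *m M^T) k i * (dg c s k (w, v) * v i 0)).
  by apply: L1Zl; exact: L1_dgw (admv i).
have -> : s * \int[gamma]_v (\sum_k \sum_i ddg c s k i (w, v) * N w k i) =
    \int[gamma]_v (\sum_k \sum_i (N w *m M^T) k i * (dg c s k (w, v) * v i 0)).
  pose h k l := \int[gamma]_v (ddg c s k l (w, v) * 1).
  have hE k l (e : R) : \int[gamma]_v (ddg c s k l (w, v) * e) = e * h k l.
    rewrite -(RintegralZl e measurableT (iddgw k l w 1)).
    by apply: eq_Rintegral => z _; rewrite mulr1 mulrC.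
  rewrite !Rintegral_sum; try by move=> k; exact: L1_sum.
  rewrite mulr_sumr; apply: eq_bigr => k _; rewrite !Rintegral_sum//.
  transitivity (\sum_i \sum_l (N w *m M^T) k i * (s * A l i * h k l)); last first.
    apply: eq_bigr => i _; rewrite (RintegralZl _ measurableT (L1_dgw k w (admv i))).
    rewrite gaussian_ibp_fiber Rintegral_sum; last by move=> l; exact: iddgw.
    by rewrite mulr_sumr; apply: eq_bigr => l _; rewrite hE.
  rewrite exchange_big mulr_sumr/=; apply: eq_bigr => l _; rewrite hE.
  (* Inserting A M = 1 writes N as (N M^T) A^T, and A is the matrix that the Gaussian integration by
     parts produces. *)
  have -> : N w k l = ((N w *m M^T) *m A^T) k l.
    by rewrite -mulmxA -trmx_mul AM trmx1 mulmx1.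
  rewrite [((N w *m M^T) *m A^T) k l]mxE mulr_suml mulr_sumr; apply: eq_bigr => i _.
  by rewrite [A^T i l]mxE; ring.
rewrite -(RintegralZl a measurableT iM).
apply: (le_Rintegral_norm _ (L1Zl a iM)).
  by apply: L1_sum => k; exact: L1_sum.
move=> v; apply: le_trans (ler_wpM2r (hsnorm_ge0 _) (ha (Y c s (W w) v))).
apply: le_trans (enorm_dot _ _); rewrite le_eqVlt; apply/orP; left; apply/eqP.
congr `|_|; apply: eq_bigr => k _; rewrite [gradient _ _ _ _]mxE.
rewrite [(_ *m (v : 'cV[R]_d)) k 0]mxE mulr_sumr; apply: eq_bigr => i _.
by rewrite mulrCA.
Qed.

End fixed_angle.

Let cos1 (a : R) : `|cos a| <= 1. Proof. by rewrite ler_norml cos_geN1 cos_le1. Qed.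
Let sin1 (a : R) : `|sin a| <= 1. Proof. by rewrite ler_norml sin_geN1 sin_le1. Qed.

Let growth x : `|g x| <= `|g 0| + (c0 + c1 * N1 x) * N1 x.
Proof.
rewrite -lerBlDl; apply: le_trans (lerB_dist _ _) _.
have [xi [xiP ->]] := mean_value_partial 0 x C1g.1.
apply: le_trans (ler_norm_sum _ _ _) _; rewrite mulr_sumr; apply: ler_sum => k _.
rewrite mxE subr0 normrM ler_wpM2r//; apply: le_trans (g1 _ _) _.
rewrite lerD2l ler_wpM2l//; apply: ler_sum => i _.
by have := xiP k i; rewrite !mxE !subr0.
Qed.

Let f (a : R) (z : T * borelV R d) := g (Y (cos a) (sin a) (W z.1) z.2).

Let Gb z := (c0 + c1 * B z) * B z.

Let L1Gb : L1 Q Gb.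
Proof.
apply: L1_ext (L1D (L1Zl c0 admB.1) admB.2) => z.
by rewrite /Gb mulrDl -mulrA expr2.
Qed.

Let B_ge0 z : 0 <= B z. Proof. by rewrite addr_ge0. Qed.

Let L1f a : L1 Q (f a).
Proof.
apply: (L1_le _ (L1D (L1_cst Q `|g 0|) L1Gb)); first exact: measurable_continuous_comp (mY _ _).
move=> z; apply: le_trans (growth _) _; rewrite lerD2l.
have h := N1Y (W z.1) z.2 (cos1 a) (sin1 a).
by apply: ler_pM => //; rewrite ?addr_ge0 ?mulr_ge0// lerD2l ler_wpM2l.
Qed.

Let DY a (z : T * borelV R d) k :=
  - sin a * W z.1 k 0 + cos a * (A *m (z.2 : 'cV[R]_d)) k 0.

Let df a z := \sum_k dg (cos a) (sin a) k z * DY a z k.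

Let is_derive_f a z : is_derive a (1 : R) (f^~ z) (df a z).
Proof.
apply: (@is_derive_path _ _ g (fun a => Y (cos a) (sin a) (W z.1) z.2)) => // k.
rewrite (_ : (fun s => _) = W z.1 k 0 *: (@cos R) +
   (A *m (z.2 : 'cV[R]_d)) k 0 *: (@sin R)); last first.
  by apply/funext => s; rewrite YE mulrC [sin s * _]mulrC.
apply: is_derive_eq; rewrite /DY mulrC [cos a * _]mulrC.
by [].
Qed.

Let abs_df a z : `|df a z| <= Gb z.
Proof.
rewrite /Gb [X in _ * X](_ : _ = \sum_k (`|W z.1 k 0| +
    `|(A *m (z.2 : 'cV[R]_d)) k 0|)); last by rewrite big_split.
rewrite mulr_sumr; apply: le_trans (ler_norm_sum _ _ _) _.
apply: ler_sum => k _; rewrite normrM ler_pM//; first exact: g1Y.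
by apply: le_trans (ler_normD _ _) _; rewrite lerD// le1M// normrN.
Qed.

(** [Gb] dominates the derivative uniformly in the angle; it is integrable because B and c1 B^2
    are. *)
Lemma interpolation_derive a : is_derive a (1 : R)
  (fun t => \int[Q]_z f t z) (\int[Q]_z df a z).
Proof.
have dfE t z : partial1of2 f t z = df t z.
  by rewrite partial1of2E; case: (is_derive_f t z).
have dfb t z : `]a - 1, a + 1[%classic t -> setT z -> `|partial1of2 f t z| <= Gb z.
  by rewrite dfE => _ _; exact: abs_df.
have Ia : `]a - 1, a + 1[%classic a.
  by rewrite /= in_itv/= ltrBlDr ltrDl ltr01.
have Gb0 z : 0 <= Gb z by rewrite mulr_ge0// addr_ge0// mulr_ge0.
have der t z : `]a - 1, a + 1[%classic t -> setT z -> derivable (f^~ z) t 1.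
  by move=> _ _; case: (is_derive_f t z).
have L1f' t : `]a - 1, a + 1[%classic t -> L1 Q (f t) by [].
have h1 := derivable_under_integral measurableT Ia L1f' der Gb0 L1Gb dfb.
have h2 := differentiation_under_integral measurableT Ia L1f' der Gb0 L1Gb dfb.
apply: DeriveDef => //; rewrite -derive1E h2.
by apply: eq_Rintegral => z _; rewrite dfE.
Qed.

Let L1gW : L1 P (fun w => g (W w)).
Proof.
pose n1 w := N1 (W w).
have an : adm P n1 by apply: adm_sum => i; exact: adm_norm.
apply: (L1_le _ (L1D (L1_cst P `|g 0|) (L1D (L1Zl c0 an.1) an.2))).
  by apply: measurable_continuous_comp => //; exact: measurable_fun_borelV.
move=> w; apply: le_trans (growth _) _; rewrite lerD2l le_eqVlt; apply/orP; left.
by apply/eqP; rewrite /n1; ring.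
Qed.

Let L1gA : L1 gamma (fun v => g (A *m v)).
Proof.
pose n1 (v : borelV R d) := N1 (A *m (v : 'cV[R]_d)).
have an : adm gamma n1 by apply: adm_sum => i; apply: adm_norm; exact: admAv.
apply: (L1_le _ (L1D (L1_cst gamma `|g 0|) (L1D (L1Zl c0 an.1) an.2))).
  by apply: measurable_continuous_comp => //; exact: measurable_fun_borelV.
move=> w; apply: le_trans (growth _) _; rewrite lerD2l le_eqVlt; apply/orP; left.
by apply/eqP; rewrite /n1; ring.
Qed.

Let interpolation_ends : \int[P]_w g (W w) - \int[gamma]_v g (A *m v) =
  \int[Q]_z f 0 z - \int[Q]_z f (pi / 2) z.
Proof.
rewrite -(Rintegral_fst gamma L1gW) -(Rintegral_snd P L1gA).
congr (_ - _); apply: eq_Rintegral => z _; rewrite /f; congr g.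
  by rewrite /Y cos0 sin0 scale0r mul0mx addr0 mul1mx.
by rewrite /Y cos_pihalf sin_pihalf scale1r raddf0 mul0mx add0r.
Qed.

Let trig_pos (t : R) : 0 < t < pi / 2 -> 0 <= sin t /\ 0 <= cos t.
Proof.
move=> /andP[t0 tp]; split.
  apply: sin_ge0_pi; rewrite ltW//=; apply: le_trans (ltW tp) _.
  by have := @pi_ge0 R; lra.
apply: cos_ge0_pihalf; rewrite (ltW tp) andbT.
by apply: le_trans (ltW t0); have := @pi_ge0 R; lra.
Qed.

Lemma stein_hessian_bound a b :
  (forall w x, enorm (gradient g x) * enorm (U w) <= a * enorm (U w)) ->
  (forall x, hsnorm (hessian g x) <= b) ->
  [/\ L1 P (fun w => g (W w)), L1 gamma (fun v => g (A *m (v : 'cV[R]_d))) &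
  `|\int[P]_w g (W w) - \int[gamma]_v g (A *m v)| <=
  a * \int[P]_w enorm (U w) + 2^-1 * (b * \int[P]_w hsnorm (N w))].
Proof.
move=> ha hb; split=> //; rewrite interpolation_ends -[leRHS]addr0.
apply: (trig_distance_le interpolation_derive) => t tp.
have [s0 c0'] := trig_pos tp; rewrite mul0r addr0.
have E : \int[Q]_z df t z = _ := interpolation_velocity (cos1 t) (sin1 t).
rewrite E.
apply: le_trans (ler_normB _ _) _; rewrite !normrM normrN (ger0_norm s0) (ger0_norm c0').
rewrite -[X in _ <= X + _]mulrC -[X in _ <= _ + X]mulrC; apply: lerD.
  by rewrite ler_wpM2l//; exact: (interpolation_U_le (cos1 t) (sin1 t) ha).
by rewrite ler_wpM2l ?mulr_ge0//; exact: (interpolation_N_le _ _ hb).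
Qed.

(** The Gaussian integration by parts consumes the factor sin t of the N term, which keeps cos t
    alone and so contributes with coefficient 1 instead of 1/2. *)
Lemma stein_lipschitz_bound a (M : 'M[R]_d) : A *m M = 1%:M ->
  (forall x, enorm (gradient g x) <= a) ->
  [/\ L1 P (fun w => g (W w)), L1 gamma (fun v => g (A *m (v : 'cV[R]_d))) &
  `|\int[P]_w g (W w) - \int[gamma]_v g (A *m v)| <=
  a * \int[P]_w enorm (U w) + a * \int[P]_w hsnorm (N w *m M^T)].
Proof.
move=> AM ha; split=> //; rewrite interpolation_ends.
rewrite [leRHS](_ : _ = a * \int[P]_w enorm (U w) + 2^-1 * 0 +
  a * \int[P]_w hsnorm (N w *m M^T)); last by rewrite mulr0 addr0.
apply: (trig_distance_le interpolation_derive) => t tp.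
have [s0 c0'] := trig_pos tp; rewrite mul0r addr0.
have E : \int[Q]_z df t z = _ := interpolation_velocity (cos1 t) (sin1 t).
rewrite E.
apply: le_trans (ler_normB _ _) _; rewrite normrM normrN (ger0_norm s0).
have ha' w x : enorm (gradient g x) * enorm (U w) <= a * enorm (U w).
  by rewrite ler_wpM2r ?hsnorm_ge0.
rewrite -[X in _ <= X + _]mulrC; apply: lerD.
  by rewrite ler_wpM2l//; exact: (interpolation_U_le (cos1 t) (sin1 t) ha').
rewrite mulrAC normrM (ger0_norm c0') ler_wpM2r//.
exact: (interpolation_N_lipschitz_le (cos1 t) (sin1 t) AM ha).
Qed.

End interpolation.

(** * Square integrability when E_1 vanishes *)

(** y^2 / (1 + y^2/(n+1)) increases to y^2 with n, so a bound on the integrals that is uniform in n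
    survives by monotone convergence. *)
Lemma L1_sqr_truncation dT (T : measurableType dT) (R : realType)
    (mu : {measure set T -> \bar R}) (f : T -> R) (C : R) :
  measurable_fun setT f ->
  (forall n, L1 mu (fun w => f w ^+ 2 / (1 + n.+1%:R^-1 * f w ^+ 2)) /\
    \int[mu]_w (f w ^+ 2 / (1 + n.+1%:R^-1 * f w ^+ 2)) <= C) ->
  L1 mu (fun w => f w ^+ 2).
Proof.
move=> mf H; pose g n w := (f w ^+ 2 / (1 + n.+1%:R^-1 * f w ^+ 2))%:E.
have den0 n w : 0 < 1 + n.+1%:R^-1 * f w ^+ 2.
  by rewrite ltr_wpDr// mulr_ge0 ?sqr_ge0.
have mg n : measurable_fun setT (g n).
  by apply/measurable_EFinP; exact: L1_measurable (H n).1.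
have g0 n w : setT w -> (0 <= g n w)%E.
  by move=> _; rewrite lee_fin divr_ge0 ?sqr_ge0// ltW.
have ndg w : setT w -> nondecreasing_seq (g^~ w).
  move=> _ m n mn; rewrite lee_fin ler_wpM2l ?sqr_ge0//.
  rewrite lef_pV2 ?posrE// lerD2l ler_wpM2r ?sqr_ge0//.
  by rewrite lef_pV2 ?posrE ?ltr0n// ler_nat.
apply: L1_ge0_lty; [exact: measurable_funX|by move=> w; exact: sqr_ge0|].
have E : (\int[mu]_w (f w ^+ 2)%:E = \int[mu]_w limn (g^~ w))%E.
  apply: eq_integral => w _; apply/esym/cvg_lim => //; apply: cvg_EFin.
    exact: nearW.
  have h : (1 + n.+1%:R^-1 * f w ^+ 2) @[n --> \oo] --> 1 + 0 * f w ^+ 2.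
    apply: cvgD; first exact: cvg_cst.
    by apply: cvgM; [exact: cvg_harmonic|exact: cvg_cst].
  have l0 : 1 + 0 * f w ^+ 2 != 0 by rewrite mul0r addr0 oner_neq0.
  have := cvgM (cvg_cst (f w ^+ 2)) (cvgV l0 h).
  by rewrite mul0r addr0 invr1 mulr1; apply.
rewrite E monotone_convergence//; apply: (@le_lt_trans _ _ C%:E); last exact: ltry.
apply: lime_le.
  apply: ereal_nondecreasing_is_cvgn => m n mn.
  apply: ge0_le_integral => //; first exact: g0.
  by move=> w _; exact: (ndg w I _ _ mn).
by apply: nearW => n; rewrite /g (L1_EFin_Rintegral (H n).1) lee_fin (H n).2.
Qed.

Lemma is_derive_comp_coord (R : realType) d (rho drho : R -> R) (i k : 'I_d)
    (x : 'cV[R]_d) : (forall y : R, is_derive y (1 : R) rho (drho y)) ->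
  is_derive x (delta_mx k 0) (fun v : 'cV[R]_d => rho (v i 0))
    (drho (x i 0) * (i == k)%:R).
Proof.
move=> hrho; apply: is_derive_line0.
rewrite (_ : (fun t => _) = rho \o (fun t : R => x i 0 + t * (i == k)%:R)); last first.
  by apply/funext => t; rewrite /= !mxE eqxx andbT.
apply: is_derive1_comp; first by rewrite mul0r addr0.
rewrite (_ : (fun t => _) = cst (x i 0) + (i == k)%:R *: (@id R)); last first.
  by apply/funext => t; rewrite /= mulrC.
by apply: is_derive_eq; rewrite add0r /GRing.scale/= mulr1.
Qed.

Lemma is_derive_soft_truncation (R : realType) (e y : R) : 0 < e ->
  is_derive y (1 : R) (fun y => y / (1 + e * y ^+ 2))
    ((1 - e * y ^+ 2) / (1 + e * y ^+ 2) ^+ 2).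
Proof.
move=> e0; have den0 : 1 + e * y ^+ 2 != 0.
  by rewrite gt_eqF// ltr_wpDr// mulr_ge0 ?sqr_ge0// ltW.
rewrite (_ : (fun y => _) = (@id R) * (fun y => (1 + e * y ^+ 2)^-1))//.
pose q := cst 1 + e *: ((@id R) ^+ 2).
have dq : is_derive y (1 : R) q (e * (2 * y)).
  by apply: is_derive_eq; rewrite /= add0r /GRing.scale/= mulr1 expr1.
have dV : is_derive y (1 : R) (fun y => (q y)^-1) (- (q y) ^- 2 *: (e * (2 * y))).
  exact: is_deriveV.
apply: is_derive_eq; rewrite /GRing.scale/= /q !fctE /=. 
rewrite (_ : e *: y ^+ 2 = e * y ^+ 2)//; field; exact: den0.
Qed.

Section soft_truncation.
Variables (R : realType) (d : nat) (n : nat).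

(** A smooth truncation of the identity: bounded for each [n], with derivative at most 1 in absolute
    value whatever [n], and its product with y increases to y^2. *)
Definition soft_truncation (y : R) : R := y / (1 + n.+1%:R^-1 * y ^+ 2).

Let e : R := n.+1%:R^-1.
Let e0 : 0 < e. Proof. by rewrite invr_gt0. Qed.
Let e1 : e <= 1. Proof. by rewrite invf_le1// ler1n. Qed.
Let drho (y : R) := (1 - e * y ^+ 2) / (1 + e * y ^+ 2) ^+ 2.

Let den1 y : 1 <= 1 + e * y ^+ 2.
Proof. by rewrite lerDl mulr_ge0 ?sqr_ge0// ltW. Qed.

Let den0 y : 0 < 1 + e * y ^+ 2. Proof. exact: lt_le_trans (den1 y). Qed.

Lemma soft_truncation_le y : `|soft_truncation y| <= n.+1%:R.
Proof.
rewrite normrM normfV (gtr0_norm (den0 y)) ler_pdivrMr//.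
rewrite mulrDr mulr1 mulrA mulfV// mul1r -[y ^+ 2]real_normK ?num_real//.
have n1 : 1 <= n.+1%:R :> R by rewrite ler1n.
have := sqr_ge0 (`|y| - 1); have := sqr_ge0 `|y|; nra.
Qed.

Let drho1 y : `|drho y| <= 1.
Proof.
have d0 := den0 y; have d1 := den1 y.
have h0 : 0 <= e * y ^+ 2 by rewrite mulr_ge0 ?sqr_ge0// ltW.
rewrite normrM normfV (gtr0_norm (exprn_gt0 2 d0)) ler_pdivrMr ?exprn_gt0//.
rewrite mul1r ler_norml; apply/andP; split; nra.
Qed.

Let continuous_drho : continuous drho.
Proof.
have sq : continuous (fun y : R => e * y ^+ 2).
  apply: continuous_mulR; first exact: cst_continuous.
  by move=> y; apply: exprn_continuous.
have den : continuous (fun y : R => 1 + e * y ^+ 2).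
  by apply: continuous_addR => //; exact: cst_continuous.
move=> y; apply: cvgM.
  by apply: cvgB; [exact: cvg_cst|exact: sq].
apply: cvgV; first by rewrite expf_neq0// gt_eqF.
under eq_fun do rewrite expr2; rewrite expr2.
by apply: cvgM; exact: den.
Qed.

Variable i : 'I_d.
Let phi (x : 'cV[R]_d) := soft_truncation (x i 0).

Let dphi (x : 'cV[R]_d) k : is_derive x (delta_mx k 0) phi (drho (x i 0) * (i == k)%:R).
Proof.
apply: is_derive_comp_coord => y; exact: is_derive_soft_truncation.
Qed.

Lemma partial_soft_truncation_le k (x : 'cV[R]_d) : `|partial k phi x| <= 1.
Proof.
rewrite /partial; case: (dphi x k) => _ ->; rewrite normrM.
by case: (i == k); rewrite ?normr1 ?normr0 ?mulr1 ?mulr0.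
Qed.

Lemma class_C1_soft_truncation : class_C1 phi.
Proof.
split => [k x|k]; first by case: (dphi x k).
have -> : partial k phi = fun x => drho (x i 0) * (i == k)%:R.
  by apply/funext => x; rewrite /partial; case: (dphi x k).
apply: continuous_mulR; last exact: cst_continuous.
move=> x; apply: (@continuous_comp _ _ _ (fun v : 'cV[R]_d => v i 0) drho).
  exact: coord_continuous.
exact: continuous_drho.
Qed.

Lemma continuous_soft_truncation : continuous soft_truncation.
Proof.
move=> y; apply: differentiable_continuous; apply/derivable1_diffP.
by case: (is_derive_soft_truncation y e0).
Qed.

Lemma continuous_soft_truncation_coord : continuous phi.
Proof.
move=> x; apply: (@continuous_comp _ _ _ (fun v : 'cV[R]_d => v i 0) soft_truncation).
  exact: coord_continuous.
exact: continuous_soft_truncation.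
Qed.

End soft_truncation.

(** * Bounds for the statistic *)

Section lipschitz_statistics.
Variables (R : realType) (d : nat) (g : 'cV[R]_d -> R) (a : R).
Hypothesis ga : euclid_lipschitz a g.

Lemma measurable_lipschitz dT (T : measurableType dT) (V : T -> 'cV[R]_d) :
  (forall k, measurable_fun setT (fun w => V w k 0)) ->
  measurable_fun setT (fun w => g (V w)).
Proof.
move=> mV; apply: measurable_continuous_comp; last exact: measurable_fun_borelV.
exact: euclid_lipschitz_continuous ga.
Qed.

Lemma L1_lipschitz dT (T : measurableType dT) (m : probability T R)
    (V : T -> 'cV[R]_d) : (forall k, L1 m (fun w => V w k 0)) ->
  L1 m (fun w => g (V w)).
Proof.
move=> iV; have inV : L1 m (fun w => enorm (V w)).
  by apply: L1_hsnorm => i j; rewrite (ord1 j).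
apply: (L1_le _ (L1D (L1_cst m `|g 0|) (L1Zl a inV))).
  by apply: measurable_lipschitz => k; exact: L1_measurable (iV k).
move=> w /=; rewrite -lerBlDl; apply: le_trans (lerB_dist _ _) _.
by have := ga (V w) 0; rewrite subr0.
Qed.

End lipschitz_statistics.

(** [K] must not depend on the bound [b] on second derivatives, which may grow as the approximation
    improves. Each of the two laws costs an error e/2. *)
Lemma lipschitz_mollify (R : realType) (d : nat) (g : 'cV[R]_d -> R) (a : R)
    dT (T : measurableType dT) (m : probability T R)
    dT' (T' : measurableType dT') (m' : probability T' R)
    (V : T -> 'cV[R]_d) (V' : T' -> 'cV[R]_d) (K : R) :
  euclid_lipschitz a g ->
  (forall k, L1 m (fun w => V w k 0)) -> (forall k, L1 m' (fun w => V' w k 0)) ->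
  (forall h b, class_C2 h -> euclid_lipschitz a h ->
     (forall i j x, `|partial j (partial i h) x| <= b) ->
     `|\int[m]_w h (V w) - \int[m']_w h (V' w)| <= K) ->
  `|\int[m]_w g (V w) - \int[m']_w g (V' w)| <= K.
Proof.
move=> ga iV iV' hK; apply/ler_addgt0Pr => e e0.
have e20 : 0 < e / 2 by rewrite divr_gt0.
have [h [C2h ah hg [b hb]]] := euclid_lipschitz_C2_approx ga e20.
have close dX (Y : measurableType dX) (n : probability Y R) (Z : Y -> 'cV[R]_d) :
    L1 n (fun w => g (Z w)) -> L1 n (fun w => h (Z w)) ->
    `|\int[n]_w h (Z w) - \int[n]_w g (Z w)| <= e / 2.
  move=> i1 i2; rewrite -(RintegralB measurableT i2 i1) -[leRHS](Rintegral_prob_cst n).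
  by apply: le_Rintegral_norm; [exact: L1B|exact: (L1_cst n (e / 2))|].
have c1 := close _ _ m V (L1_lipschitz ga iV) (L1_lipschitz ah iV).
have c2 := close _ _ m' V' (L1_lipschitz ga iV') (L1_lipschitz ah iV').
have := hK h b C2h ah hb; move: c1 c2.
rewrite !ler_norml => /andP[? ?] /andP[? ?] /andP[? ?]; apply/andP; split; lra.
Qed.

(** * The integration by parts and the bounds for W = F(X_0) *)

Section stein_statistic.
Context (R : realType) (dT : measure_display) (T : measurableType dT)
  (P : probability T R) (dS : measure_display) (S : measurableType dS)
  (mu : probability S R) (p : R -> R.-pker S ~> S) (X : R -> T -> S)
  (hX : stationary_reversible_markov P mu p X)
  (d : nat) (F : S -> 'cV[R]_d)
  (hF : generatorV_domain p F) (hFF : carre_du_champV_domain p F F)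
  (hint : forall j, L1 P (component F j \o X 0))
  (hlim : forall rho : R, 0 < rho ->
     ((t^-1)%:E * 'E_P[(fun w => enorm (F (X t w) - F (X 0 w)) ^+ 2
                         * (rho < enorm (F (X t w) - F (X 0 w)))%R%:R)%R]
       @[t --> 0^'+] --> 0)%E)
  (Lambda Sigma : 'M[R]_d) (hLambda : Lambda \in unitmx)
  (e1 : T -> 'cV[R]_d) (e2 : T -> 'M[R]_d)
  (ie1 : forall k, L1 P (fun w => e1 w k 0))
  (ie2 : forall k i, L1 P (fun w => e2 w k i))
  (hL : {ae P, forall w,
     generatorV p F (X 0 w) = - (Lambda *m F (X 0 w)) + e1 w})
  (hGamma : {ae P, forall w,
     carre_du_champV p F F (X 0 w) = Lambda *m Sigma + e2 w}).

Let W w := F (X 0 w).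
Let U w := invmx Lambda *m e1 w.
Let N w := invmx Lambda *m e2 w.

Lemma L1_mulmx_const m n l (B : 'M[R]_(m, n)) (e : T -> 'M[R]_(n, l)) :
  (forall i j, L1 P (fun w => e w i j)) ->
  forall i j, L1 P (fun w => (B *m e w) i j).
Proof.
by move=> ie i j; under eq_fun do rewrite mxE; apply: L1_sum => k; exact: L1Zl.
Qed.

Let iU k : L1 P (fun w => U w k 0).
Proof. by apply: L1_mulmx_const => i j; rewrite (ord1 j). Qed.

Let iN k i : L1 P (fun w => N w k i). Proof. exact: L1_mulmx_const. Qed.

Let mX0 : measurable_fun setT (X 0).
Proof. exact: (markov_measurable hX). Qed.

Let mFX k : measurable_fun setT (fun w => F (X 0 w) k 0).
Proof. exact: L1_measurable (hint k). Qed.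

Let mV j : measurable_fun setT (fun w => generator p (component F j) (X 0 w)).
Proof. exact: measurableT_comp (measurable_generator (hF j)) mX0. Qed.

Let mG k j : measurable_fun setT
  (fun w => carre_du_champ p (component F k) (component F j) (X 0 w)).
Proof.
have mFc i : measurable_fun setT (component F i) by case: (hF i).
have [_ _ dFF] := hFF k j.
apply: (measurableT_comp (f := carre_du_champ p (component F k) (component F j))) => //.
apply: measurable_funM => //; apply: measurable_funB.
  apply: measurable_funB; first exact: measurable_generator.
  by apply: measurable_funM => //; exact: measurable_generator.
by apply: measurable_funM => //; exact: measurable_generator.
Qed.

Lemma L1_carre_du_champ k j :
  L1 P (fun w => carre_du_champ p (component F k) (component F j) (X 0 w)).
Proof.
apply: (ae_eq_L1 (f := fun w => (Lambda *m Sigma) k j + e2 w k j)) => //.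
  apply: filterS hGamma => w h.
  by have := congr1 (fun M : 'M[R]_d => M k j) h; rewrite !mxE => ->.
by apply: L1D => //; exact: (L1_cst P ((Lambda *m Sigma) k j)).
Qed.

(** Multiplied by Lambda^-1, the two hypotheses read W - U = - Lambda^-1 LF(X_0) and Sigma + N =
    Lambda^-1 Gamma(F, F)(X_0). The identity is the corresponding combination over j of the
    reversible ones. *)
Lemma statistic_ibp (phi : 'cV[R]_d -> R) C : class_C1 phi -> continuous phi ->
  (forall k x, `|partial k phi x| <= C) -> L1 P (fun w => phi (W w) ^+ 2) ->
  (forall k, L1 P (fun w => phi (W w) * W w k 0)) ->
  (forall k, L1 P (fun w => phi (W w) * U w k 0)) ->
  forall k, \int[P]_w (phi (W w) * W w k 0) = \int[P]_w (phi (W w) * U w k 0) +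
    \sum_i \int[P]_w (partial i phi (W w) * (Sigma k i + N w k i)).
Proof.
move=> C1phi cphi phiC phi2 iphiW iphiU k.
pose V j w := generator p (component F j) (X 0 w).
pose G i j w := carre_du_champ p (component F i) (component F j) (X 0 w).
have ibp j := reversible_ibp hX hF hFF hint hlim L1_carre_du_champ C1phi cphi
  phiC phi2 j.
have iV j : L1 P (fun w => phi (W w) * V j w) := (ibp j).1.
have mdphi i : measurable_fun setT (fun w => partial i phi (W w)).
  by apply: measurable_continuous_comp (C1phi.2 i) _; exact: measurable_fun_borelV.
have idG i j : L1 P (fun w => partial i phi (W w) * G i j w).
  apply: (L1_mul_bounded (C := C) (L1_carre_du_champ i j)); first exact: mdphi.
  by move=> w; exact: phiC.
have idN i : L1 P (fun w => partial i phi (W w) * (Sigma k i + N w k i)).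
  have iSN := L1D (L1_cst P (Sigma k i)) (iN k i).
  apply: (L1_mul_bounded (C := C) iSN); first exact: mdphi.
  by move=> w; exact: phiC.
have EV : \int[P]_w (phi (W w) * W w k 0 - phi (W w) * U w k 0) =
    \int[P]_w (\sum_j - invmx Lambda k j * (phi (W w) * V j w)).
  apply: ae_eq_Rintegral.
  - apply: filterS hL => w h.
    have {}h : - (invmx Lambda *m \col_j V j w) = W w - U w.
      rewrite (_ : \col_j V j w = generatorV p F (X 0 w))// h mulmxDr mulmxN.
      by rewrite mulKmx// opprD opprK.
    rewrite -mulrBr; have -> : W w k 0 - U w k 0 = (W w - U w) k 0 by rewrite !mxE.
    rewrite -h [in LHS]mxE mxE -sumrN mulr_sumr; apply: eq_bigr => j _.
    by rewrite mxE mulNr mulrN mulrCA.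
  - exact: L1_measurable (L1B (iphiW k) (iphiU k)).
  - by apply: L1_measurable; apply: L1_sum => j; exact: L1Zl.
have EN i : \int[P]_w (\sum_j invmx Lambda k j * (partial i phi (W w) * G i j w)) =
    \int[P]_w (partial i phi (W w) * (Sigma k i + N w k i)).
  apply: ae_eq_Rintegral.
  - apply: filterS hGamma => w h.
    have -> : Sigma k i + N w k i = (invmx Lambda *m carre_du_champV p F F (X 0 w)) k i.
      by rewrite h mulmxDr mulKmx// [RHS]mxE.
    rewrite [in RHS]mxE mulr_sumr; apply: eq_bigr => j _.
    by rewrite mxE /G carre_du_champC mulrCA.
  - by apply: L1_measurable; apply: L1_sum => j; exact: L1Zl.
  - exact: L1_measurable (idN i).
apply/eqP; rewrite addrC -subr_eq -(RintegralB measurableT (iphiW k) (iphiU k)) EV.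
rewrite Rintegral_sum; last by move=> j; exact: L1Zl.
apply/eqP; transitivity (\sum_j \sum_i
    invmx Lambda k j * \int[P]_w (partial i phi (W w) * G i j w)).
  apply: eq_bigr => j _; rewrite (RintegralZl _ measurableT (iV j)) (ibp j).2.
  by rewrite mulrNN mulr_sumr.
rewrite exchange_big/=; apply: eq_bigr => i _; rewrite -EN Rintegral_sum.
  by apply: eq_bigr => j _; rewrite (RintegralZl _ measurableT (idG i j)).
by move=> j; exact: L1Zl.
Qed.

(** With U = 0 and rho the soft truncation, integration by parts bounds E[W_i rho(W_i)] by the sum
    over k of E|Sigma_ik + N_ik|, uniformly in n, because |rho'| <= 1. *)
Lemma statistic_sqr_integrable i : (forall w, e1 w = 0) ->
  L1 P (fun w => W w i 0 ^+ 2).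
Proof.
move=> e10.
have U0 w : U w = 0 by rewrite /U e10 mulmx0.
have iSN k : L1 P (fun w => Sigma i k + N w i k).
  by apply: L1D => //; exact: (L1_cst P (Sigma i k)).
apply: (L1_sqr_truncation (C := \sum_k \int[P]_w `|Sigma i k + N w i k|)) => // n.
pose phi (x : 'cV[R]_d) := soft_truncation n (x i 0).
have mphi : measurable_fun setT (fun w => phi (W w)).
  apply: (measurableT_comp (f := @soft_truncation R n)) => //.
  by apply: continuous_measurable_fun; exact: continuous_soft_truncation.
have phin w : `|phi (W w)| <= n.+1%:R by exact: soft_truncation_le.
have phi2 : L1 P (fun w => phi (W w) ^+ 2).
  apply: (L1_bounded P (C := n.+1%:R ^+ 2)); first exact: measurable_funX.
  by move=> w; rewrite normrX lerXn2r ?nnegrE.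
have iphiW k : L1 P (fun w => phi (W w) * W w k 0).
  exact: (L1_mul_bounded (C := n.+1%:R) (hint k)).
have iphiU k : L1 P (fun w => phi (W w) * U w k 0).
  exact: (L1_mul_bounded (C := n.+1%:R) (iU k)).
have E w : W w i 0 ^+ 2 / (1 + n.+1%:R^-1 * W w i 0 ^+ 2) = phi (W w) * W w i 0.
  by rewrite /phi /soft_truncation expr2 mulrAC.
split; first by apply: L1_ext (iphiW i) => w; rewrite E.
rewrite (@eq_Rintegral _ _ _ P setT (fun w => phi (W w) * W w i 0)); last by move=> w _; rewrite E.
rewrite (statistic_ibp (@class_C1_soft_truncation R d n i)
  (@continuous_soft_truncation_coord R d n i)
  (@partial_soft_truncation_le R d n i) phi2 iphiW iphiU i).
have -> : \int[P]_w (phi (W w) * U w i 0) = 0.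
  rewrite (@eq_Rintegral _ _ _ P setT (fun=> 0)) ?Rintegral_prob_cst//.
  by move=> w _; rewrite U0 mxE mulr0.
rewrite add0r; apply: ler_sum => k _; apply: le_trans (ler_norm _) _.
apply: le_Rintegral_norm.
- apply: (L1_mul_bounded (C := 1) (iSN k)); last by move=> w; exact: partial_soft_truncation_le.
  apply: measurable_continuous_comp ((@class_C1_soft_truncation R d n i).2 k) _.
  exact: measurable_fun_borelV.
- exact: L1_norm.
- by move=> w; rewrite normrM ler_piMl//; exact: partial_soft_truncation_le.
Qed.

Context (gamma : probability (borelV R d) R) (gammaN : std_normal gamma)
  (A : 'M[R]_d) (AAT : A *m A^T = Sigma).

(** A bounded gradient is the case c1 = 0. If instead e1 = 0, the gradient grows linearly with slope
    c1 = b, W is square integrable, and any [a] serves because U = 0. *)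
Lemma statistic_hessian_bound (g : 'cV[R]_d -> R) a b : class_C2 g ->
  (forall x, hsnorm (hessian g x) <= b) ->
  0 <= a -> (forall x, enorm (gradient g x) <= a) \/ (forall w, e1 w = 0) ->
  [/\ L1 P (fun w => g (W w)), L1 gamma (fun v => g (A *m (v : 'cV[R]_d))) &
  `|\int[P]_w g (W w) - \int[gamma]_v g (A *m v)| <=
  a * \int[P]_w enorm (U w) + 2^-1 * (b * \int[P]_w hsnorm (N w))].
Proof.
move=> C2g hb a0 [ha|e10].
  have g1 k x : `|partial k g x| <= a + 0 * \sum_i `|x i 0|.
    rewrite mul0r addr0; apply: le_trans (ha x).
    by have := ler_entry_hsnorm (gradient g x) k 0; rewrite mxE.
  have g2 k l x : `|partial l (partial k g) x| <= b.
    by apply: le_trans (hb x); have := ler_entry_hsnorm (hessian g x) k l; rewrite mxE.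
  have L10 (f : T -> R) : L1 P (fun w => 0 * f w).
    by apply: L1_ext (L1_cst P 0) => w; rewrite mul0r.
  apply: (stein_hessian_bound gammaN AAT hint iU iN statistic_ibp C2g a0 (lexx 0) g1 g2 _ _ _ hb) => //.
  by move=> w x; rewrite ler_wpM2r ?hsnorm_ge0.
have g2 k l x : `|partial l (partial k g) x| <= b.
  by apply: le_trans (hb x); have := ler_entry_hsnorm (hessian g x) k l; rewrite mxE.
have b0 : 0 <= b by exact: le_trans (hsnorm_ge0 _) (hb 0).
have g1 k x : `|partial k g x| <= \sum_l `|partial l g 0| + b * \sum_i `|x i 0|.
  have := bounded_partials_growth 0 x ((class_C2_C1 C2g).2 k).1 (g2 k).
  under eq_bigr do rewrite mxE subr0.
  move=> h; have := ler_normD (partial k g x - partial k g 0) (partial k g 0).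
  rewrite subrK => /le_trans; apply; rewrite addrC lerD//.
  by rewrite (bigD1 k)//= lerDl sumr_ge0.
have U0 w : U w = 0 by rewrite /U e10 mulmx0.
have c00 : 0 <= \sum_l `|partial l g 0| by exact: sumr_ge0.
apply: (stein_hessian_bound gammaN AAT hint iU iN statistic_ibp C2g c00 b0 g1 g2 _ _ _ hb) => //.
- by move=> k; apply: L1Zl; exact: statistic_sqr_integrable.
- by move=> k; apply: L1_ext (L1_cst P 0) => w; rewrite U0 mxE expr0n mulr0.
- by move=> w x; rewrite U0 hsnorm0 !mulr0.
Qed.

Let iAv k : L1 gamma (fun v : borelV R d => (A *m (v : 'cV[R]_d)) k 0).
Proof.
under eq_fun do rewrite mxE; apply: L1_sum => i; apply: L1Zl.
exact: L1_gaussian_coord.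
Qed.

Let hessian_le (h : 'cV[R]_d -> R) b x :
  (forall i j x, `|partial j (partial i h) x| <= b) ->
  hsnorm (hessian h x) <= \sum_(i < d) \sum_(j < d) b.
Proof.
move=> hb; apply: le_trans (hsnorm_le_sum _) _.
by apply: ler_sum => i _; apply: ler_sum => j _; rewrite mxE.
Qed.

(** The second derivatives of the mollified function, however large, are multiplied by the mean of
    |N|, which is 0. *)
Lemma statistic_lipschitz_bound0 (g : 'cV[R]_d -> R) a : 0 <= a ->
  euclid_lipschitz a g -> (forall w, e2 w = 0) ->
  `|\int[P]_w g (W w) - \int[gamma]_v g (A *m v)| <= a * \int[P]_w enorm (U w).
Proof.
move=> a0 ga e20; apply: (lipschitz_mollify ga hint iAv) => h b C2h ah hb.
have [_ _] := statistic_hessian_bound C2h (fun x => hessian_le x hb) a0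
  (or_introl (fun x => lipschitz_gradient_le x a0 (class_C2_C1 C2h).1 ah)).
rewrite (@eq_Rintegral _ _ _ P setT (fun=> 0) (fun w => hsnorm (N w))).
  by rewrite Rintegral_prob_cst !mulr0 addr0.
by move=> w _; rewrite /N e20 mulmx0 hsnorm0.
Qed.

Lemma statistic_lipschitz_bound (g : 'cV[R]_d -> R) a (M : 'M[R]_d) : 0 <= a ->
  euclid_lipschitz a g -> A *m M = 1%:M ->
  `|\int[P]_w g (W w) - \int[gamma]_v g (A *m v)| <=
  a * \int[P]_w enorm (U w) + a * \int[P]_w hsnorm (N w *m M^T).
Proof.
move=> a0 ga AM; apply: (lipschitz_mollify ga hint iAv) => h b C2h ah hb.
have ha x : enorm (gradient h x) <= a.
  exact: lipschitz_gradient_le a0 (class_C2_C1 C2h).1 ah.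
have g1 k x : `|partial k h x| <= a + 0 * \sum_i `|x i 0|.
  rewrite mul0r addr0; apply: le_trans (ha x).
  by have := ler_entry_hsnorm (gradient h x) k 0; rewrite mxE.
have L10 (f : T -> R) : L1 P (fun w => 0 * f w).
  by apply: L1_ext (L1_cst P 0) => w; rewrite mul0r.
have [_ _] := stein_lipschitz_bound gammaN AAT hint iU iN statistic_ibp C2h a0
  (lexx 0) g1 hb (fun k => L10 _) (fun k => L10 _) AM ha.
by [].
Qed.

End stein_statistic.

(** * Lipschitz functions determine a law *)

Section inf_convolution.
Variables (R : realType) (d : nat) (O : set 'cV[R]_d).
Implicit Types x y : 'cV[R]_d.

(* The largest n-Lipschitz function below the indicator of O. *)
Definition lipschitz_indicator (n : nat) x : R :=
  inf [set \1_O y + n%:R * enorm (x - y) | y in setT].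

Let val0 n x y : 0 <= \1_O y + n%:R * enorm (x - y) :> R.
Proof. by rewrite addr_ge0 ?mulr_ge0 ?hsnorm_ge0// indicE. Qed.

Let bnd n x : has_lbound [set \1_O y + n%:R * enorm (x - y) | y in setT].
Proof. by exists 0 => _ [y _ <-]; exact: val0. Qed.

Let ne n x : [set \1_O y + n%:R * enorm (x - y) | y in setT] !=set0.
Proof. by exists (\1_O x + n%:R * enorm (x - x)), x. Qed.

Lemma lipschitz_indicator_ge0 n x : 0 <= lipschitz_indicator n x.
Proof. by apply: lb_le_inf => // _ [y _ <-]; exact: val0. Qed.

Lemma lipschitz_indicator_le n x : lipschitz_indicator n x <= \1_O x.
Proof.
apply: ge_inf => //; exists x => //.
by rewrite subrr hsnorm0 mulr0 addr0.
Qed.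

Lemma lipschitz_indicator_lipschitz n : euclid_lipschitz n%:R (lipschitz_indicator n).
Proof.
have h x y : lipschitz_indicator n x - lipschitz_indicator n y <= n%:R * enorm (x - y).
  rewrite lerBlDr -lerBlDl; apply: lb_le_inf => // _ [z _ <-].
  rewrite lerBlDl; apply: le_trans (ge_inf (bnd n x) _) _; first by exists z.
  rewrite addrCA lerD2l -mulrDr ler_wpM2l//.
  by have := hsnormD (x - y) (y - z); rewrite addrA subrK.
move=> x y; rewrite ler_norml h andbT lerNl opprB.
by have := h y x; rewrite -hsnormN opprB.
Qed.

(** At a point of [O] whose coordinate cube of half-width e lies in [O], the value is exactly 1 as
    soon as n e >= 1; outside [O] it is always 0. *)
Lemma lipschitz_indicator_cvg x : open O ->
  lipschitz_indicator n x @[n --> \oo] --> (\1_O x : R).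
Proof.
move=> oO; have [Ox|nOx] := pselect (O x); last first.
  apply: cvg_near_cst; apply: nearW => n; apply/eqP; rewrite eq_le.
  rewrite lipschitz_indicator_le/= indicE memNset//.
  exact: lipschitz_indicator_ge0.
have [e e0 he] := nbhs_coord (open_nbhs_nbhs (conj oO Ox)).
apply: cvg_near_cst; exists (Num.truncn e^-1).+1 => // n /= Nn.
apply/eqP; rewrite eq_le lipschitz_indicator_le/= indicE mem_set//.
apply: lb_le_inf => // _ [y _ <-].
have [Oy|nOy] := pselect (O y).
  by rewrite indicE mem_set//= lerDl mulr_ge0 ?hsnorm_ge0.
rewrite indicE memNset// add0r.
have ey : e <= enorm (x - y).
  rewrite leNgt; apply/negP => ye; apply: nOy; apply: he => i.
  apply: le_lt_trans ye; rewrite distrC.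
  by have := ler_entry_hsnorm (x - y) i 0; rewrite !mxE.
apply: (@le_trans _ _ (n%:R * e)); last by rewrite ler_wpM2l.
rewrite -ler_pdivrMr// mul1r; apply: le_trans (ltW (truncnS_gt _)) _.
by rewrite ler_nat.
Qed.

End inf_convolution.

Section equal_laws.
Context (R : realType) (d : nat) dT (T : measurableType dT) (m : probability T R)
  dT' (T' : measurableType dT') (m' : probability T' R)
  (V : T -> 'cV[R]_d) (V' : T' -> 'cV[R]_d)
  (mV : measurable_fun setT (V : T -> borelV R d))
  (mV' : measurable_fun setT (V' : T' -> borelV R d)).
Hypothesis hE : forall (h : 'cV[R]_d -> R) a, 0 <= a -> euclid_lipschitz a h ->
  \int[m]_w h (V w) = \int[m']_w h (V' w).

(** Lipschitz functions with values in [0, 1] converge to the indicator of an open set; dominated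
    convergence transfers the equality, and open sets are a generating pi-system. *)
Let law_open (O : set 'cV[R]_d) : open O -> m (V @^-1` O) = m' (V' @^-1` O).
Proof.
move=> oO.
have cvgP dX (Y : measurableType dX) (n : probability Y R) (Z : Y -> 'cV[R]_d) :
    measurable_fun setT (Z : Y -> borelV R d) ->
    (\int[n]_w (lipschitz_indicator O k (Z w)))%:E @[k --> \oo] --> n (Z @^-1` O).
  move=> mZ.
  have mh k : measurable_fun setT (fun w => lipschitz_indicator O k (Z w)).
    apply: measurable_continuous_comp mZ; apply: euclid_lipschitz_continuous.
    exact: lipschitz_indicator_lipschitz.
  have h1 k w : `|lipschitz_indicator O k (Z w)| <= 1.
    rewrite ger0_norm ?lipschitz_indicator_ge0//.
    by apply: le_trans (lipschitz_indicator_le _ _ _) _; rewrite indicE lern1 leq_b1.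
  have mO : measurable (Z @^-1` O).
    by rewrite -[_ @^-1` _]setTI; apply: mZ => //; exact: sub_sigma_algebra.
  have -> : n (Z @^-1` O) = (\int[n]_w (\1_O (Z w))%:E)%E.
    exact: (esym (etrans (integral_indic n measurableT mO) (congr1 n (setIT _)))).
  have -> : (fun k => (\int[n]_w (lipschitz_indicator O k (Z w)))%:E) =
      (fun k => \int[n]_w (lipschitz_indicator O k (Z w))%:E)%E.
    by apply/funext => k; rewrite (L1_EFin_Rintegral (L1_bounded n (mh k) (h1 k))).
  apply: (@dominated_cvg _ _ _ n _ measurableT _ _ (cst 1%:E)) => //.
  - by move=> k; exact/measurable_EFinP.
  - move=> w _; apply: cvg_EFin; first exact: nearW.
    exact: lipschitz_indicator_cvg.
  - exact: (L1_cst n 1).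
  - by move=> k w _; rewrite /= lee_fin; exact: h1.
have := cvgP _ _ m V mV.
have -> : (fun k => (\int[m]_w (lipschitz_indicator O k (V w)))%:E) =
    (fun k => (\int[m']_w (lipschitz_indicator O k (V' w)))%:E).
  apply/funext => k; congr (_%:E); apply: (hE (a := k%:R)) => //.
  exact: lipschitz_indicator_lipschitz.
by move=> /cvg_unique; apply => //; exact: cvgP.
Qed.

Lemma lipschitz_determines_law (B : set (borelV R d)) : measurable B ->
  m (V @^-1` B) = m' (V' @^-1` B).
Proof.
move=> mB; pose m1 : {measure set (borelV R d) -> \bar R} :=
  pushforward m (V : T -> borelV R d).
pose m2 : {measure set (borelV R d) -> \bar R} :=
  pushforward m' (V' : T' -> borelV R d).
refine (@measure_unique _ R (borelV R d) (@open 'cV[R]_d) (fun=> setT) _ _ _ _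
  (m1 mV) (m2 mV') _ _ B mB) => //.
- by move=> A C oA oC; exact: openI.
- by move=> _; exact: openT.
- by apply/seteqP; split=> // z _; exists 0%N.
- move=> _; apply: le_lt_trans (ltry 1); apply: (probability_le1 m).
  by rewrite preimage_setT; exact: measurableT.
Qed.

End equal_laws.

(** * Infinite norms and expectations *)

Lemma measurable_wrt_measurable dT dS dE (T : measurableType dT)
    (S : measurableType dS) (E : measurableType dE) (Y : T -> S) (f : T -> E) :
  measurable_fun setT Y -> measurable_wrt Y f -> measurable_fun setT f.
Proof.
move=> mY fY _ B mB; rewrite setTI; have [C mC <-] := fY B mB.
exact: mY.
Qed.

Lemma supnorm_cases (R : realType) d (f : 'cV[R]_d -> R) : (forall x, 0 <= f x) ->
  supnorm f = +oo%E \/ exists a, [/\ 0 <= a, supnorm f = a%:E & forall x, f x <= a].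
Proof.
move=> f0; have ub x : ((f x)%:E <= supnorm f)%E.
  by apply: ereal_sup_ubound; exists x => //; rewrite ger0_norm.
case E : (supnorm f) => [a| |]; last 1 first.
- by have := ub 0; rewrite E.
- right; exists a; split => // [|x]; last by have := ub x; rewrite E lee_fin.
  by have := ub 0; rewrite E lee_fin; apply: le_trans.
- by left.
Qed.

Section expectation.
Context (R : realType) dT (T : measurableType dT) (P : probability T R).
Variable f : T -> R.
Hypotheses (mf : measurable_fun setT f) (f0 : forall w, 0 <= f w).

Lemma expectation_cases : 'E_P[f]%E = +oo%E \/
  L1 P f /\ 'E_P[f]%E = (\int[P]_w f w)%:E.
Proof.
have [fi|fi] := ltP ('E_P[f])%E +oo%E; last by left; apply/eqP; rewrite -leye_eq.
right; have iP : L1 P f by apply: L1_ge0_lty => //; rewrite -expectation_integral.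
by split=> //; exact: expectation_Rintegral.
Qed.

Lemma expectation_nneg : (0 <= 'E_P[f])%E.
Proof. by rewrite expectation_integral; apply: integral_ge0 => w _; rewrite lee_fin. Qed.

Lemma Rintegral_eq0_ae : L1 P f -> \int[P]_w f w = 0 -> {ae P, forall w, f w = 0}.
Proof.
move=> fi f00; have mf' : measurable_fun setT (EFin \o f) by exact/measurable_EFinP.
have /(ae_eq_integral_abs P measurableT mf') : (\int[P]_w `|(EFin \o f) w| = 0)%E.
  under eq_integral do rewrite /= ger0_norm//.
  by rewrite L1_EFin_Rintegral// f00.
by apply: filterS => w /(_ I)[].
Qed.

End expectation.

(** Positivity of [K] matters: in the extended reals 0 * +oo = 0, so an infinite term makes the
    bound vacuous only behind a positive factor. *)
Lemma mule_pinfty_addl (R : realType) (K : R) (u v : \bar R) : 0 < K ->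
  (0 <= u)%E -> (0 <= v)%E -> u = +oo%E \/ v = +oo%E -> (K%:E * (u + v))%E = +oo%E.
Proof.
move=> K0 u0 v0 h; rewrite (_ : (u + v)%E = +oo%E) ?gt0_muley ?lte_fin//.
case: h => ->.
  by rewrite addye// gt_eqF// (lt_le_trans _ v0)// ltNyr.
by rewrite addey// gt_eqF// (lt_le_trans _ u0)// ltNyr.
Qed.

(** The norm depends only on the Gram matrix; this is what allows A^-1 to be exchanged for the
    symmetric root of Sigma^-1. *)
Lemma hsnorm_gram (R : realType) m n (B : 'M[R]_(m, n)) :
  hsnorm B = Num.sqrt (\tr (B^T *m B)).
Proof.
congr Num.sqrt; rewrite exchange_big; apply: eq_bigr => j _; rewrite mxE.
by apply: eq_bigr => i _; rewrite mxE expr2.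
Qed.

Lemma affine_of_hessian0 (R : realType) d (g : 'cV[R]_d -> R) : class_C2 g ->
  (forall x, hsnorm (hessian g x) <= 0) ->
  forall x, g x = g 0 + \sum_k partial k g 0 * x k 0.
Proof.
move=> C2g h0 x.
have C1dg := (class_C2_C1 C2g).2.
have h k l y : `|partial l (partial k g) y| <= 0.
  by apply: le_trans (h0 y); have := ler_entry_hsnorm (hessian g y) k l; rewrite mxE.
have dg k y : partial k g y = partial k g 0.
  apply/eqP; rewrite -subr_eq0 -normr_le0.
  by have := bounded_partials_growth 0 y (C1dg k).1 (h k); rewrite mul0r.
have [xi [_ E]] := mean_value_partial 0 x (class_C2_C1 C2g).1.1.
rewrite -[LHS](subrK (g 0)) addrC E; congr (_ + _); apply: eq_bigr => k _.
by rewrite dg mxE subr0.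
Qed.

(** * The two bounds, with infinite values allowed *)

Section main_estimates.
Context (R : realType) (dT : measure_display) (T : measurableType dT)
  (P : probability T R) (dS : measure_display) (S : measurableType dS)
  (mu : probability S R) (p : R -> R.-pker S ~> S) (X : R -> T -> S)
  (hX : stationary_reversible_markov P mu p X)
  (d : nat) (F : S -> 'cV[R]_d)
  (hF : generatorV_domain p F) (hFF : carre_du_champV_domain p F F)
  (hint : forall j, L1 P (component F j \o X 0))
  (hmean : forall j, ('E_P[component F j \o X 0%R] = 0)%E)
  (Lambda Sigma : 'M[R]_d) (hLambda : Lambda \in unitmx)
  (E1 : T -> 'cV[R]_d) (E2 : T -> 'M[R]_d)
  (mE1 : measurable_fun setT (E1 : T -> borelV R d))
  (mE2 : measurable_fun setT (E2 : T -> borelM R d d))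
  (hL : {ae P, forall w,
     generatorV p F (X 0 w) = - (Lambda *m F (X 0 w)) + E1 w})
  (hGamma : {ae P, forall w,
     carre_du_champV p F F (X 0 w) = Lambda *m Sigma + E2 w})
  (hlim : forall rho : R, 0 < rho ->
     ((t^-1)%:E * 'E_P[(fun w => enorm (F (X t w) - F (X 0 w)) ^+ 2
                         * (rho < enorm (F (X t w) - F (X 0 w)))%R%:R)%R]
       @[t --> 0^'+] --> 0)%E)
  (dT' : measure_display) (T' : measurableType dT') (P' : probability T' R)
  (Z : T' -> 'cV[R]_d) (mZ : measurable_fun setT (Z : T' -> borelV R d))
  (gamma : probability (borelV R d) R) (gammaN : std_normal gamma)
  (A : 'M[R]_d) (AAT : A *m A^T = Sigma)
  (hZ : forall C : set (borelV R d), measurable C ->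
          P' (Z @^-1` C) = gamma [set v : 'cV[R]_d | C (A *m v)]).

Let W w := F (X 0 w).
Let K := opnorm (invmx Lambda).
Let n1 w := enorm (E1 w).
Let n2 w := hsnorm (E2 w).

Let mn1 : measurable_fun setT n1.
Proof.
by apply: measurable_continuous_comp mE1; exact: enorm_continuous.
Qed.

Let mn2 : measurable_fun setT n2.
Proof.
apply: (measurableT_comp (f := @Num.sqrt R)).
  by apply: continuous_measurable_fun; exact: sqrt_continuous.
apply: measurable_sum => i; apply: measurable_sum => j; apply: measurable_funX.
exact: (measurableT_comp (measurable_entry i j) mE2).
Qed.

Let L1_E1 : L1 P n1 -> forall k, L1 P (fun w => E1 w k 0).
Proof.
move=> i1 k; apply: (L1_le _ i1); last by move=> w; exact: ler_entry_hsnorm.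
exact: (measurableT_comp (measurable_entry k 0) mE1).
Qed.

Let L1_E2 : L1 P n2 -> forall k i, L1 P (fun w => E2 w k i).
Proof.
move=> i2 k i; apply: (L1_le _ i2); last by move=> w; exact: ler_entry_hsnorm.
exact: (measurableT_comp (measurable_entry k i) mE2).
Qed.

Let mW : measurable_fun setT (W : T -> borelV R d).
Proof. by apply: measurable_fun_borelV => k; exact: L1_measurable (hint k). Qed.

Let mAv : measurable_fun setT (fun v : borelV R d => A *m (v : 'cV[R]_d) : borelV R d).
Proof.
apply: measurable_fun_borelV => k; under eq_fun do rewrite mxE.
apply: measurable_sum => i; apply: measurable_funM => //.
exact: measurable_entry.
Qed.

Let iAv k : L1 gamma (fun v : borelV R d => (A *m (v : 'cV[R]_d)) k 0).
Proof.
under eq_fun do rewrite mxE; apply: L1_sum => i; apply: L1Zl.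
exact: L1_gaussian_coord.
Qed.

Let E_Z (g : 'cV[R]_d -> R) : continuous g ->
  L1 gamma (fun v => g (A *m (v : 'cV[R]_d))) ->
  'E_P'[g \o Z]%E = (\int[gamma]_v g (A *m (v : 'cV[R]_d)))%:E.
Proof.
move=> cg ig; rewrite expectation_integral -(L1_EFin_Rintegral ig).
apply: (law_integral mZ mAv hZ (f := EFin \o (g : borelV R d -> R))).
by apply/measurable_EFinP; exact: continuous_measurable_borelM.
Qed.

Let E_W (g : 'cV[R]_d -> R) : L1 P (fun w => g (W w)) ->
  'E_P[g \o F \o X 0]%E = (\int[P]_w g (W w))%:E.
Proof. by move=> ig; rewrite (expectation_Rintegral (f := g \o F \o X 0) ig). Qed.

Let difference (g : 'cV[R]_d -> R) c : continuous g -> L1 P (fun w => g (W w)) ->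
  L1 gamma (fun v => g (A *m (v : 'cV[R]_d))) ->
  `|\int[P]_w g (W w) - \int[gamma]_v g (A *m (v : 'cV[R]_d))| <= c ->
  (`|'E_P[g \o F \o X 0%R] - 'E_P'[g \o Z]| <= c%:E)%E.
Proof. by move=> cg i1 i2 h; rewrite E_W// E_Z// -EFinB /= lee_fin. Qed.

(** If E|E_1| = 0, then E_1 vanishes almost surely and the zero function may take its place; the
    bounds above want it to vanish at every point. *)
Let hL0 : L1 P n1 -> \int[P]_w n1 w = 0 -> {ae P, forall w,
  generatorV p F (X 0 w) = - (Lambda *m F (X 0 w)) + (fun=> 0 : 'cV[R]_d) w}.
Proof.
move=> i1 /(Rintegral_eq0_ae mn1 (fun w => hsnorm_ge0 _) i1).
by move: hL; apply: filterS2 => w -> /hsnorm_eq0 ->.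
Qed.

Let hG0 : L1 P n2 -> \int[P]_w n2 w = 0 -> {ae P, forall w,
  carre_du_champV p F F (X 0 w) = Lambda *m Sigma + (fun=> 0 : 'M[R]_d) w}.
Proof.
move=> i2 /(Rintegral_eq0_ae mn2 (fun w => hsnorm_ge0 _) i2).
by move: hGamma; apply: filterS2 => w -> /hsnorm_eq0 ->.
Qed.

Let U_le : L1 P n1 -> \int[P]_w enorm (invmx Lambda *m E1 w) <= K * \int[P]_w n1 w.
Proof.
move=> i1; rewrite -(RintegralZl K measurableT i1).
apply: le_Rintegral => //; last by move=> w _; exact: enorm_opnorm.
  apply: L1_hsnorm => i j; apply: L1_mulmx_const => k l.
  by rewrite (ord1 l); exact: L1_E1.
exact: L1Zl.
Qed.

Let N_le : L1 P n2 -> \int[P]_w hsnorm (invmx Lambda *m E2 w) <= K * \int[P]_w n2 w.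
Proof.
move=> i2; rewrite -(RintegralZl K measurableT i2).
apply: le_Rintegral => //; last by move=> w _; exact: hsnorm_mulmx_le.
  apply: L1_hsnorm => i j; apply: L1_mulmx_const => k l.
  exact: L1_E2.
exact: L1Zl.
Qed.

Let i0v k : L1 P (fun w => (fun=> 0 : 'cV[R]_d) w k 0).
Proof. by under eq_fun do rewrite mxE; exact: (L1_cst P 0). Qed.

Let i0m k i : L1 P (fun w => (fun=> 0 : 'M[R]_d) w k i).
Proof. by under eq_fun do rewrite mxE; exact: (L1_cst P 0). Qed.

Let Rint0 m n (B : 'M[R]_(m, n)) l : \int[P]_w hsnorm (B *m (0 : 'M[R]_(n, l))) = 0.
Proof. by rewrite mulmx0 hsnorm0 (Rintegral_prob_cst P). Qed.

Let x1_ge0 : 0 <= \int[P]_w n1 w.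
Proof. by apply: Rintegral_ge0 => w _; exact: hsnorm_ge0. Qed.

Let x2_ge0 : 0 <= \int[P]_w n2 w.
Proof. by apply: Rintegral_ge0 => w _; exact: hsnorm_ge0. Qed.

Let K_gt0 : (0 < d)%N -> 0 < K.
Proof.
rewrite /K; case: d Lambda hLambda => // d' L uL _.
by apply: opnorm_unitmx_gt0; rewrite unitmx_inv.
Qed.

Let W_mean k : \int[P]_w W w k 0 = 0.
Proof. by have := hmean k; rewrite (expectation_Rintegral (hint k)) => -[]. Qed.

(** When sup |D^2 g| = 0 the bound loses E_2 even if its mean is infinite, and then integration by
    parts is out of reach. An affine function depends on the means alone, and both are 0. *)
Let affine_estimate (g : 'cV[R]_d -> R) c : continuous g ->
  (forall x, g x = g 0 + \sum_k c k * x k 0) ->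
  (`|'E_P[g \o F \o X 0%R] - 'E_P'[g \o Z]| <= 0)%E.
Proof.
move=> cg gE.
have mean dV (V : measurableType dV) (m : probability V R) (Y : V -> 'cV[R]_d) :
    (forall k, L1 m (fun w => Y w k 0)) -> (forall k, \int[m]_w Y w k 0 = 0) ->
    L1 m (fun w => g (Y w)) /\ \int[m]_w g (Y w) = g 0.
  move=> iY Y0; have iS : L1 m (fun w => \sum_k c k * Y w k 0).
    by apply: L1_sum => k; exact: L1Zl.
  split; first by apply: L1_ext (L1D (L1_cst m (g 0)) iS) => w; rewrite [RHS]gE.
  rewrite (@eq_Rintegral _ _ _ m setT (fun w => g 0 + \sum_k c k * Y w k 0)); last first.
    by move=> w _; rewrite [LHS]gE.
  rewrite (RintegralD measurableT (L1_cst m (g 0)) iS) Rintegral_prob_cst.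
  rewrite Rintegral_sum; last by move=> k; exact: L1Zl.
  rewrite big1 ?addr0// => k _.
  by rewrite (RintegralZl _ measurableT (iY k)) Y0 mulr0.
have Av_mean k : \int[gamma]_v (A *m (v : 'cV[R]_d)) k 0 = 0.
  rewrite (@eq_Rintegral _ _ _ gamma setT (fun v : borelV R d => \sum_i A k i * v i 0)).
    rewrite Rintegral_sum; last by move=> i; apply: L1Zl; exact: L1_gaussian_coord.
    apply: big1 => i _; rewrite (RintegralZl _ measurableT (L1_gaussian_coord gammaN i)).
    by rewrite gaussian_mean// mulr0.
  by move=> v _; rewrite mxE.
have [j1 e1] := mean _ _ P W hint W_mean.
have [j2 e2] := mean _ _ gamma _ iAv Av_mean.
by apply: difference => //; rewrite e1 e2 subrr normr0.
Qed.

Let constant_estimate (g : 'cV[R]_d -> R) : continuous g -> (forall x, g x = g 0) ->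
  (`|'E_P[g \o F \o X 0%R] - 'E_P'[g \o Z]| <= 0)%E.
Proof.
move=> cg gc; apply: (affine_estimate (c := fun=> 0) cg) => x.
by rewrite big1 ?addr0// => k _; rewrite mul0r.
Qed.

Let law_estimate (g : 'cV[R]_d -> R) : L1 P n1 -> L1 P n2 ->
  \int[P]_w n1 w = 0 -> \int[P]_w n2 w = 0 -> continuous g ->
  ('E_P[g \o F \o X 0%R] +? - 'E_P'[g \o Z])%E ->
  `|'E_P[g \o F \o X 0%R] - 'E_P'[g \o Z]|%E = 0%E.
Proof.
move=> i1 i2 x10 x20 cg; have hL' := hL0 i1 x10; have hG' := hG0 i2 x20.
have lawP (h : 'cV[R]_d -> R) a : 0 <= a -> euclid_lipschitz a h ->
    \int[P]_w h (W w) = \int[P']_w h (Z w).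
  move=> a0 ha.
  have := statistic_lipschitz_bound0 hX hF hFF hint hlim hLambda i0v i0m hL' hG'
    gammaN AAT a0 ha (fun=> erefl).
  rewrite Rint0 mulr0 normr_le0 subr_eq0 => /eqP E; rewrite [LHS]E.
  apply/esym; apply: (law_Rintegral mZ mAv hZ (f := h : borelV R d -> R)).
  by apply: continuous_measurable_borelM; exact: euclid_lipschitz_continuous ha.
have E : 'E_P[g \o F \o X 0%R]%E = 'E_P'[g \o Z]%E.
  rewrite !expectation_integral; apply: (law_integral mW mZ _ (f := EFin \o (g : borelV R d -> R))).
    by move=> B mB; exact: (lipschitz_determines_law mW mZ lawP).
  by apply/measurable_EFinP; exact: continuous_measurable_borelM.
(* Were the common expectation infinite, the difference would be oo - oo, which [+?] excludes. *)
rewrite E; case: ('E_P'[g \o Z])%E => [r| |] //= _.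
by rewrite subrr normr0.
Qed.

Lemma smooth_estimate (g : 'cV[R]_d -> R) : class_C2 g ->
  ('E_P[g \o F \o X 0%R] +? - 'E_P'[g \o Z])%E ->
  (`|'E_P[g \o F \o X 0%R] - 'E_P'[g \o Z]| <=
   K%:E * (supnorm (fun x => enorm (gradient g x)) * 'E_P[n1]
     + (2^-1)%R%:E * supnorm (fun x => hsnorm (hessian g x)) * 'E_P[n2]))%E.
Proof.
move=> C2g wd; have cg : continuous g by case: C2g.
have K0 : 0 <= K := opnorm_ge0 _.
have ca := supnorm_cases (fun x => hsnorm_ge0 (gradient g x)).
have cb := supnorm_cases (fun x => hsnorm_ge0 (hessian g x)).
(* In dimension 0 the gradient has norm 0; so a positive [a] forces d > 0, and with it K > 0. *)
have dim0 : d = 0%N -> (supnorm (fun x => enorm (gradient g x)) <= 0)%E.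
  move=> d0; apply: ge_ereal_sup => _ [x _ <-]; rewrite lee_fin ger0_norm ?hsnorm_ge0//.
  rewrite /hsnorm big1 ?sqrtr0// => i; by have := ltn_ord i; rewrite [X in (_ < X)%N]d0.
move: ca cb dim0; set a := supnorm _; set b := supnorm (fun x => hsnorm (hessian g x)) => ca cb dim0.
have a0 : (0 <= a)%E by case: ca => [->|[r [r0 -> _]]]; rewrite ?lee_fin// leey.
have b0 : (0 <= b)%E by case: cb => [->|[r [r0 -> _]]]; rewrite ?lee_fin// leey.
have x10 := expectation_nneg P (fun w => hsnorm_ge0 (E1 w)).
have x20 := expectation_nneg P (fun w => hsnorm_ge0 (E2 w)).
have u0 : (0 <= a * 'E_P[n1])%E by exact: mule_ge0.
have hb0 : (0 <= (2^-1)%R%:E * b)%E by apply: mule_ge0 => //; rewrite lee_fin.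
have v0 : (0 <= (2^-1)%R%:E * b * 'E_P[n2])%E by exact: mule_ge0.
have rhs0 : (0 <= K%:E * (a * 'E_P[n1] + (2^-1)%R%:E * b * 'E_P[n2]))%E.
  by apply: mule_ge0; [rewrite lee_fin|exact: adde_ge0].
(* Vanishing sup norms are settled apart: since 0 * +oo = 0, the bound then says nothing about the
   corresponding mean, which may be infinite. *)
have [aeq0|a_neq0] := eqVneq a 0%E.
  case: ca => [aoo|[r [r0 aE ha]]]; first by rewrite aoo in aeq0.
  have r00 : r = 0 by move: aeq0; rewrite aE => -[].
  apply: le_trans (constant_estimate cg _) rhs0 => x.
  apply/eqP; rewrite -subr_eq0 -normr_le0.
  by have := gradient_euclid_lipschitz (class_C2_C1 C2g).1 ha x 0; rewrite r00 mul0r.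
have [beq0|b_neq0] := eqVneq b 0%E.
  case: cb => [boo|[r [r0 bE hb]]]; first by rewrite boo in beq0.
  have r00 : r = 0 by move: beq0; rewrite bE => -[].
  apply: le_trans (affine_estimate cg _) rhs0.
  by apply: affine_of_hessian0 => //; rewrite -r00.
have agt0 : (0 < a)%E by rewrite lt_neqAle eq_sym a_neq0.
have bgt0 : (0 < b)%E by rewrite lt_neqAle eq_sym b_neq0.
have hbgt0 : (0 < (2^-1)%R%:E * b)%E by rewrite mule_gt0// lte_fin.
have Kgt0 : 0 < K.
  by apply: K_gt0; rewrite lt0n; apply/eqP => /dim0; rewrite leNgt agt0.
(* Both sup norms and [K] are now positive, so an infinite mean makes the right-hand side
   infinite. *)
have [e1oo|[i1 e1E]] := expectation_cases P mn1 (fun w => hsnorm_ge0 (E1 w)).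
  rewrite mule_pinfty_addl ?leey//; left.
  by rewrite [X in (_ * X)%E]e1oo gt0_muley.
have [e2oo|[i2 e2E]] := expectation_cases P mn2 (fun w => hsnorm_ge0 (E2 w)).
  rewrite mule_pinfty_addl ?leey//; right.
  by rewrite [X in (_ * X)%E]e2oo gt0_muley.
have U1 := U_le i1; have N1 := N_le i2.
have x1oo : a = +oo%E -> \int[P]_w n1 w != 0 -> (a * 'E_P[n1])%E = +oo%E.
  move=> -> x1; rewrite [X in (_ * X)%E]e1E gt0_mulye// lte_fin lt_neqAle eq_sym x1.
  exact: x1_ge0.
have x2oo : b = +oo%E -> \int[P]_w n2 w != 0 ->
    ((2^-1)%R%:E * b * 'E_P[n2])%E = +oo%E.
  move=> -> x2; rewrite [X in (_ * X)%E]e2E gt0_muley ?lte_fin// gt0_mulye//.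
  by rewrite lte_fin lt_neqAle eq_sym x2; exact: x2_ge0.
(* Both means are finite from here on. An infinite sup norm makes the bound vacuous unless the mean
   that it multiplies is 0. *)
case: ca => [aoo|[r [r0 aE ha]]].
  have [x1|x1] := eqVneq (\int[P]_w n1 w) 0; last first.
    by rewrite mule_pinfty_addl ?leey//; left; exact: x1oo.
  case: cb => [boo|[s [s0 bE hb]]].
    have [x2|x2] := eqVneq (\int[P]_w n2 w) 0; last first.
      by rewrite mule_pinfty_addl ?leey//; right; exact: x2oo.
    by rewrite law_estimate.
  have [j1 j2 h] := statistic_hessian_bound hX hF hFF hint hlim hLambda i0v
    (L1_E2 i2) (hL0 i1 x1) hGamma gammaN AAT C2g hb (lexx 0) (or_intror (fun=> erefl)).
  apply: le_trans (difference cg j1 j2 h) _.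
  rewrite [X in (_ * X + _)%E]e1E x1 mule0 add0e [X in (_ * (_ * X))%E]e2E bE -!EFinM.
  rewrite lee_fin mul0r add0r [leRHS]mulrCA -[leRHS]mulrA ler_wpM2l//.
  by rewrite mulrCA [leRHS]mulrCA ler_wpM2l.
have gr := gradient_euclid_lipschitz (class_C2_C1 C2g).1 ha.
case: cb => [boo|[s [s0 bE hb]]].
  have [x2|x2] := eqVneq (\int[P]_w n2 w) 0; last first.
    by rewrite mule_pinfty_addl ?leey//; right; exact: x2oo.
  have h := statistic_lipschitz_bound0 hX hF hFF hint hlim hLambda (L1_E1 i1) i0m
    hL (hG0 i2 x2) gammaN AAT r0 gr (fun=> erefl).
  apply: le_trans (difference cg (L1_lipschitz gr hint) (L1_lipschitz gr iAv) h) _.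
  rewrite [X in (_ * (_ + _ * X))%E]e2E x2 mule0 adde0 [X in (_ * (_ * X))%E]e1E aE -!EFinM.
  by rewrite lee_fin [leRHS]mulrCA ler_wpM2l.
have [j1 j2 h] := statistic_hessian_bound hX hF hFF hint hlim hLambda (L1_E1 i1)
  (L1_E2 i2) hL hGamma gammaN AAT C2g hb r0 (or_introl ha).
apply: le_trans (difference cg j1 j2 h) _.
rewrite [X in (_ * (_ * X + _))%E]e1E [X in (_ * (_ + _ * X))%E]e2E aE bE -!EFinM.
rewrite lee_fin mulrDr [X in _ <= X + _]mulrCA lerD ?ler_wpM2l//.
rewrite [leRHS]mulrCA -[leRHS]mulrA ler_wpM2l//.
by rewrite mulrCA [leRHS]mulrCA ler_wpM2l.
Qed.

Lemma wasserstein_estimate (Q : 'M[R]_d) : Sigma \in unitmx -> psdmx Q ->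
  Q *m Q = invmx Sigma ->
  (wasserstein P P' (F \o X 0%R) Z <=
   K%:E * ('E_P[n1] + (opnorm Q)%:E * 'E_P[n2]))%E.
Proof.
move=> uSigma [QT _] QQ.
have K0 : 0 <= K := opnorm_ge0 _.
have q0 : 0 <= opnorm Q := opnorm_ge0 _.
have x10 := expectation_nneg P (fun w => hsnorm_ge0 (E1 w)).
have x20 := expectation_nneg P (fun w => hsnorm_ge0 (E2 w)).
have v0 : (0 <= (opnorm Q)%:E * 'E_P[n2])%E by apply: mule_ge0; rewrite ?lee_fin.
have rhs0 : (0 <= K%:E * ('E_P[n1] + (opnorm Q)%:E * 'E_P[n2]))%E.
  by apply: mule_ge0; [rewrite lee_fin|exact: adde_ge0].
apply: ge_ereal_sup => _ [g g1 <-].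
have gr : euclid_lipschitz 1 g by move=> x y; rewrite mul1r; exact: g1.
have cg : continuous g := euclid_lipschitz_continuous gr.
(* In dimension 0 the factor [K] is 0 and would hide an infinite mean; there [g] is constant. *)
have [d0|dgt0] := posnP d.
  apply: le_trans (constant_estimate cg _) rhs0 => x; congr g.
  by apply/matrixP => i; have := ltn_ord i; rewrite [X in (_ < X)%N]d0.
have Kgt0 := K_gt0 dgt0.
have qgt0 : 0 < opnorm Q.
  have uQ : Q \in unitmx.
    have : Q *m Q \in unitmx by rewrite QQ unitmx_inv.
    by rewrite unitmx_mul => /andP[].
  move: dgt0 Q uQ {QT QQ q0 v0 rhs0}; case: d => // d' _ Q uQ.
  exact: opnorm_unitmx_gt0.
have [e1oo|[i1 e1E]] := expectation_cases P mn1 (fun w => hsnorm_ge0 (E1 w)).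
  by rewrite mule_pinfty_addl ?leey//; left.
have [e2oo|[i2 e2E]] := expectation_cases P mn2 (fun w => hsnorm_ge0 (E2 w)).
  rewrite mule_pinfty_addl ?leey//; right.
  by rewrite [X in (_ * X)%E]e2oo gt0_muley.
have uA : A \in unitmx.
  by move: uSigma; rewrite -AAT unitmx_mul => /andP[].
(* [A] need not be symmetric, so A^-1 and [Q] may differ; their link is that both give Sigma^-1 as
   Gram matrix. *)
have invS : invmx Sigma = (invmx A)^T *m invmx A.
  apply: (can_inj (mulKmx uSigma)); rewrite mulmxV// -AAT trmx_inv -mulmxA.
  by rewrite (mulmxA A^T) mulmxV ?unitmx_tr// mul1mx mulmxV.
have h := statistic_lipschitz_bound hX hF hFF hint hlim hLambda (L1_E1 i1)
  (L1_E2 i2) hL hGamma gammaN AAT ler01 gr (mulmxV uA).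
apply: le_trans (difference cg (L1_lipschitz gr hint) (L1_lipschitz gr iAv) h) _.
rewrite [X in (_ * (X + _))%E]e1E [X in (_ * (_ + _ * X))%E]e2E -!EFinM.
rewrite lee_fin !mul1r mulrDr lerD//; first exact: U_le.
rewrite mulrCA; apply: (@le_trans _ _ (opnorm Q * \int[P]_w hsnorm (invmx Lambda *m E2 w))).
  have iN i j : L1 P (fun w => (invmx Lambda *m E2 w) i j).
    by apply: L1_mulmx_const => k l; exact: L1_E2.
  rewrite -(RintegralZl (opnorm Q) measurableT (L1_hsnorm iN)).
  apply: le_Rintegral => //.
  - apply: L1_hsnorm => i j; under eq_fun do rewrite mxE.
    by apply: L1_sum => k; exact: L1Zr.
  - by apply: L1Zl; exact: L1_hsnorm.
  move=> w _; set N := invmx Lambda *m E2 w.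
  (* A^-1 and Q have the same Gram matrix Sigma^-1. *)
  have -> : hsnorm (N *m (invmx A)^T) = hsnorm (Q *m N^T).
    rewrite -hsnorm_tr trmx_mul trmxK !hsnorm_gram !trmx_mul !trmxK QT.
    by rewrite !mulmxA -(mulmxA _ Q Q) QQ invS !mulmxA.
  by apply: le_trans (hsnorm_mulmx_le _ _) _; rewrite hsnorm_tr.
by rewrite ler_wpM2l//; exact: N_le.
Qed.

End main_estimates.

Theorem theorem3 (R : realType)
  (* the process *)
  (dT : measure_display) (T : measurableType dT) (P : probability T R)
  (dS : measure_display) (S : measurableType dS) (mu : probability S R)
  (p : R -> R.-pker S ~> S) (X : R -> T -> S)
  (hX : stationary_reversible_markov P mu p X)
  (* the statistic *)
  (d : nat) (F : S -> 'cV[R]_d)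
  (hF : generatorV_domain p F) (hFF : carre_du_champV_domain p F F)
  (hint : forall j, P.-integrable setT (EFin \o (component F j \o X 0)))
  (hmean : forall j, ('E_P[component F j \o X 0%R] = 0)%E)
  (* the data *)
  (Lambda Sigma : 'M[R]_d)
  (hLambda : Lambda \in unitmx) (hSigma : psdmx Sigma)
  (E1 : T -> 'cV[R]_d) (E2 : T -> 'M[R]_d)
  (hE1 : measurable_wrt (X 0) (E1 : T -> borelV R d))
  (hE2 : measurable_wrt (X 0) (E2 : T -> borelM R d d))
  (hL : {ae P, forall w,
     generatorV p F (X 0 w) = - (Lambda *m F (X 0 w)) + E1 w})
  (hGamma : {ae P, forall w,
     carre_du_champV p F F (X 0 w) = Lambda *m Sigma + E2 w})
  (hlim : forall rho : R, 0 < rho ->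
     ((t^-1)%:E * 'E_P[(fun w => enorm (F (X t w) - F (X 0 w)) ^+ 2
                         * (rho < enorm (F (X t w) - F (X 0 w)))%R%:R)%R]
       @[t --> 0^'+] --> 0)%E)
  (* Z_Sigma, on a probability space of its own *)
  (dT' : measure_display) (T' : measurableType dT') (P' : probability T' R)
  (Z : T' -> 'cV[R]_d) (hZ : normal_vector P' Sigma Z) :
  (forall g : 'cV[R]_d -> R, class_C2 g ->
     (* the left-hand side is not of the form oo - oo *)
     ('E_P[g \o F \o X 0%R] +? - 'E_P'[g \o Z])%E ->
     (`|'E_P[g \o F \o X 0%R] - 'E_P'[g \o Z]| <=
      (opnorm (invmx Lambda))%:E *
      (supnorm (fun x => enorm (gradient g x)) * 'E_P[fun w => enorm (E1 w)]
       + (2^-1)%R%:E * supnorm (fun x => hsnorm (hessian g x))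
         * 'E_P[fun w => hsnorm (E2 w)]))%E)
  /\
  (Sigma \in unitmx ->
   (* Q is Sigma^(-1/2) *)
   forall Q : 'M[R]_d, psdmx Q -> Q *m Q = invmx Sigma ->
     (wasserstein P P' (F \o X 0%R) Z <=
      (opnorm (invmx Lambda))%:E *
      ('E_P[fun w => enorm (E1 w)]
       + (opnorm Q)%:E * 'E_P[fun w => hsnorm (E2 w)]))%E).
Proof.
have mX0 : measurable_fun setT (X 0) by exact: (markov_measurable hX).
have mE1 := measurable_wrt_measurable mX0 hE1.
have mE2 := measurable_wrt_measurable mX0 hE2.
have [mZ [gamma [A [gammaN AAT lawZ]]]] := hZ.
split => [g C2g wd|uSigma Q psdQ QQ].
  exact: (smooth_estimate hX hF hFF hint hmean hLambda mE1 mE2 hL hGamma hlim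
    mZ gammaN AAT lawZ C2g wd).
exact: (wasserstein_estimate hX hF hFF hint hmean hLambda mE1 mE2 hL hGamma hlim
  mZ gammaN AAT lawZ uSigma psdQ QQ).
Qed.
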